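(* Fix $m\in\mathbb N$. For $n\in\mathbb N$, let $(X_{1n},\dots,X_{mn})$ be vectors of non-negative random variables. Suppose that $\mu_{in}$ and $\sigma_{in}$ are positive real numbers such that for each $1\le i\le m$, as $n\to\infty$, $$\sigma_{in}\ll\mu_{in}\ll\sigma_{in}^3.$$ Let $\Gamma:=(\gamma_{ij})_{i,j=1}^m$ be a fixed real symmetric matrix. Let $c>0$ be a constant, and suppose further that, as $n\to\infty$, uniformly for all integer sequences $(k_{in})_{i=1}^m$ with $0\le k_{in}\le c\,\mu_{in}/\sigma_{in}$, $$\mathbb E\prod_{i=1}^m(X_{in})_{k_{in}}=\prod_{i=1}^m\mu_{in}^{k_{in}}\cdot\exp\left(\frac12\sum_{i,j=1}^m\frac{\gamma_{ij}\sigma_{in}\sigma_{jn}-\delta_{ij}\mu_{in}}{\mu_{in}\mu_{jn}}k_{in}k_{jn}+o(1)\right).$$ Then $$\left(\frac{X_{1n}-\mu_{1n}}{\sigma_{1n}},\dots,\frac{X_{mn}-\mu_{mn}}{\sigma_{mn}}\right)\to\mathrm N(0,\Gamma)\quad\text{in distribution, as }n\to\infty.$$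
   Context: For positive sequences, $a_n\ll b_n$ means $a_n/b_n\to0$ as $n\to\infty$. For real $x$ and $q\in\{0,1,2,\dots\}$, $(x)_q:=x(x-1)\cdots(x-q+1)$ is the falling factorial, with $(x)_0:=1$. $\delta_{ij}$ is Kronecker's delta. $\mathrm N(0,\Gamma)$ is the multivariate normal distribution with mean $0$ and covariance matrix $\Gamma$ (possibly singular or zero); positive semidefiniteness of $\Gamma$ is not assumed, and the existence of $\mathrm N(0,\Gamma)$ is part of the assertion. The random variables are not assumed to be integer-valued. *)

(* Defs.v *)
From HB Require Import structures.
From mathcomp Require Import all_boot all_order all_algebra.
From mathcomp Require Import all_classical all_reals all_analysis.

Set Implicit Arguments.
Unset Strict Implicit.
Unset Printing Implicit Defensive.
Import Order.TTheory GRing.Theory Num.Theory.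
Import numFieldNormedType.Exports.

Local Open Scope classical_set_scope.
Local Open Scope ring_scope.

Definition much_less (R : realType) (a b : R^nat) : Prop :=
  a n / b n @[n --> \oo] --> (0 : R).

Definition falling (R : realType) (x : R) (q : nat) : R :=
  \prod_(j < q) (x - j%:R).

(* R^m with its Borel sigma-algebra. *)
Notation borel_rV R m := (g_sigma_algebraType (@open 'rV[R]_m)).

(* The library's normal_prob is the uniform law on [0, 1] when s = 0; the normal
   law with zero variance is the Dirac mass at its mean. *)
Definition normal_law (R : realType) (a s : R) (A : set R) : \bar R :=
  if s == 0 then \d_a A else normal_prob a s A.

(* nu is N(0, Gamma): every linear combination of the coordinates is normal
   (possibly degenerate), the mean is 0 and the covariance matrix is Gamma. *)
Definition multinormal (R : realType) (m : nat)
    (nu : probability (borel_rV R m) R) (Gamma : 'M[R]_m) : Prop :=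
  [/\ forall t : 'rV[R]_m, exists a s : R, 0 <= s /\
        forall A : set R, measurable A ->
          nu [set x : 'rV[R]_m | A (\sum_(i < m) t ord0 i * x ord0 i)] =
          normal_law a s A,
      forall i, ('E_nu[fun x : 'rV[R]_m => x ord0 i] = 0)%E
    & forall i j, covariance nu (fun x : 'rV[R]_m => x ord0 i)
                                (fun x : 'rV[R]_m => x ord0 j) =
                  (Gamma i j)%:E].

Definition cvg_in_distribution (R : realType) (m : nat)
    (d : nat -> measure_display) (T : forall n, measurableType (d n))
    (P : forall n, probability (T n) R) (Y : forall n, T n -> 'rV[R]_m)
    (nu : probability (borel_rV R m) R) : Prop :=
  forall f : 'rV[R]_m -> R, continuous f ->
    (exists M : R, forall x, `|f x| <= M) ->
    ('E_(P n)[f \o Y n] @[n --> \oo] --> 'E_nu[f])%E.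

(* Main.v *)
Require Import Defs.
From HB Require Import structures.
From mathcomp Require Import all_boot all_order all_algebra.
From mathcomp Require Import all_classical all_reals all_analysis.
From mathcomp Require Import measurable_realfun ring lra.

Set Implicit Arguments.
Unset Strict Implicit.
Unset Printing Implicit Defensive.
Import Order.TTheory GRing.Theory Num.Theory.
Import numFieldNormedType.Exports.

Local Open Scope classical_set_scope.
Local Open Scope ring_scope.

(** The idea is to read factorial moments as exponential moments. Put
    [y = (x - mu) / sigma]. When [y] stays bounded and [k] is about
    [t mu / sigma], the number [(x)_k / mu^k * e^(k^2 / (2 mu))] is close to
    [e^(t y)]. The last factor cancels the terms [- delta_ij mu_i] of the
    hypothesis, which therefore says that [E e^(t . Y_n)] tends to
    [e^(t Gamma t^T / 2)] for [t] in [[0, c]^m], where [Y_n] is the standardized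
    vector. Taken literally this may fail, as [Y_n] can have infinite exponential
    moments; but it holds after truncation of [Y_n] to a box [|y_i| <= K], when
    first [n] and then [K] tend to infinity ([standardized_mgf_cvg]). Indeed,
    after the addition of a small constant the normalized falling factorial is
    nonnegative ([vfall_ge0]), and outside of the box it is at most an
    exponentially small multiple of a moment in which one coordinate of [t] is
    replaced by 0 or by [c] ([vfall_le_tail_low], [vfall_le_tail_high]).

    The second ingredient is a continuity theorem for such truncated moment
    generating functions, known only on an open cube of exponents
    ([mgf_cvg_in_law]). It rests on an approximation theorem
    ([mexp_approx_bounded]): every bounded continuous function on [R^m] is
    approximated by real exponential sums with arbitrarily small exponents, with
    an error that is weighted by a product of hyperbolic cosines. The functions
    approximated on the way are powers, trigonometric functions, powers of sines,
    and Bernstein polynomials in sines. A test function is cut off, multiplied by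
    [e^(- t0 . y)] where [t0] is the centre of the cube, approximated, and
    multiplied back by [e^(t0 . y)]; all exponents that occur are then in the
    cube.

    It remains to exhibit the limit. Moment generating functions are log-convex
    and so are their limits, which forces [Gamma] to be positive semidefinite
    ([box_mgf_psd]); a Cholesky factorization ([psd_sum_sqr]) then gives a law
    [nu] with moment generating function [e^(t Gamma t^T / 2)]
    ([gauss_law_exists]). The continuity theorem applied to constant sequences
    shows that a moment generating function determines a law on the line
    ([mgf_law_unique]), so linear forms are normal under [nu]; differentiation at
    0 gives the mean and the covariance ([multinormal_of_mgf]). *)

(** * Approximation by real exponential sums on the line *)

Definition expsum (R : realType) (s : seq (R * R)) (y : R) : R :=
  \sum_(p <- s) p.1 * expR (p.2 * y).

Definition cosh2 (R : realType) (rho y : R) : R :=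
  expR (rho * y) + expR (- (rho * y)).

(** A bounded nonconstant function is not a uniform limit of real exponential
    sums, so the error is weighted by [cosh2 rho]. The weight is an exponential sum with
    exponents in [[- rho, rho]], hence it is integrated by the same moments as the
    approximating sums, and [rho] can be taken arbitrarily small. *)
Definition exp_approx (R : realType) (rho : R) (g : R -> R) : Prop :=
  forall eps, 0 < eps ->
    exists2 s : seq (R * R), (forall p, p \in s -> `|p.2| <= rho) &
      forall y, `|g y - expsum s y| <= eps * cosh2 rho y.

Lemma cosh2_ge (R : realType) (rho r y : R) :
  r <= rho -> expR (r * `|y|) <= cosh2 rho y.
Proof.
move=> rr; apply: (@le_trans _ _ (expR (rho * `|y|))).
  by rewrite ler_expR ler_wpM2r.
rewrite /cosh2; have [y0|y0] := ger0P y.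
  by rewrite lerDl expR_ge0.
by rewrite mulrN lerDr expR_ge0.
Qed.

Lemma cosh2_ge1 (R : realType) (rho y : R) : 0 <= rho -> 1 <= cosh2 rho y.
Proof. by move=> r0; have := cosh2_ge y r0; rewrite mul0r expR0. Qed.

Lemma expsum_cat (R : realType) (s1 s2 : seq (R * R)) y :
  expsum (s1 ++ s2) y = expsum s1 y + expsum s2 y.
Proof. by rewrite /expsum big_cat. Qed.

Lemma expsum_scale (R : realType) (a : R) (s : seq (R * R)) y :
  expsum [seq (a * p.1, p.2) | p <- s] y = a * expsum s y.
Proof.
by rewrite /expsum big_map big_distrr /=; apply: eq_bigr => p _; rewrite mulrA.
Qed.

Lemma exp_approx_ext (R : realType) (rho : R) (g1 g2 : R -> R) :
  g1 =1 g2 -> exp_approx rho g1 -> exp_approx rho g2.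
Proof. by move=> /funext ->. Qed.

Lemma exp_approx0 (R : realType) (rho : R) : exp_approx rho (fun=> 0).
Proof.
move=> e e0; exists [::] => // y; rewrite /expsum big_nil subrr normr0.
by rewrite mulr_ge0 ?ltW// addr_gt0 ?expR_gt0.
Qed.

Lemma exp_approxZ (R : realType) (rho a : R) (g : R -> R) :
  exp_approx rho g -> exp_approx rho (fun y => a * g y).
Proof.
move=> ag e e0; have a1 : 0 < `|a| + 1 by rewrite ltr_wpDl.
have [s s1 s2] := ag (e / (`|a| + 1)) (divr_gt0 e0 a1).
exists [seq (a * p.1, p.2) | p <- s].
  by move=> q /mapP[p ps ->] /=; exact: s1.
move=> y; rewrite expsum_scale -mulrBr normrM.
apply: le_trans (ler_wpM2l (normr_ge0 _) (s2 y)) _.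
have C0 : 0 <= cosh2 rho y by rewrite addr_ge0 ?expR_ge0.
rewrite mulrA ler_wpM2r// mulrA ler_pdivrMr// mulrC ler_wpM2l ?ltW//.
by rewrite ltrDl.
Qed.

Lemma exp_approxD (R : realType) (rho : R) (g1 g2 : R -> R) :
  exp_approx rho g1 -> exp_approx rho g2 ->
  exp_approx rho (fun y => g1 y + g2 y).
Proof.
move=> a1 a2 e e0; have e20 : 0 < e / 2 by rewrite divr_gt0.
have [s1 s11 s12] := a1 _ e20; have [s2 s21 s22] := a2 _ e20.
exists (s1 ++ s2).
  by move=> p; rewrite mem_cat => /orP[/s11|/s21].
move=> y; rewrite expsum_cat opprD addrACA (splitr e) mulrDl.
by apply: le_trans (ler_normD _ _) _; rewrite lerD.
Qed.

Lemma exp_approx_sum (R : realType) (rho : R) I (r : seq I) (g : I -> R -> R) :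
  (forall i, exp_approx rho (g i)) ->
  exp_approx rho (fun y => \sum_(i <- r) g i y).
Proof.
move=> ag; elim: r => [|i r ih].
  by apply: exp_approx_ext (exp_approx0 _) => y; rewrite big_nil.
by apply: exp_approx_ext (exp_approxD (ag i) ih) => y; rewrite big_cons.
Qed.

Lemma exp_approx_lim (R : realType) (rho : R) (g : R -> R) :
  (forall eps, 0 < eps -> exists2 g', exp_approx rho g' &
     forall y, `|g y - g' y| <= eps * cosh2 rho y) ->
  exp_approx rho g.
Proof.
move=> H e e0; have e20 : 0 < e / 2 by rewrite divr_gt0.
have [g' ag' gg'] := H _ e20; have [s s1 s2] := ag' _ e20.
exists s => // y; rewrite -(subrKA (g' y)) (splitr e) mulrDl.
by apply: le_trans (ler_normD _ _) _; rewrite lerD.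
Qed.

(** A single term of the exponential series. *)
Lemma exprn_le_expR (R : realType) (a y : R) q : 0 < a ->
  `|y| ^+ q <= q`!%:R / a ^+ q * expR (a * `|y|).
Proof.
move=> a0; have ay : 0 <= a * `|y|; first by rewrite mulr_ge0 // ltW.
case: q => [|q]; first by rewrite !expr0 fact0 divr1 mul1r -expR0 ler_expR.
have := expR_ge1Dxn q ay; rewrite exprMn => H.
rewrite mulrAC ler_pdivlMr ?exprn_gt0// -ler_pdivrMl ?ltr0n ?fact_gt0//.
by rewrite (le_trans _ H)// mulrC [X in X / _]mulrC lerDr.
Qed.

Lemma expR_sub1_le (R : realType) (u : R) :
  `|expR u - 1| <= `|u| * expR `|u|.
Proof.
have := expR_ge1Dx u; have := expR_ge1Dx (- u).
rewrite expRN => h1 h2; have E0 := expR_gt0 u.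
have [u0|u0] := ger0P u.
  rewrite ger0_norm; last lra.
  have : (1 - u) * expR u <= 1 by rewrite -ler_pdivlMr// mul1r.
  lra.
rewrite expRN ler0_norm; last first.
  by rewrite subr_le0 -expR0 ler_expR ltW.
rewrite opprB.
have : 1 <= (expR u)^-1 by rewrite invf_ge1// -expR0 ler_expR ltW.
have : 1 - expR u <= - u by lra.
nra.
Qed.

Lemma expR_sub1_sub_le (R : realType) (u : R) :
  `|expR u - 1 - u| <= u ^+ 2 * expR `|u|.
Proof.
have h1 := expR_ge1Dx u; have h2 := expR_ge1Dx (- u).
rewrite ger0_norm; last lra.
have E0 := expR_gt0 u; move: h2; rewrite expRN => h2.
have E1 : 1 <= expR `|u| by rewrite -expR0 ler_expR.
have h3 : (1 - u) * expR u <= 1 by rewrite -ler_pdivlMr// mul1r.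
have [u0|u0] := ger0P u; first by nra.
rewrite expRN; have E2 : 1 <= (expR u)^-1 by rewrite invf_ge1// -expR0 ler_expR ltW.
have h4 : expR u - 1 - u <= u ^+ 2.
  suff : expR u <= 1 + u + u ^+ 2 by lra.
  have h5 : (1 - u) * expR u <= 1 by [].
  have : (1 - u) * (1 + u + u ^+ 2) >= 1.
    have -> : (1 - u) * (1 + u + u ^+ 2) = 1 - u ^+ 3 by ring.
    have : u ^+ 3 <= 0 by rewrite exprS; have := sqr_ge0 u; nra.
    lra.
  move=> h6; rewrite -(@ler_pM2l _ (1 - u)); lra.
have := sqr_ge0 u; nra.
Qed.

(** The difference quotient [((e^(h y) - 1) / h)^q] is an exponential sum with
    exponents at most [q h], and it tends to [y^q] as [h] tends to 0. *)
Lemma exp_approx_exprn (R : realType) (rho : R) q : 0 < rho ->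
  exp_approx rho (fun y => y ^+ q).
Proof.
move=> r0; apply: exp_approx_lim => e e0.
pose M : R := q%:R * (q.+1`!%:R / (rho / 2) ^+ q.+1).
have M0 : 0 <= M.
  by rewrite !mulr_ge0 ?ler0n// invr_ge0 exprn_ge0// ltW// divr_gt0.
(* The first bound makes the error small; the second one keeps the exponents
   below rho / 2, so that half of the weight is left to absorb powers of y. *)
pose h := Num.min (e / (M + 1)) (rho / 2 / q.+1%:R).
have h0 : 0 < h.
  rewrite lt_min !divr_gt0// ?ltr0n// ltr_wpDl//.
have h1 : h * M <= e.
  apply: (@le_trans _ _ (e / (M + 1) * M)).
    by rewrite ler_wpM2r// ge_min lexx.
  rewrite mulrAC ler_pdivrMr ?ltr_wpDl// ler_wpM2l ?ltW//; lra.
have h2 : q.+1%:R * h <= rho / 2.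
  by rewrite mulrC -ler_pdivlMr ?ltr0n// ge_min lexx orbT.
exists (fun y => ((expR (h * y) - 1) / h) ^+ q).
  move=> d d0.
  exists [seq (h ^- q * ((-1) ^+ (q - i) * 'C(q, i)%:R), i%:R * h) | i <- index_iota 0 q.+1].
    move=> p /mapP[i]; rewrite mem_index_iota => /andP[_ iq] -> /=.
    rewrite ger0_norm ?mulr_ge0 ?(ltW h0)//.
    apply: (@le_trans _ _ (q.+1%:R * h)).
      by rewrite ler_wpM2r ?ltW// ltr_nat.
    by rewrite (le_trans h2)// ler_pdivrMr// ler_peMr ?ltW// ltr1n.
  move=> y; rewrite (_ : _ - _ = 0).
    by rewrite normr0 mulr_ge0 ?ltW// addr_gt0 ?expR_gt0.
  apply/eqP; rewrite subr_eq0; apply/eqP.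
  rewrite expr_div_n addrC exprDn /expsum big_map big_mkord.
  rewrite mulrC big_distrr /=; apply: eq_bigr => i _.
  rewrite -mulrA -mulrA; congr (_ * _).
  rewrite -mulr_natr -mulrA; congr (_ * _).
  by rewrite mulrC -mulrA expRM_natl.
move=> y; set a := (expR (h * y) - 1) / h.
pose b := `|y| * expR (h * `|y|).
have hy : `|h * y| = h * `|y| by rewrite normrM gtr0_norm.
have b0 : 0 <= b by rewrite mulr_ge0 ?expR_ge0.
have ab : `|a| <= b.
  rewrite normrM normfV (gtr0_norm h0) ler_pdivrMr//.
  by rewrite (le_trans (expR_sub1_le _))// hy /b; lra.
have yb : `|y| <= b.
  by rewrite ler_peMr// -expR0 ler_expR mulr_ge0// ltW.
have ay : `|a - y| <= h * y ^+ 2 * expR (h * `|y|).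
  rewrite (_ : a - y = (expR (h * y) - 1 - h * y) / h); last first.
    by rewrite /a; field; rewrite gt_eqF.
  rewrite normrM normfV (gtr0_norm h0) ler_pdivrMr//.
  rewrite (le_trans (expR_sub1_sub_le _))// hy exprMn; lra.
rewrite distrC subrXX normrM.
have S : `|\sum_(i < q) a ^+ (q.-1 - i) * y ^+ i| <= q%:R * b ^+ q.-1.
  apply: le_trans (ler_norm_sum _ _ _) _.
  rewrite -[q in q%:R]card_ord mulrC -sum1_card natr_sum mulr_sumr.
  apply: ler_sum => i _; rewrite mulr1 normrM !normrX.
  have -> : b ^+ q.-1 = b ^+ (q.-1 - i) * b ^+ i.
    by rewrite -exprD subnK// -ltnS prednK//; case: (q) i => [[]|].
  by rewrite ler_pM ?exprn_ge0// lerXn2r// nnegrE.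
case: q @M M0 h h0 h1 h2 @a @b hy b0 ab yb ay S => [|q] M M0 h h0 h1 h2 a b hy b0 ab yb ay S.
  by rewrite big_ord0 normr0 mulr0 mulr_ge0 ?ltW// addr_gt0 ?expR_gt0.
apply: le_trans (ler_pM _ _ ay S) _ => //.
have -> : h * y ^+ 2 * expR (h * `|y|) * (q.+1%:R * b ^+ q.+1.-1) =
  h * q.+1%:R * (`|y| ^+ q.+2) * expR (q.+1%:R * (h * `|y|)).
  have -> : y ^+ 2 = `|y| ^+ 2 by rewrite real_normK// num_real.
  rewrite expRM_natl /b /= exprMn [expR _ ^+ q.+1]exprS [`|y| ^+ q.+2]exprS.
  by rewrite [`|y| ^+ q.+1]exprS; ring.
have := @exprn_le_expR R (rho / 2) y q.+2 (divr_gt0 r0 (ltr0Sn _ _)).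
have E : expR (q.+1%:R * (h * `|y|)) <= expR (rho / 2 * `|y|).
  rewrite ler_expR mulrA ler_wpM2r// (le_trans _ h2)// ler_wpM2r ?ltW//.
  by rewrite ltr_nat.
move=> F.
have hq : 0 <= h * q.+1%:R by rewrite mulr_ge0 ?ler0n// ltW.
rewrite -mulrA.
apply: le_trans (ler_wpM2l hq (ler_pM _ _ F E)) _; rewrite ?exprn_ge0 ?expR_ge0//.
rewrite -[X in _ * X]mulrA -expRD -mulrDl -splitr mulrA -[X in X * _]mulrA.
apply: ler_pM => //.
  by rewrite mulr_ge0// ltW.
exact: cosh2_ge.
Qed.

(** From the index [Q] on, [u^p / p!] is at most [2^-Q (2u)^p / p!], and the latter
    are terms of an exponential series. *)
Lemma series_coeff_dist (R : realType) (c : R^nat) (f u : R) Q :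
  (forall p, `|c p| <= `|u| ^+ p / p`!%:R) -> series c n @[n --> \oo] --> f ->
  `|f - series c Q| <= 2 ^- Q * expR (2 * `|u|).
Proof.
move=> cu cf.
have cvn : `|series c n - series c Q| @[n --> \oo] --> `|f - series c Q|.
  by apply: cvg_norm; apply: cvgB => //; exact: cvg_cst.
apply: (cvgr_to_le cvn); near=> n.
have Qn : (Q <= n)%N by near: n; exact: nbhs_infty_ge.
rewrite sub_series Qn.
apply: le_trans (ler_norm_sum _ _ _) _.
apply: (@le_trans _ _ (\sum_(Q <= p < n) 2 ^- Q * exp_coeff (2 * `|u|) p)).
  rewrite big_nat [leRHS]big_nat; apply: ler_sum => p /andP[Qp pn].
  rewrite (le_trans (cu p))// /exp_coeff /= exprMn mulrA.
  rewrite ler_wpM2r ?invr_ge0 ?ler0n// mulrA ler_peMl ?exprn_ge0//.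
  by rewrite -(subnK Qp) exprD mulrCA mulVf ?mulr1 ?exprn_ege1// ?ler1n// expf_neq0.
rewrite -big_distrr /= ler_wpM2l ?invr_ge0 ?exprn_ge0//.
apply: (@le_trans _ _ (series (exp_coeff (2 * `|u|)) n)).
  rewrite /series /= [leRHS](@big_cat_nat _ _ _ Q) //= lerDr sumr_ge0// => p _.
  by rewrite exp_coeff_ge0 // mulr_ge0.
apply: nondecreasing_cvgn_le.
  apply: nondecreasing_series => p _ _; by rewrite exp_coeff_ge0 // mulr_ge0.
exact: is_cvg_series_exp_coeff.
Unshelve. all: by end_near. Qed.

Lemma cos_power_series (R : realType) : exists c : R^nat, forall u Q,
  `|cos u - \sum_(p < Q) c p * u ^+ p| <= 2 ^- Q * expR (2 * `|u|).
Proof.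
exists (fun p => (~~ odd p)%:R * (-1) ^+ p./2 * p`!%:R^-1) => u Q; set S := \sum_(p < Q) _.
suff -> : S = series (cos_coeff u) Q.
  apply: series_coeff_dist; last by rewrite unlock; exact: is_cvg_series_cos_coeff.
  move=> p; rewrite /cos_coeff /= !normrM normfV !normr_nat !normrX normrN normr1.
  by rewrite expr1n mulr1; case: odd; [rewrite !mul0r divr_ge0 | rewrite mul1r].
by rewrite /S cos_coeffE /series /= big_mkord.
Qed.

Lemma sin_power_series (R : realType) : exists c : R^nat, forall u Q,
  `|sin u - \sum_(p < Q) c p * u ^+ p| <= 2 ^- Q * expR (2 * `|u|).
Proof.
exists (fun p => (odd p)%:R * (-1) ^+ p.-1./2 * p`!%:R^-1) => u Q; set S := \sum_(p < Q) _.
suff -> : S = series (sin_coeff u) Q.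
  apply: series_coeff_dist; last by rewrite unlock; exact: is_cvg_series_sin_coeff.
  move=> p; rewrite /sin_coeff /= !normrM normfV !normr_nat !normrX normrN normr1.
  by rewrite expr1n mulr1; case: odd; [rewrite mul1r | rewrite !mul0r divr_ge0].
by rewrite /S sin_coeffE /series /= big_mkord.
Qed.

(** Expand [cos (delta y)] and [sin (delta y)] in powers of [y]. The remainder is of
    size [e^(2 |delta y|)]; the condition on [delta] leaves half of the weight
    [cosh2 rho] to absorb it, the other half absorbing [y^q]. *)
Lemma exp_approx_trig_step (R : realType) (rho lambda delta : R) :
  0 < rho -> `|delta| <= rho / 4 ->
  (forall q phi, exp_approx rho (fun y => y ^+ q * cos (lambda * y + phi))) ->
  forall q phi,
    exp_approx rho (fun y => y ^+ q * cos ((lambda + delta) * y + phi)).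
Proof.
move=> r0 dr IH q phi; apply: exp_approx_lim => e e0.
have [c cP] := cos_power_series R; have [s sP] := sin_power_series R.
have r20 : 0 < rho / 2 by rewrite divr_gt0.
pose M := q`!%:R / (rho / 2) ^+ q.
have M0 : 0 <= M by rewrite divr_ge0 ?ler0n// exprn_ge0// ltW.
have [Q HQ] : exists Q, 2 ^- Q * (2 * M) <= e.
  have : (2^-1 ^+ n : R) * (2 * M) @[n --> \oo] --> 0 * (2 * M).
    by apply: cvgMl; apply: cvg_expr; rewrite ger0_norm// invf_lt1 ?ltr1n.
  rewrite mul0r => /cvgrPdist_le /(_ _ e0)[N _ /(_ _ (leqnn N))] /=.
  rewrite sub0r normrN exprVn => H; exists N.
  by rewrite (le_trans (ler_norm _) H).
exists (fun y =>
  (\sum_(p < Q) (c p * delta ^+ p) * (y ^+ (q + p) * cos (lambda * y + phi))) +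
  (-1) * \sum_(p < Q) (s p * delta ^+ p) *
      (y ^+ (q + p) * cos (lambda * y + (phi - pi / 2)))).
  apply: exp_approxD.
    by apply: exp_approx_sum => p; apply: exp_approxZ; exact: IH.
  by apply: exp_approxZ; apply: exp_approx_sum => p; apply: exp_approxZ; exact: IH.
move=> y; rewrite mulrDl addrAC cosD.
set a := lambda * y + phi; set u := delta * y.
have -> : cos (lambda * y + (phi - pi / 2)) = sin a by rewrite addrA cosBpihalf.
set S1 := (X in _ - (X + _)); set S2 := (X in _ - (_ + _ * X)).
have E1 : S1 = y ^+ q * cos a * \sum_(p < Q) c p * u ^+ p.
  rewrite /S1 big_distrr /=; apply: eq_bigr => p _.
  by rewrite /u exprMn exprD; ring.
have E2 : S2 = y ^+ q * sin a * \sum_(p < Q) s p * u ^+ p.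
  rewrite /S2 big_distrr /=; apply: eq_bigr => p _.
  by rewrite /u exprMn exprD; ring.
rewrite E1 E2.
have -> : y ^+ q * (cos a * cos u - sin a * sin u) -
  (y ^+ q * cos a * (\sum_(p < Q) c p * u ^+ p) +
   -1 * (y ^+ q * sin a * \sum_(p < Q) s p * u ^+ p)) =
  y ^+ q * (cos a * (cos u - \sum_(p < Q) c p * u ^+ p) -
            sin a * (sin u - \sum_(p < Q) s p * u ^+ p)) by ring.
have B : `|cos a * (cos u - \sum_(p < Q) c p * u ^+ p) -
            sin a * (sin u - \sum_(p < Q) s p * u ^+ p)| <=
         2 ^- Q * 2 * expR (rho / 2 * `|y|).
  have U : expR (2 * `|u|) <= expR (rho / 2 * `|y|).
    rewrite ler_expR normrM mulrA ler_wpM2r//.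
    by have := dr; lra.
  have cs1 : `|cos a| <= 1 by rewrite ler_norml cos_geN1 cos_le1.
  have cs2 : `|sin a| <= 1 by rewrite ler_norml sin_geN1 sin_le1.
  apply: le_trans (ler_normB _ _) _; rewrite mulrAC mulr_natr mulr2n.
  have Q0 : (0 : R) <= 2 ^- Q by rewrite invr_ge0 exprn_ge0.
  have HH := ler_wpM2l Q0 U.
  by rewrite lerD// normrM (le_trans _ HH)//;
     [have := cP u Q|have := sP u Q]; apply: le_trans; rewrite ler_piMl.
rewrite normrM normrX.
apply: le_trans (ler_pM _ _ (@exprn_le_expR _ _ y q r20) B) _; rewrite ?exprn_ge0//.
rewrite mulrACA -expRD -mulrDl -splitr.
apply: ler_pM; rewrite ?expR_ge0 ?mulr_ge0 ?invr_ge0 ?exprn_ge0 ?(ltW r20)//.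
  by rewrite mulrC -mulrA.
exact: cosh2_ge.
Qed.

(** The frequency [lambda] is reached from 0 by finitely many steps of length at
    most [rho / 4]. Carrying the power [y^q] along is what allows the iteration. *)
Lemma exp_approx_trig (R : realType) (rho lambda phi : R) q :
  0 < rho -> exp_approx rho (fun y => y ^+ q * cos (lambda * y + phi)).
Proof.
move=> r0.
have [n Hn] : exists n, `|lambda| / n.+1%:R <= rho / 4.
  exists (Num.trunc (`|lambda| / (rho / 4))).
  rewrite ler_pdivrMr// mulrC -ler_pdivrMr ?divr_gt0// ltW//.
  by rewrite truncnS_gt.
set delta := lambda / n.+1%:R.
have dr : `|delta| <= rho / 4 by rewrite normrM normfV normr_nat.
have : forall k q phi,
    exp_approx rho (fun y => y ^+ q * cos ((delta *+ k) * y + phi)).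
  elim=> [|k IH].
    move=> {}q {}phi; apply: exp_approx_ext (exp_approxZ (cos phi) (exp_approx_exprn q r0)).
    by move=> y; rewrite mulr0n mul0r add0r mulrC.
  by rewrite mulrSr; exact: exp_approx_trig_step.
move=> /(_ n.+1 q phi); apply: exp_approx_ext => y.
by rewrite -mulr_natr /delta divfK.
Qed.

(** A product of a sine and a cosine is half a sum of two sines, so the power of
    the sine is lowered at the price of shifting the frequency. *)
Lemma exp_approx_sinX (R : realType) (rho a : R) q : 0 < rho ->
  exp_approx rho (fun y => sin (a * y) ^+ q).
Proof.
move=> r0.
suff : forall lambda phi,
    exp_approx rho (fun y => sin (a * y) ^+ q * cos (lambda * y + phi)).
  move=> /(_ 0 0); apply: exp_approx_ext => y.
  by rewrite mul0r addr0 cos0 mulr1.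
elim: q => [|q IH] lambda phi.
  apply: exp_approx_ext (exp_approx_trig lambda phi 0 r0) => y.
  by rewrite !expr0.
apply: exp_approx_ext (exp_approxZ 2^-1 (exp_approxD
  (IH (lambda + a) (phi - pi / 2))
  (exp_approxZ (-1) (IH (lambda - a) (phi - pi / 2))))) => y.
have E b : cos ((lambda + b) * y + (phi - pi / 2)) =
           sin ((lambda * y + phi) + b * y).
  by rewrite -cosBpihalf; congr cos; ring.
rewrite !E [- a * y]mulNr sinB sinD exprSr.
by field.
Qed.

(** * Approximation of bounded continuous functions of several variables *)

Definition dot (R : realType) (m : nat) (t y : 'rV[R]_m) : R :=
  \sum_(i < m) t ord0 i * y ord0 i.

Definition mexpsum (R : realType) (m : nat) (s : seq (R * 'rV[R]_m))
    (y : 'rV[R]_m) : R :=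
  \sum_(p <- s) p.1 * expR (dot p.2 y).

Definition mcosh (R : realType) (m : nat) (rho : R) (y : 'rV[R]_m) : R :=
  \prod_(i < m) cosh2 rho (y ord0 i).

Definition mexp_approx (R : realType) (m : nat) (rho : R) (g : 'rV[R]_m -> R) :=
  forall eps, 0 < eps -> exists2 s : seq (R * 'rV[R]_m),
    (forall p, p \in s -> forall i, `|p.2 ord0 i| <= rho) &
    forall y, `|g y - mexpsum s y| <= eps * mcosh rho y.

Lemma mcosh_ge0 (R : realType) m (rho : R) (y : 'rV[R]_m) : 0 <= mcosh rho y.
Proof. by apply: prodr_ge0 => i _; rewrite addr_ge0 ?expR_ge0. Qed.

Lemma mcosh_ge (R : realType) m (rho : R) (y : 'rV[R]_m) i : 0 <= rho ->
  cosh2 rho (y ord0 i) <= mcosh rho y.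
Proof.
move=> r0; rewrite /mcosh (bigD1 i)//= ler_peMr//.
  by rewrite addr_ge0 ?expR_ge0.
elim/big_ind : _ => //; last by move=> j _; exact: cosh2_ge1.
by move=> a b a1 b1; rewrite -[1]mulr1 ler_pM.
Qed.

Lemma mcosh_ge1 (R : realType) m (rho : R) (y : 'rV[R]_m) : 0 <= rho ->
  1 <= mcosh rho y.
Proof.
move=> r0; rewrite /mcosh; elim/big_ind : _ => //; last by move=> j _; exact: cosh2_ge1.
by move=> a b a1 b1; rewrite -[1]mulr1 ler_pM.
Qed.

Lemma mexp_approxZ (R : realType) m (rho a : R) (g : 'rV[R]_m -> R) :
  mexp_approx rho g -> mexp_approx rho (fun y => a * g y).
Proof.
move=> ag e e0; have a1 : 0 < `|a| + 1 by rewrite ltr_wpDl.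
have [s s1 s2] := ag (e / (`|a| + 1)) (divr_gt0 e0 a1).
exists [seq (a * p.1, p.2) | p <- s].
  by move=> q /mapP[p ps ->] /=; exact: s1.
move=> y; have -> : mexpsum [seq (a * p.1, p.2) | p <- s] y = a * mexpsum s y.
  by rewrite /mexpsum big_map big_distrr /=; apply: eq_bigr => p _; rewrite mulrA.
rewrite -mulrBr normrM.
apply: le_trans (ler_wpM2l (normr_ge0 _) (s2 y)) _.
rewrite mulrA ler_wpM2r ?mcosh_ge0// mulrA ler_pdivrMr// mulrC ler_wpM2l ?ltW//.
by rewrite ltrDl.
Qed.

Lemma mexp_approxD (R : realType) m (rho : R) (g1 g2 : 'rV[R]_m -> R) :
  mexp_approx rho g1 -> mexp_approx rho g2 ->
  mexp_approx rho (fun y => g1 y + g2 y).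
Proof.
move=> a1 a2 e e0; have e20 : 0 < e / 2 by rewrite divr_gt0.
have [s1 s11 s12] := a1 _ e20; have [s2 s21 s22] := a2 _ e20.
exists (s1 ++ s2).
  by move=> p; rewrite mem_cat => /orP[/s11|/s21].
move=> y; rewrite {1}/mexpsum big_cat /= opprD addrACA (splitr e) mulrDl.
by apply: le_trans (ler_normD _ _) _; rewrite lerD.
Qed.

Lemma mexp_approx_sum (R : realType) m (rho : R) I (r : seq I)
    (g : I -> 'rV[R]_m -> R) :
  (forall i, mexp_approx rho (g i)) ->
  mexp_approx rho (fun y => \sum_(i <- r) g i y).
Proof.
move=> ag; elim: r => [|i r ih].
  move=> e e0; exists [::] => // y; rewrite /mexpsum !big_nil subrr normr0.
  by rewrite mulr_ge0 ?mcosh_ge0// ltW.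
have := mexp_approxD (ag i) ih.
by congr mexp_approx; apply/funext => y; rewrite big_cons.
Qed.

Lemma mexp_approx_lim (R : realType) m (rho : R) (g : 'rV[R]_m -> R) :
  (forall eps, 0 < eps -> exists2 g', mexp_approx rho g' &
     forall y, `|g y - g' y| <= eps * mcosh rho y) ->
  mexp_approx rho g.
Proof.
move=> H e e0; have e20 : 0 < e / 2 by rewrite divr_gt0.
have [g' ag' gg'] := H _ e20; have [s s1 s2] := ag' _ e20.
exists s => // y; rewrite -(subrKA (g' y)) (splitr e) mulrDl.
by apply: le_trans (ler_normD _ _) _; rewrite lerD.
Qed.

(** Replace the factors one at a time. *)
Lemma prod_dist_le (R : realType) I (r : seq I) (a b c : I -> R) (e : R) :
  0 <= e -> (forall i, `|a i| <= c i) -> (forall i, `|a i - b i| <= e * c i) ->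
  `|\prod_(i <- r) a i - \prod_(i <- r) b i| <=
    ((1 + e) ^+ size r - 1) * \prod_(i <- r) c i.
Proof.
move=> e0 ac abc.
have c0 i : 0 <= c i by apply: le_trans (ac i).
have bc i : `|b i| <= (1 + e) * c i.
  have -> : b i = a i - (a i - b i) by ring.
  by rewrite (le_trans (ler_normB _ _))// mulrDl mul1r lerD.
have BC (s : seq I) :
    `|\prod_(i <- s) b i| <= (1 + e) ^+ size s * \prod_(i <- s) c i.
  elim: s => [|i s ih]; first by rewrite !big_nil normr1 expr0 mulr1.
  by rewrite !big_cons normrM /= exprS mulrACA ler_pM.
elim: r => [|i r ih]; first by rewrite !big_nil expr0 !subrr normr0 mul0r.
rewrite !big_cons /=.
set A := \prod_(j <- r) a j in ih *; set B := \prod_(j <- r) b j in ih *.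
have -> : a i * A - b i * B = a i * (A - B) + (a i - b i) * B by ring.
apply: le_trans (ler_normD _ _) _; rewrite !normrM.
apply: le_trans (lerD (ler_pM _ _ (ac i) ih) (ler_pM _ _ (abc i) (BC r))) _ => //.
rewrite exprS; set C := \prod_(j <- r) c j; rewrite le_eqVlt; apply/orP; left; apply/eqP; ring.
Qed.

(** Factors that depend on different coordinates have exponents with disjoint
    supports, so the exponents of the product stay in the same cube. *)
Lemma prod_expsum (R : realType) m (rho : R) (s : 'I_m -> seq (R * R))
    (r : seq 'I_m) :
  0 <= rho -> uniq r -> (forall i p, p \in s i -> `|p.2| <= rho) ->
  exists2 S : seq (R * 'rV[R]_m),
    (forall p, p \in S -> forall i,
       if i \in r then `|p.2 ord0 i| <= rho else p.2 ord0 i == 0) &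
    forall y, mexpsum S y = \prod_(i <- r) expsum (s i) (y ord0 i).
Proof.
move=> r0 ur sr; elim: r ur => [_|j r ih /= /andP[jr /ih[S S1 S2]]].
  exists [:: (1, 0)].
    by move=> p; rewrite inE => /eqP -> i /=; rewrite mxE.
  move=> y; rewrite /mexpsum big_seq1 big_nil /= mul1r /dot big1 ?expR0//.
  by move=> i _; rewrite mxE mul0r.
exists [seq (p.1 * q.1, p.2 *: delta_mx 0 j + q.2) | p <- s j, q <- S].
  move=> _ /allpairsP[[p q] /= [ps qS ->]] i /=.
  have := S1 _ qS i; rewrite !mxE eqxx /= inE.
  have [->|ij] := eqVneq i j.
    by rewrite (negbTE jr) /= => /eqP ->; rewrite mulr1 addr0; exact: (sr j).
  by rewrite /= mulr0 add0r.
move=> y; rewrite big_cons -S2 /mexpsum big_allpairs_dep /expsum big_distrl /=.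
apply: eq_bigr => p _; rewrite big_distrr /=; apply: eq_bigr => q _.
have -> : dot (p.2 *: delta_mx 0 j + q.2) y = p.2 * y ord0 j + dot q.2 y.
  rewrite /dot -[in RHS](_ : \sum_i p.2 * (i == j)%:R * y ord0 i = p.2 * y ord0 j).
    rewrite -big_split /=; apply: eq_bigr => i _.
    by rewrite !mxE eqxx /= mulrDl.
  rewrite (bigD1 j)//= eqxx mulr1 big1 ?addr0// => i /negbTE ->.
  by rewrite mulr0 mul0r.
by rewrite expRD; ring.
Qed.

Lemma mexp_approx_prod (R : realType) m (rho : R) (h : 'I_m -> R -> R) :
  0 <= rho -> (forall i y, `|h i y| <= 1) -> (forall i, exp_approx rho (h i)) ->
  mexp_approx rho (fun y : 'rV[R]_m => \prod_(i < m) h i (y ord0 i)).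
Proof.
move=> r0 h1 ah e e0.
have [d d0 de] : exists2 d : R, 0 < d & (1 + d) ^+ m - 1 <= e.
  have : (1 + d) ^+ m - 1 @[d --> 0^'+] --> (1 + (0 : R)) ^+ m - 1.
    apply: cvgB; last exact: cvg_cst.
    apply: cvg_at_right_filter; apply: (continuous_comp (f := fun d : R => 1 + d)
      (g := fun x : R => x ^+ m)); last exact: exprn_continuous.
    by apply: cvgD; [exact: cvg_cst|exact: cvg_id].
  rewrite addr0 expr1n subrr => /cvgrPdist_le /(_ _ e0) H.
  near (0 : R)^'+ => d; exists d; first by near: d; exact: nbhs_right_gt.
  have : `|0 - ((1 + d) ^+ m - 1)| <= e by near: d.
  by rewrite sub0r normrN; apply: le_trans (ler_norm _).
have /choice[s sP] : forall i, exists s : seq (R * R),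
    (forall p, p \in s -> `|p.2| <= rho) /\
    forall y, `|h i y - expsum s y| <= d * cosh2 rho y.
  by move=> i; have [s s1 s2] := ah i _ d0; exists s.
have [S S1 S2] := prod_expsum r0 (index_enum_uniq _) (fun i => (sP i).1).
exists S => [p pS i|y]; first by have := S1 p pS i; rewrite mem_index_enum.
rewrite S2 /mcosh.
apply: (@le_trans _ _ (((1 + d) ^+ m - 1) * mcosh rho y)); last first.
  by rewrite ler_wpM2r// mcosh_ge0.
have := @prod_dist_le R _ (index_enum 'I_m) (fun i => h i (y ord0 i))
  (fun i => expsum (s i) (y ord0 i)) (fun i => cosh2 rho (y ord0 i)) d (ltW d0).
have -> : size (index_enum 'I_m) = m by rewrite -sum1_size sum1_card card_ord.
apply.
  by move=> i; rewrite (le_trans (h1 _ _))// cosh2_ge1.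
by move=> i; exact: (sP i).2.
Unshelve. all: by end_near. Qed.

(** The binomial probabilities ['C(N, k) x^k (1 - x)^(N - k)], given by the Pascal
    recursion so that binomial expectations are computed by induction on [N]. *)
Fixpoint bern (R : realType) (N : nat) (x : R) (k : nat) : R :=
  if N is N'.+1 then
    (if k is k'.+1 then x * bern N' x k' else 0) + (1 - x) * bern N' x k
  else (k == 0)%:R.

Lemma bern_big (R : realType) N (x : R) k : (N < k)%N -> bern N x k = 0.
Proof.
elim: N k => [|N IH] [|k]//= Nk.
by rewrite !IH ?mulr0 ?addr0// ltnW.
Qed.

Lemma bern_ge0 (R : realType) N (x : R) k : 0 <= x <= 1 -> 0 <= bern N x k.
Proof.
move=> /andP[x0 x1]; elim: N k => [|N IH] k /=; first exact: ler0n.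
by case: k => [|k]; rewrite addr_ge0// mulr_ge0// subr_ge0.
Qed.

Lemma sum_bernS (R : realType) N (x : R) (f : nat -> R) :
  \sum_(k < N.+2) f k * bern N.+1 x k =
  \sum_(k < N.+1) (x * f k.+1 + (1 - x) * f k) * bern N x k.
Proof.
under eq_bigr do rewrite /= mulrDr.
rewrite big_split /= big_ord_recl /= mulr0 add0r.
rewrite [X in _ + X]big_ord_recr /= (@bern_big _ N x N.+1)// !mulr0 addr0.
rewrite -big_split /=; apply: eq_bigr => k _.
by rewrite /bump /= add1n; ring.
Qed.

Lemma sum_bern (R : realType) N (x : R) : \sum_(k < N.+1) bern N x k = 1.
Proof.
elim: N => [|N IH]; first by rewrite big_ord1.
have := sum_bernS N x (fun=> 1).
under eq_bigr do rewrite mul1r; move=> ->.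
by rewrite -[RHS]IH; apply: eq_bigr => k _; ring.
Qed.

Lemma bern_le1 (R : realType) N (x : R) k : 0 <= x <= 1 -> `|bern N x k| <= 1.
Proof.
move=> x01; rewrite ger0_norm ?bern_ge0//.
have [Nk|kN] := ltnP N k; first by rewrite bern_big.
rewrite -ltnS in kN; rewrite -(sum_bern N x) (bigD1 (Ordinal kN))//= lerDl.
by apply: sumr_ge0 => i _; rewrite bern_ge0.
Qed.

(** The variance of the binomial law. *)
Lemma bern_variance (R : realType) N (x : R) :
  \sum_(k < N.+1) (k%:R - N%:R * x) ^+ 2 * bern N x k = N%:R * (x * (1 - x)).
Proof.
elim: N => [|N IH]; first by rewrite big_ord1 /= !mul0r subr0 expr0n mul0r.
rewrite (sum_bernS N x (fun k => (k%:R - N.+1%:R * x) ^+ 2)).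
transitivity (\sum_(k < N.+1) ((k%:R - N%:R * x) ^+ 2 * bern N x k +
    (x * (1 - x)) * bern N x k)).
  by apply: eq_bigr => k _; rewrite -!natr1; ring.
by rewrite big_split /= IH -big_distrr /= sum_bern -natr1; ring.
Qed.

(** Raising [N] multiplies by [x] or [1 - x], which are affine in [sin (a y)]; the
    induction therefore has to carry a power of the sine. *)
Lemma exp_approx_bern (R : realType) (rho a : R) N k q : 0 < rho ->
  exp_approx rho (fun y => sin (a * y) ^+ q * bern N ((1 + sin (a * y)) / 2) k).
Proof.
move=> r0; elim: N k q => [|N IH] k q.
  apply: exp_approx_ext (exp_approxZ ((k == 0)%:R) (exp_approx_sinX a q r0)) => y.
  by rewrite mulrC.
have H1 : exp_approx rho (fun y => sin (a * y) ^+ q *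
    ((1 - (1 + sin (a * y)) / 2) * bern N ((1 + sin (a * y)) / 2) k)).
  apply: exp_approx_ext (exp_approxD (exp_approxZ 2^-1 (IH k q))
    (exp_approxZ (- 2^-1) (IH k q.+1))) => y.
  by rewrite exprS; field.
case: k H1 => [|k] H1.
  by apply: exp_approx_ext H1 => y /=; rewrite add0r.
apply: exp_approx_ext (exp_approxD H1 (exp_approxD (exp_approxZ 2^-1 (IH k q))
    (exp_approxZ 2^-1 (IH k q.+1)))) => y /=.
by rewrite exprS; field.
Qed.

(** The point of the cube [|a y_i| <= pi / 2] at which [(1 + sin (a y_i)) / 2] is
    equal to [x_i]. *)
Definition asin_node (R : realType) (m : nat) (a : R) (x : 'I_m -> R) : 'rV[R]_m :=
  \row_i (asin (2 * x i - 1) / a).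

Lemma asin_node_sin (R : realType) m (a : R) (y : 'rV[R]_m) :
  0 < a -> (forall i, `|a * y ord0 i| <= 1) ->
  asin_node a (fun i => (1 + sin (a * y ord0 i)) / 2) = y.
Proof.
move=> a0 ay; apply/rowP => i; rewrite mxE.
rewrite (_ : 2 * _ - 1 = sin (a * y ord0 i)); last by field.
have := ay i; rewrite ler_norml => /andP[y1 y2].
rewrite sinK; last first.
  by rewrite in_itv/=; have p1 := pihalf_ge1 R; apply/andP; split; lra.
by rewrite mulrC mulKf// gt_eqF.
Qed.

Lemma asin_node_near (R : realType) m (h : 'rV[R]_m -> R) (a e : R) (y0 : 'rV[R]_m) :
  0 < a -> 0 < e -> {for y0, continuous h} ->
  (forall i, `|a * y0 ord0 i| <= 1) ->
  exists2 d : R, 0 < d & forall x : 'I_m -> R,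
    (forall i, `|(1 + sin (a * y0 ord0 i)) / 2 - x i| < d) ->
    `|h y0 - h (asin_node a x)| < e.
Proof.
move=> a0 e0 hc ay; move/cvgrPdist_lt : hc => /(_ _ e0).
move=> /nbhs_ballP[r /= r0 rh].
suff : \forall d \near 0^'+, forall i : 'I_m, forall z : R,
    `|(1 + sin (a * y0 ord0 i)) / 2 - z| < d ->
    `|y0 ord0 i - asin (2 * z - 1) / a| < r.
  move=> H; near (0 : R)^'+ => d; exists d.
    by near: d; exact: nbhs_right_gt.
  have H2 : forall i : 'I_m, forall z : R,
    `|(1 + sin (a * y0 ord0 i)) / 2 - z| < d ->
    `|y0 ord0 i - asin (2 * z - 1) / a| < r by near: d.
  move=> x xd; apply: rh; split => // i j; rewrite ord1 mxE; exact: H2.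
apply: filter_forall => i.
set x0 := (1 + _) / 2.
have E0 : y0 ord0 i = asin (2 * x0 - 1) / a.
  by rewrite -{1}(asin_node_sin a0 ay) mxE.
have : {for x0, continuous (fun z : R => asin (2 * z - 1) / a)}.
  apply: cvgM; last exact: cvg_cst.
  apply: (continuous_comp (f := fun z : R => 2 * z - 1) (g := @asin R)).
    by apply: cvgB; [apply: cvgM; [exact: cvg_cst|exact: cvg_id]|exact: cvg_cst].
  apply: continuous_asin.
  rewrite (_ : 2 * _ - 1 = sin (a * y0 ord0 i)); last by rewrite /x0; field.
  rewrite -ltr_norml lt_neqAle ler_norml sin_geN1 sin_le1 !andbT.
  apply/eqP => /sin1cos0 c0.
  have := ay i; rewrite ler_norml => /andP[y1 y2].
  suff : 0 < cos (a * y0 ord0 i) by rewrite c0 ltxx.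
  apply: cos_gt0_pihalf.
  have p2 : 1 < pi / 2 :> R.
    rewrite lt_neqAle pihalf_ge1 andbT; apply/eqP => p1.
    by have := @cos1_gt0 R; rewrite p1 cos_pihalf ltxx.
  by apply/andP; split; lra.
move=> /cvgrPdist_lt /(_ _ r0) /nbhs_ballP[d /= d0 dP].
near=> d' => z zd; rewrite E0; apply: dP; rewrite /ball /=.
rewrite (lt_le_trans zd)//; near: d'; exact: nbhs_right_le.
Unshelve. all: by end_near. Qed.

(** Uniform continuity in the sine coordinates, by compactness of the cube. *)
Lemma asin_node_unif (R : realType) m (h : 'rV[R]_m -> R) (a e : R) :
  0 < a -> 0 < e -> continuous h ->
  exists2 d : R, 0 < d & forall (y : 'rV[R]_m) (x : 'I_m -> R),
    (forall i, `|a * y ord0 i| <= 1) ->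
    (forall i, `|(1 + sin (a * y ord0 i)) / 2 - x i| < d) ->
    `|h y - h (asin_node a x)| < e.
Proof.
move=> a0 e0 hc.
pose K := [set y : 'rV[R]_m | forall i, `[- a^-1, a^-1]%classic (y ord0 i)].
have cK : compact K by apply: (@rV_compact R m (fun=> `[- a^-1, a^-1]%classic)) => i; exact: segment_compact.
have KP y : K y <-> forall i, `|a * y ord0 i| <= 1.
  rewrite /K /=; split => H i; have := H i; rewrite in_itv/= -ler_norml;
  by rewrite normrM (gtr0_norm a0) -ler_pdivlMl// mulr1.
move/compact_near_coveringP : cK => /(_ R (0 : R)^'+
  (fun d y => forall x : 'I_m -> R,
    (forall i, `|(1 + sin (a * y ord0 i)) / 2 - x i| < d) ->
    `|h y - h (asin_node a x)| < e) _) H.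
near (0 : R)^'+ => d; exists d; first by near: d; exact: nbhs_right_gt.
move=> y x /KP; move: y x; near: d.
suff : \forall d \near 0^'+, K `<=` (fun y => forall x : 'I_m -> R,
    (forall i, `|(1 + sin (a * y ord0 i)) / 2 - x i| < d) ->
    `|h y - h (asin_node a x)| < e).
  by apply: filterS => d H' y x Ky; exact: H'.
apply: H => y0 /KP ay.
have e20 : 0 < e / 2 by rewrite divr_gt0.
have [d d0 dP] := asin_node_near a0 e20 (hc y0) ay.
have d20 : 0 < d / 2 by rewrite divr_gt0.
near=> y d' => x xd.
have hy : `|h y0 - h y| < e / 2.
  by near: y; move/cvgrPdist_lt : (hc y0); apply.
have sy : forall i, `|(1 + sin (a * y0 ord0 i)) / 2 - (1 + sin (a * y ord0 i)) / 2| < d / 2.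
  near: y; apply: filter_forall => i.
  suff : {for y0, continuous (fun y : 'rV[R]_m => (1 + sin (a * y ord0 i)) / 2)}.
    by move/cvgrPdist_lt; apply.
  apply: (continuous_comp (f := fun y : 'rV[R]_m => y ord0 i)
    (g := fun u : R => (1 + sin (a * u)) / 2)); first exact: coord_continuous.
  apply: cvgM; last exact: cvg_cst.
  apply: cvgD; first exact: cvg_cst.
  apply: (continuous_comp (f := fun u : R => a * u) (g := @sin R)).
    by apply: cvgM; [exact: cvg_cst|exact: cvg_id].
  exact: continuous_sin.
have d'd : d' <= d / 2 by near: d'; exact: nbhs_right_le.
rewrite -(subrKA (h y0)) (splitr e) (le_lt_trans (ler_normD _ _))// ltrD//.
  by rewrite distrC.
apply: dP => i; rewrite -(subrKA ((1 + sin (a * y ord0 i)) / 2)) (splitr d).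
by rewrite (le_lt_trans (ler_normD _ _))// ltrD// (lt_le_trans (xd i)).
Unshelve. all: by end_near. Qed.

(** Bernstein polynomials in the variables [(1 + sin (a y_i)) / 2]. *)
Definition bern_approx (R : realType) (m N : nat) (a : R) (h : 'rV[R]_m -> R)
    (y : 'rV[R]_m) : R :=
  \sum_(kap : {ffun 'I_m -> 'I_N.+1})
    h (asin_node a (fun i => (kap i)%:R / N%:R)) *
    \prod_(i < m) bern N ((1 + sin (a * y ord0 i)) / 2) (kap i).

Lemma mexp_approx_bern (R : realType) m N (rho a : R) (h : 'rV[R]_m -> R) :
  0 < rho -> mexp_approx rho (bern_approx N a h).
Proof.
move=> r0; apply: mexp_approx_sum => kap; apply: mexp_approxZ.
apply: (@mexp_approx_prod R m rho
  (fun i y => bern N ((1 + sin (a * y)) / 2) (kap i)) (ltW r0)).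
  move=> i y; apply: bern_le1.
  have := sin_geN1 (a * y); have := sin_le1 (a * y) => ? ?.
  by apply/andP; split; lra.
move=> i; apply: exp_approx_ext (exp_approx_bern a N (kap i) 0 r0) => y.
by rewrite expr0 mul1r.
Qed.

Lemma sin01 (R : realType) (u : R) : 0 <= (1 + sin u) / 2 <= 1.
Proof.
have := sin_geN1 u; have := sin_le1 u => ? ?.
by apply/andP; split; lra.
Qed.

Lemma sum_prod_bern (R : realType) m N (x : 'I_m -> R) :
  \sum_(kap : {ffun 'I_m -> 'I_N.+1}) \prod_(i < m) bern N (x i) (kap i) = 1.
Proof.
rewrite -(bigA_distr_bigA (fun i (k : 'I_N.+1) => bern N (x i) k)).
by rewrite big1// => i _; exact: sum_bern.
Qed.

Lemma sum_prod_bern_variance (R : realType) m N (x : 'I_m -> R) j :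
  \sum_(kap : {ffun 'I_m -> 'I_N.+1}) ((kap j)%:R - N%:R * x j) ^+ 2 *
     \prod_(i < m) bern N (x i) (kap i) = N%:R * (x j * (1 - x j)).
Proof.
pose F i (k : 'I_N.+1) :=
  (if i == j then (k%:R - N%:R * x i) ^+ 2 else 1) * bern N (x i) k.
transitivity (\sum_(kap : {ffun 'I_m -> 'I_N.+1}) \prod_i F i (kap i)).
  apply: eq_bigr => kap _; rewrite (bigD1 j)//= [RHS](bigD1 j)//= /F eqxx mulrA.
  by congr (_ * _); apply: eq_bigr => i /negbTE ->; rewrite mul1r.
rewrite -(bigA_distr_bigA F).
transitivity ((\sum_k F j k) * \prod_(i | i != j) \sum_k F i k); first exact: bigD1.
rewrite [X in _ * X]big1 ?mulr1.
  by rewrite /F eqxx bern_variance.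
move=> i /negbTE ij; rewrite /F ij -[RHS](sum_bern N (x i)).
by apply: eq_bigr => k _; rewrite mul1r.
Qed.

Lemma bern_approx_le (R : realType) m N (a M : R) (h : 'rV[R]_m -> R) y :
  (forall y, `|h y| <= M) -> `|bern_approx N a h y| <= M.
Proof.
move=> hM; apply: le_trans (ler_norm_sum _ _ _) _.
have -> : M = M * \sum_(kap : {ffun 'I_m -> 'I_N.+1})
    \prod_(i < m) bern N ((1 + sin (a * y ord0 i)) / 2) (kap i).
  by rewrite sum_prod_bern mulr1.
rewrite big_distrr /=; apply: ler_sum => kap _; rewrite normrM.
have P0 : 0 <= \prod_(i < m) bern N ((1 + sin (a * y ord0 i)) / 2) (kap i).
  by apply: prodr_ge0 => i _; rewrite bern_ge0// sin01.
by rewrite (ger0_norm P0) ler_wpM2r.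
Qed.

(** Bernstein's argument: the nodes near [y] contribute little because [h] is
    uniformly continuous on the cube, and by Chebyshev's inequality the binomial
    weight of the other nodes is of order [1 / N]. *)
Lemma bern_approx_dist (R : realType) m (a M e : R) (h : 'rV[R]_m -> R) :
  0 < a -> 0 < e -> continuous h -> (forall y, `|h y| <= M) ->
  exists N, forall y : 'rV[R]_m, (forall i, `|a * y ord0 i| <= 1) ->
    `|h y - bern_approx N a h y| <= e.
Proof.
move=> a0 e0 hc hM.
have M0 : 0 <= M by apply: le_trans (hM 0).
have e20 : 0 < e / 2 by rewrite divr_gt0.
have [d d0 dP] := asin_node_unif a0 e20 hc.
pose C := 2 * M / d ^+ 2 * m%:R.
have C0 : 0 <= C by rewrite !mulr_ge0 ?ler0n// invr_ge0 exprn_ge0// ltW.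
pose N := (Num.trunc (C / (e / 2))).+1.
have NC : C / N%:R <= e / 2.
  by rewrite ler_pdivrMr ?ltr0n// mulrC -ler_pdivrMr// ltW// truncnS_gt.
exists N => y ay.
pose x i : R := (1 + sin (a * y ord0 i)) / 2.
have x01 i : 0 <= x i <= 1 by exact: sin01.
pose w (kap : {ffun 'I_m -> 'I_N.+1}) := \prod_(i < m) bern N (x i) (kap i).
have w0 kap : 0 <= w kap by apply: prodr_ge0 => i _; rewrite bern_ge0.
have sw : \sum_kap w kap = 1 by exact: sum_prod_bern.
rewrite -[h y]mulr1 -sw big_distrr /= /bern_approx -sumrB.
apply: le_trans (ler_norm_sum _ _ _) _.
have N0 : 0 < N%:R :> R by rewrite ltr0n.
apply: (@le_trans _ _ (\sum_kap (e / 2 * w kap + \sum_(j < m) 2 * M / d ^+ 2 / N%:R ^+ 2 *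
   (((kap j)%:R - N%:R * x j) ^+ 2 * w kap)))).
  apply: ler_sum => kap _; rewrite -/(w kap) -mulrBl normrM (ger0_norm (w0 _)).
  under eq_bigr do rewrite mulrA; rewrite -mulr_suml -mulrDl ler_wpM2r//.
  have T0 (j : 'I_m) : 0 <= 2 * M / d ^+ 2 / N%:R ^+ 2 * ((kap j)%:R - N%:R * x j) ^+ 2.
    by rewrite mulr_ge0 ?sqr_ge0// divr_ge0 ?exprn_ge0// divr_ge0 ?sqr_ge0// mulr_ge0.
  have [H|] := pselect (forall i, `|x i - (kap i)%:R / N%:R| < d).
    by rewrite ler_wpDr ?sumr_ge0// ltW// dP.
  move/existsNP => [j /negP]; rewrite -leNgt => dj.
  rewrite ler_wpDl ?(ltW e20)// (bigD1 j)//= ler_wpDr ?sumr_ge0//.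
  apply: (@le_trans _ _ (2 * M)).
    by rewrite (le_trans (ler_normB _ _))// mulr_natl mulr2n lerD.
  have -> : 2 * M / d ^+ 2 / N%:R ^+ 2 * ((kap j)%:R - N%:R * x j) ^+ 2 =
     2 * M * ((x j - (kap j)%:R / N%:R) ^+ 2 / d ^+ 2).
    by field; rewrite ?pnatr_eq0 ?gt_eqF.
  rewrite ler_peMr ?mulr_ge0// ler_pdivlMr ?exprn_gt0// mul1r.
  by rewrite -(real_normK (num_real (_ - _))) lerXn2r ?nnegrE// ltW.
rewrite big_split /= -mulr_sumr sw mulr1 exchange_big /=.
under eq_bigr do rewrite -mulr_sumr sum_prod_bern_variance.
rewrite [leRHS](splitr e) lerD2l (le_trans _ NC)//.
apply: (@le_trans _ _ (\sum_(j < m) 2 * M / d ^+ 2 / N%:R)).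
  apply: ler_sum => j _.
  have -> : 2 * M / d ^+ 2 / N%:R ^+ 2 * (N%:R * (x j * (1 - x j))) =
    2 * M / d ^+ 2 / N%:R * (x j * (1 - x j)).
    by field; rewrite ?pnatr_eq0 ?gt_eqF.
  have /andP[x0 x1] := x01 j.
  rewrite ler_piMr//; last by nra.
  by rewrite !mulr_ge0// ?invr_ge0 ?exprn_ge0// ltW.
rewrite sumr_const card_ord -mulr_natr /C.
rewrite le_eqVlt; apply/orP; left; apply/eqP; ring.
Qed.

(** On a large cube, where the sine coordinates separate points, the Bernstein polynomials
    in these coordinates are close to [h]; outside of the cube both functions are
    bounded by [M] and the weight is large. *)
Theorem mexp_approx_bounded (R : realType) m (rho M : R) (h : 'rV[R]_m -> R) :
  0 < rho -> continuous h -> (forall y, `|h y| <= M) -> mexp_approx rho h.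
Proof.
move=> r0 hc hM; apply: mexp_approx_lim => e e0.
have M0 : 0 <= M by apply: le_trans (hM 0).
(* Outside of the cube of size K the weight exceeds 2 M / e. *)
pose K := 2 * M / e / rho + 1.
have K0 : 0 < K by rewrite ltr_wpDl// !divr_ge0 ?mulr_ge0// ltW.
have Ki0 : 0 < K^-1 by rewrite invr_gt0.
have [N NP] := bern_approx_dist Ki0 e0 hc hM.
exists (bern_approx N K^-1 h); first exact: mexp_approx_bern.
move=> y; have [yK|] := pselect (forall i, `|K^-1 * y ord0 i| <= 1).
  rewrite (le_trans (NP y yK))// ler_peMr ?(ltW e0)//.
  by rewrite mcosh_ge1// ltW.
move/existsNP => [i /negP]; rewrite -ltNge normrM (gtr0_norm Ki0).
rewrite mulrC ltr_pdivlMr// mul1r => Ky.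
apply: (@le_trans _ _ (2 * M)).
  by rewrite (le_trans (ler_normB _ _))// mulr_natl mulr2n lerD// bern_approx_le.
apply: le_trans (ler_wpM2l (ltW e0) (mcosh_ge y i (ltW r0))).
apply: le_trans (ler_wpM2l (ltW e0) (cosh2_ge _ (lexx _))).
rewrite -ler_pdivrMl// mulrC (le_trans _ (expR_ge1Dx _))//.
have : 2 * M / e <= rho * K.
  by rewrite /K mulrDr mulr1 mulrCA divff ?gt_eqF// mulr1 lerDl ltW.
have : rho * K <= rho * `|y ord0 i| by rewrite ler_wpM2l// ltW.
lra.
Qed.

(** * Measurability and integrability on row vectors *)

(** An open set of [R^m] is a countable union of rational boxes. *)
Lemma measurable_rV (R : realType) m d (T : measurableType d)
    (Y : T -> 'rV[R]_m) :
  (forall i, measurable_fun setT (fun w => Y w ord0 i)) ->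
  measurable_fun setT (Y : T -> borel_rV R m).
Proof.
move=> mY; apply: (measurability (@open 'rV[R]_m : set (set (borel_rV R m)))) => // _ [U oU <-].
rewrite setTI.
pose B (q : {ffun 'I_m -> rat} * nat) :=
  [set y : 'rV[R]_m | forall i, `|ratr (q.1 i) - y ord0 i| < q.2.+1%:R^-1].
have -> : Y @^-1` U = \bigcup_q
    (if `[< B q `<=` U >] then Y @^-1` B q else set0).
  apply/seteqP; split => [w Uw|w [q _]]; last first.
    by case: ifPn => // /asboolP qU; exact: qU.
  have /nbhs_ballP[e /= e0 eU] : nbhs (Y w) U by exact: open_nbhs_nbhs.
  pose k := Num.trunc (2 / e).
  have k1 : k.+1%:R^-1 <= e / 2 :> R.
    rewrite -[leRHS]invrK lef_pV2 ?posrE ?invr_gt0 ?divr_gt0// invf_div ltW//.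
    exact: truncnS_gt.
  have k0 : 0 < k.+1%:R^-1 :> R by rewrite invr_gt0.
  have /choice[q qP] : forall i, exists q : rat,
      `|ratr q - Y w ord0 i| < k.+1%:R^-1.
    move=> i; have [|q] := @rat_in_itvoo R (Y w ord0 i - k.+1%:R^-1)
      (Y w ord0 i + k.+1%:R^-1).
      by rewrite ltrD2l gtrN.
    rewrite in_itv/= => /andP[q1 q2]; exists q.
    by rewrite ltr_distl q1 q2.
  exists ([ffun i => q i], k) => //; case: ifPn => [_ i /=|/asboolPn].
    by rewrite ffunE.
  case=> y By; apply: eU; split => // i j; rewrite ord1.
  have := By j; have := qP j; rewrite /= ffunE /ball /= => h1 h2.
  rewrite -(subrKA (ratr (q j))) (splitr e) (le_lt_trans (ler_normD _ _))// ltrD//.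
    by rewrite distrC (lt_le_trans h1).
  by rewrite (lt_le_trans h2).
apply: countable_bigcupT_measurable => [|q]; first exact: countableP.
case: ifP => // _.
have -> : Y @^-1` B q = \bigcap_(i in [set: 'I_m])
    [set w | `|ratr (q.1 i) - Y w ord0 i| < q.2.+1%:R^-1].
  by apply/seteqP; split => w H i; [move=> _|]; exact: H.
apply: fin_bigcap_measurable => // i _.
rewrite -[X in measurable X]setTI.
have mf : measurable_fun setT (fun w => `|ratr (q.1 i) - Y w ord0 i|).
  by apply: measurableT_comp => //; exact: measurable_funB.
have := mf measurableT _ (measurable_itv `]-oo, q.2.+1%:R^-1[).
by congr (measurable (_ `&` _)); apply/seteqP; split => w /=; rewrite in_itv.
Qed.

Lemma continuous_measurable_rV (R : realType) m (g : 'rV[R]_m -> R) :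
  continuous g -> measurable_fun setT (g : borel_rV R m -> R).
Proof.
move=> gc; apply: (measurability _ (RGenOpens.measurableE R)).
move=> _ [_ [a [b ->]] <-]; rewrite setTI; apply: sub_sigma_algebra.
by apply: open_comp => // x _; exact: gc.
Qed.

Lemma measurable_coord (R : realType) m (i : 'I_m) :
  measurable_fun setT (fun y : borel_rV R m => y ord0 i).
Proof. by apply: continuous_measurable_rV; exact: coord_continuous. Qed.

Lemma continuous_dot (R : realType) m (t : 'rV[R]_m) : continuous (dot t).
Proof.
apply: (@continuous_big R _ +%R 0 xpredT add_continuous) => i _ z.
apply: (continuous_comp (f := fun y : 'rV[R]_m => y ord0 i)
  (g := fun u : R => t ord0 i * u)); first exact: coord_continuous.
by apply: cvgM; [exact: cvg_cst|exact: cvg_id].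
Qed.

Lemma continuous_expdot (R : realType) m (t : 'rV[R]_m) :
  continuous (fun y => expR (dot t y)).
Proof.
move=> y; apply: (continuous_comp (f := dot t)).
  exact: continuous_dot.
exact: continuous_expR.
Qed.

Lemma continuous_mul_rV (R : realType) m (f g : 'rV[R]_m -> R) :
  continuous f -> continuous g -> continuous (fun y => f y * g y).
Proof.
by move=> fc gc y; exact: (@cvgM R _ (nbhs y) _ f g (f y) (g y) (fc y) (gc y)).
Qed.

Definition box (R : realType) (m : nat) (K : R) : set 'rV[R]_m :=
  [set y | forall i, `|y ord0 i| <= K].

Lemma measurable_box (R : realType) m (K : R) :
  measurable (box K : set (borel_rV R m)).
Proof.
have -> : box K = \bigcap_(i in [set: 'I_m])
    [set y : borel_rV R m | `|y ord0 i| <= K].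
  by apply/seteqP; split => w H i; [move=> _|]; exact: H.
apply: fin_bigcap_measurable => // i _.
rewrite -[X in measurable X]setTI.
have mf : measurable_fun setT (fun y : borel_rV R m => `|y ord0 i|).
  by apply: measurableT_comp => //; exact: measurable_coord.
have := mf measurableT _ (measurable_itv `]-oo, K]).
by congr (measurable (_ `&` _)); apply/seteqP; split => w /=; rewrite in_itv.
Qed.

Lemma le_box (R : realType) m (K1 K2 : R) :
  K1 <= K2 -> box K1 `<=` (box K2 : set 'rV[R]_m).
Proof. by move=> K12 y yK i; exact: le_trans (yK i) K12. Qed.

Lemma dot_le_box (R : realType) m (K : R) (t y : 'rV[R]_m) :
  box K y -> `|dot t y| <= \sum_(i < m) `|t ord0 i| * K.
Proof.
move=> yK; apply: le_trans (ler_norm_sum _ _ _) _.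
by apply: ler_sum => i _; rewrite normrM ler_wpM2l.
Qed.

Lemma dotDl (R : realType) m (t u y : 'rV[R]_m) :
  dot (t + u) y = dot t y + dot u y.
Proof.
by rewrite /dot -big_split /=; apply: eq_bigr => i _; rewrite mxE mulrDl.
Qed.

Lemma dotNl (R : realType) m (t y : 'rV[R]_m) : dot (- t) y = - dot t y.
Proof.
by rewrite /dot -sumrN; apply: eq_bigr => i _; rewrite mxE mulNr.
Qed.

Lemma mexpsum_tilt (R : realType) m (t y : 'rV[R]_m) s :
  expR (dot t y) * mexpsum s y = mexpsum [seq (p.1, t + p.2) | p <- s] y.
Proof.
rewrite /mexpsum big_map big_distrr /=; apply: eq_bigr => p _.
by rewrite dotDl expRD mulrCA.
Qed.

Lemma mcosh_mexpsum (R : realType) m (rho : R) : 0 <= rho ->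
  exists2 s : seq (R * 'rV[R]_m),
    (forall p, p \in s -> forall i, `|p.2 ord0 i| <= rho) &
    forall y, mexpsum s y = mcosh rho y.
Proof.
move=> r0.
have [|S S1 S2] := @prod_expsum R m rho (fun=> [:: (1, rho); (1, - rho)])
  (index_enum _) r0 (index_enum_uniq _).
  move=> i p; rewrite !inE => /orP[|] /eqP -> /=; first by rewrite ger0_norm.
  by rewrite normrN ger0_norm.
exists S => [p pS i|y]; first by have := S1 p pS i; rewrite mem_index_enum.
rewrite S2; apply: eq_bigr => i _.
by rewrite /expsum /cosh2 big_cons big_seq1 /= !mul1r mulNr.
Qed.

(** * From exponential moments to convergence in law *)

(** The exponential moments of [Y n], truncated to growing boxes, converge to [M] on
    an open cube of exponents that has 0 only on its boundary. Without the truncation the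
    moments of [Y n] may be infinite. *)
Definition box_mgf_cvg (R : realType) (m : nat)
    (d : nat -> measure_display) (T : forall n, measurableType (d n))
    (P : forall n, probability (T n) R) (Y : forall n, T n -> 'rV[R]_m)
    (c : R) (M : 'rV[R]_m -> R) :=
  forall t : 'rV[R]_m, (forall i, 0 < t ord0 i < c) ->
    forall eps, 0 < eps -> exists K0, forall K, K0 <= K -> \forall n \near \oo,
      `|\int[P n]_(w in Y n @^-1` box K) expR (dot t (Y n w)) - M t| <= eps.

Lemma bounded_integrable (R : realType) d (T : measurableType d)
    (P : probability T R) (D : set T) (g : T -> R) (C : R) :
  measurable D -> measurable_fun setT g -> (forall w, D w -> `|g w| <= C) ->
  P.-integrable D (EFin \o g).
Proof.
move=> mD mg gC.
apply: (@le_integrable _ _ _ P D mD _ (cst C%:E)).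
- by apply/measurable_EFinP; exact: measurable_funTS.
- by move=> w Dw; rewrite /= lee_fin (le_trans (gC w Dw)) ?ler_norm.
- exact: finite_measure_integrable_cst.
Qed.

Lemma measurable_preimage_box (R : realType) m d (T : measurableType d)
    (V : T -> 'rV[R]_m) (K : R) :
  measurable_fun setT (V : T -> borel_rV R m) -> measurable (V @^-1` box K).
Proof.
by move=> mV; rewrite -[X in measurable X]setTI; apply: mV => //; exact: measurable_box.
Qed.

Lemma expdot_le_box (R : realType) m (t : 'rV[R]_m) (K : R) (y : 'rV[R]_m) :
  box K y -> `|expR (dot t y)| <= expR (\sum_(i < m) `|t ord0 i| * K).
Proof.
move=> yK; rewrite ger0_norm ?expR_ge0// ler_expR.
by rewrite (le_trans _ (dot_le_box t yK))// ler_norm.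
Qed.

Lemma box_expdot_integrable (R : realType) m d (T : measurableType d)
    (P : probability T R) (V : T -> 'rV[R]_m) (K : R) (t : 'rV[R]_m) :
  measurable_fun setT (V : T -> borel_rV R m) ->
  P.-integrable (V @^-1` box K) (EFin \o (fun w => expR (dot t (V w)))).
Proof.
move=> mV.
have mE := measurableT_comp (continuous_measurable_rV (@continuous_expdot R m t)) mV.
exact: (@bounded_integrable _ _ _ _ _ _ (expR (\sum_(i < m) `|t ord0 i| * K))
  (measurable_preimage_box K mV) mE (fun w yK => expdot_le_box t yK)).
Qed.

Lemma lincomb_integrable (R : realType) d (T : measurableType d)
    (P : probability T R) (D : set T) (I : eqType) (s : seq I) (a : I -> R)
    (f : I -> T -> R) : measurable D ->
  (forall i, i \in s -> P.-integrable D (EFin \o f i)) ->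
  P.-integrable D (EFin \o (fun w => \sum_(i <- s) a i * f i w)).
Proof.
move=> mD; elim: s => [_|i s ih H].
  rewrite (_ : EFin \o _ = cst 0%E); first exact: integrable0.
  by apply/funext => w; rewrite /= big_nil.
have H1 : P.-integrable D (EFin \o (fun w => a i * f i w)).
  have := integrableZl mD (a i) (H i (mem_head _ _)).
  by apply: eq_integrable.
have H2 := ih (fun j js => H j (mem_behead (s := i :: s) js)).
have := integrableD mD H1 H2; apply: eq_integrable => // w _ /=.
by rewrite -EFinD big_cons.
Qed.

Lemma lincomb_Rintegral (R : realType) d (T : measurableType d)
    (P : probability T R) (D : set T) (I : eqType) (s : seq I) (a : I -> R)
    (f : I -> T -> R) : measurable D ->
  (forall i, i \in s -> P.-integrable D (EFin \o f i)) ->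
  \int[P]_(w in D) (\sum_(i <- s) a i * f i w) =
  \sum_(i <- s) a i * \int[P]_(w in D) f i w.
Proof.
move=> mD; elim: s => [_|i s ih H].
  rewrite big_nil (eq_Rintegral _ (g := fun=> 0)) ?Rintegral_cst ?mul0r//.
  by move=> w _; rewrite big_nil.
have H2 j : j \in s -> P.-integrable D (EFin \o f j).
  by move=> js; apply: H; rewrite inE js orbT.
rewrite big_cons -ih// -RintegralZl//; last exact: (H i (mem_head _ _)).
rewrite -RintegralD//.
- by apply: eq_Rintegral => w _; rewrite big_cons.
- have := integrableZl mD (a i) (H i (mem_head _ _)).
  by apply: eq_integrable.
- exact: lincomb_integrable.
Qed.

Lemma Rintegral_prob_cst (R : realType) d (T : measurableType d)
    (P : probability T R) (r : R) : \int[P]_w r = r.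
Proof.
by rewrite /Rintegral integral_cst//= probability_setT mule1.
Qed.

(** In the sup norm: 1 on the ball of radius [K], 0 outside of radius [K + 1], and
    affine in the norm in between. *)
Definition cutoff (R : realType) (m : nat) (K : R) (y : 'rV[R]_m) : R :=
  (1 + `|K + 1 - `|y| | - `|K - `|y| |) / 2.

Lemma cutoff01 (R : realType) m (K : R) (y : 'rV[R]_m) : 0 <= cutoff K y <= 1.
Proof.
rewrite /cutoff; set a := K - `|y|; have -> : K + 1 - `|y| = a + 1 by rewrite /a; ring.
by case: (ger0P a) => a0; case: (ger0P (a + 1)) => b0; apply/andP; split; lra.
Qed.

Lemma cutoff1 (R : realType) m (K : R) (y : 'rV[R]_m) : `|y| <= K -> cutoff K y = 1.
Proof.
move=> yK; rewrite /cutoff; set a := K - `|y|.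
have -> : K + 1 - `|y| = a + 1 by rewrite /a; ring.
have a0 : 0 <= a by rewrite subr_ge0.
by rewrite !ger0_norm//; [lra|lra].
Qed.

Lemma cutoff0 (R : realType) m (K : R) (y : 'rV[R]_m) : ~ box (K + 1) y ->
  cutoff K y = 0.
Proof.
move/existsNP => [i /negP]; rewrite -ltNge => Ki.
have : K + 1 < `|y|.
  rewrite (lt_le_trans Ki)// [leRHS]mx_normrE.
  exact: (le_bigmax _ (fun ij => `|y ij.1 ij.2|) (ord0, i)).
move=> Ky; rewrite /cutoff; set a := K - `|y|.
have -> : K + 1 - `|y| = a + 1 by rewrite /a; ring.
have a0 : a + 1 < 0 by rewrite /a; lra.
by rewrite !ltr0_norm//; [lra|lra].
Qed.

Lemma continuous_cutoff (R : realType) m (K : R) : continuous (@cutoff R m K).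
Proof.
move=> y; apply: (continuous_comp (f := fun y : 'rV[R]_m => `|y|)
  (g := fun u : R => (1 + `|K + 1 - u| - `|K - u|) / 2)).
  exact: norm_continuous.
apply: cvgM; last exact: cvg_cst.
apply: cvgB; first apply: cvgD; first exact: cvg_cst.
  by apply: cvg_norm; apply: cvgB; [exact: cvg_cst|exact: cvg_id].
by apply: cvg_norm; apply: cvgB; [exact: cvg_cst|exact: cvg_id].
Qed.

Lemma bounded_comp_integrable (R : realType) m d (T : measurableType d)
    (P : probability T R) (V : T -> 'rV[R]_m) (g : 'rV[R]_m -> R) (C : R) :
  measurable_fun setT (V : T -> borel_rV R m) -> continuous g ->
  (forall y, `|g y| <= C) -> P.-integrable setT (EFin \o (g \o V)).
Proof.
move=> mV gc gC; apply: (@bounded_integrable _ _ _ P setT (g \o V) C) => //.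
  apply: (measurableT_comp (T2 := borel_rV R m)); last exact: mV.
  exact: continuous_measurable_rV.
by move=> w _; exact: gC.
Qed.

Lemma cutoff_norm (R : realType) m (K : R) (y : 'rV[R]_m) : `|cutoff K y| <= 1.
Proof. by have /andP[? ?] := cutoff01 K y; rewrite ger0_norm. Qed.

(** What the cutoff removes from [f] is controlled by what it removes from the
    constant 1; this is how one passes from [f * cutoff K] to [f]. *)
Lemma cutoff_tail (R : realType) m d (T : measurableType d)
    (P : probability T R) (V : T -> 'rV[R]_m) (f : 'rV[R]_m -> R) (M K : R) :
  measurable_fun setT (V : T -> borel_rV R m) -> continuous f ->
  (forall y, `|f y| <= M) ->
  `|\int[P]_w f (V w) - \int[P]_w (f (V w) * cutoff K (V w))| <=
  M * (1 - \int[P]_w cutoff K (V w)).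
Proof.
move=> mV fc fM.
have fi := bounded_comp_integrable P mV fc fM.
have ci := bounded_comp_integrable P mV (@continuous_cutoff R m K) (cutoff_norm K).
have fci : P.-integrable setT (EFin \o (fun w => f (V w) * cutoff K (V w))).
  apply: (@bounded_comp_integrable _ _ _ _ P V (fun y => f y * cutoff K y) M) => //.
    exact: continuous_mul_rV fc (@continuous_cutoff R m K).
  by move=> y; rewrite normrM -[M]mulr1 ler_pM// cutoff_norm.
have oi : P.-integrable setT (EFin \o (fun _ : T => 1)).
  exact: finite_measure_integrable_cst.
have -> : 1 - \int[P]_w cutoff K (V w) = \int[P]_w (1 - cutoff K (V w)).
  rewrite RintegralB//; congr (_ - _).
  by rewrite Rintegral_prob_cst.
rewrite -RintegralB// -RintegralZl//; last first.
  have := integrableB measurableT oi ci; exact: eq_integrable.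
apply: le_trans (le_normr_Rintegral _ _) _ => //.
  have := integrableB measurableT fi fci; exact: eq_integrable.
apply: le_Rintegral => //.
- have := integrableB measurableT fi fci => /integrable_abse.
  by apply: eq_integrable.
- have := integrableZl measurableT M (integrableB measurableT oi ci).
  by apply: eq_integrable.
- move=> w _; have /andP[c0 c1] := cutoff01 K (V w).
  rewrite -{1}[f (V w)]mulr1 -mulrBr normrM [X in _ * X]ger0_norm ?subr_ge0//.
  by rewrite ler_wpM2r ?subr_ge0.
Qed.

Lemma cutoff_small (R : realType) m d (T : measurableType d)
    (P : probability T R) (V : T -> 'rV[R]_m) (e : R) :
  measurable_fun setT (V : T -> borel_rV R m) -> 0 < e ->
  exists K, 1 - \int[P]_w cutoff K (V w) <= e.
Proof.
move=> mV e0.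
have mc n : measurable_fun setT (fun w => (cutoff n%:R (V w))%:E).
  have := bounded_comp_integrable P mV (@continuous_cutoff R m n%:R) (cutoff_norm n%:R).
  exact: measurable_int.
have H1 w : setT w -> (cutoff n%:R (V w))%:E @[n --> \oo] --> 1%:E.
  move=> _; apply: cvg_near_cst; near=> n.
  rewrite cutoff1//; near: n; exact: nbhs_infty_ger.
have H2 w : forall n, setT w -> (`|(cutoff n%:R (V w))%:E| <= (EFin \o cst 1%R) w)%E.
  by move=> n _; rewrite /= lee_fin cutoff_norm.
have [_ _] := @dominated_convergence _ _ _ P setT measurableT
  (fun n w => (cutoff n%:R (V w))%:E) (fun=> 1%:E) (EFin \o cst 1) mc
  (measurable_cst _) (aeW _ H1) (finite_measure_integrable_cst P 1 measurableT) (aeW _ H2).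
rewrite integral_cst//= mul1e probability_setT.
move=> /fine_cvgP[_] /cvgrPdist_le /(_ _ e0)[N _ /(_ _ (leqnn N))] /= H.
exists N%:R; exact: le_trans (ler_norm _) H.
Unshelve. all: by end_near. Qed.

Section box_mgf_convergence.
Variables (R : realType) (m : nat).
Variables (d : nat -> measure_display) (T : forall n, measurableType (d n)).
Variables (P : forall n, probability (T n) R) (Y : forall n, T n -> 'rV[R]_m).
Variables (d' : measure_display) (T' : measurableType d') (P' : probability T' R).
Variables (Z : T' -> 'rV[R]_m) (c : R).
Hypothesis c_gt0 : 0 < c.
Arguments Y : clear implicits.
Hypothesis mY : forall n, measurable_fun setT (Y n : T n -> borel_rV R m).
Hypothesis mZ : measurable_fun setT (Z : T' -> borel_rV R m).
Hypothesis Z_int : forall t : 'rV[R]_m, (forall i, 0 < t ord0 i < c) ->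
  P'.-integrable setT (fun w => (expR (dot t (Z w)))%:E).
Hypothesis YZ : box_mgf_cvg P Y c (fun t => \int[P']_w expR (dot t (Z w))).

Let mYbox n K : measurable (Y n @^-1` box K).
Proof. exact: measurable_preimage_box. Qed.

Let inside (s : seq (R * 'rV[R]_m)) :=
  forall p, p \in s -> forall i, 0 < p.2 ord0 i < c.

Let Y_exp_int n K t :
  (P n).-integrable (Y n @^-1` box K) (EFin \o (fun w => expR (dot t (Y n w)))).
Proof. exact: box_expdot_integrable. Qed.

Let mexpsum_int d0 (T0 : measurableType d0) (P0 : probability T0 R) (D : set T0)
    (V : T0 -> 'rV[R]_m) (s : seq (R * 'rV[R]_m)) : measurable D ->
  (forall p, p \in s -> P0.-integrable D (EFin \o (fun w => expR (dot p.2 (V w))))) ->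
  P0.-integrable D (EFin \o (fun w => mexpsum s (V w))).
Proof. by move=> mD H; exact: lincomb_integrable. Qed.

Let mexpsum_Rintegral d0 (T0 : measurableType d0) (P0 : probability T0 R)
    (D : set T0) (V : T0 -> 'rV[R]_m) (s : seq (R * 'rV[R]_m)) : measurable D ->
  (forall p, p \in s -> P0.-integrable D (EFin \o (fun w => expR (dot p.2 (V w))))) ->
  \int[P0]_(w in D) mexpsum s (V w) =
  \sum_(p <- s) p.1 * \int[P0]_(w in D) expR (dot p.2 (V w)).
Proof. by move=> mD H; exact: lincomb_Rintegral. Qed.

Let mexpsum_cvg s eps : inside s -> 0 < eps -> exists K0, forall K, K0 <= K ->
  \forall n \near \oo,
    `|\int[P n]_(w in Y n @^-1` box K) mexpsum s (Y n w) -
      \int[P']_w mexpsum s (Z w)| <= eps.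
Proof.
elim: s eps => [|p s ih] eps ins e0.
  exists 0 => K _; near=> n.
  rewrite (mexpsum_Rintegral (T0 := T n))// (mexpsum_Rintegral (T0 := T'))//.
  by rewrite !big_nil subrr normr0 ltW.
have ins' : inside s by move=> q qs; apply: ins; rewrite inE qs orbT.
have e20 : 0 < eps / 2 by rewrite divr_gt0.
have p10 : 0 < `|p.1| + 1 by rewrite ltr_wpDl.
have [K1 H1] := ih _ ins' e20.
have [K2 H2] := YZ (ins p (mem_head _ _)) (divr_gt0 e20 p10).
exists (Num.max K1 K2) => K; rewrite ge_max => /andP[K1K K2K].
have {}H1 := H1 _ K1K; have {}H2 := H2 _ K2K.
near=> n.
have H1n : `|\int[P n]_(w in Y n @^-1` box K) mexpsum s (Y n w) -
  \int[P']_w mexpsum s (Z w)| <= eps / 2 by near: n.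
have H2n : `|\int[P n]_(w in Y n @^-1` box K) expR (dot p.2 (Y n w)) -
  \int[P']_w expR (dot p.2 (Z w))| <= eps / 2 / (`|p.1| + 1) by near: n.
move: H1n.
rewrite (mexpsum_Rintegral (s := s) (T0 := T n)); [|exact: mYbox|by move=> q _; exact: Y_exp_int].
rewrite (mexpsum_Rintegral (s := s) (T0 := T'))//; last first.
  by move=> q qs; apply: Z_int; exact: ins'.
rewrite (mexpsum_Rintegral (T0 := T n)); [|exact: mYbox|by move=> q _; exact: Y_exp_int].
rewrite (mexpsum_Rintegral (T0 := T'))//; last first.
  by move=> q qs; apply: Z_int; exact: ins.
move=> H1'; rewrite !big_cons opprD addrACA (splitr eps).
rewrite (le_trans (ler_normD _ _))// lerD// -mulrBr normrM.
apply: le_trans (ler_wpM2l (normr_ge0 _) H2n) _.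
rewrite mulrA ler_pdivrMr// mulrC ler_wpM2l ?(ltW e20)//.
by rewrite lerDl.
Unshelve. all: by end_near. Qed.

(** The centre of the cube of exponents: multiplication by [e^(t0 . y)] moves the
    exponential sums with exponents near 0 into the cube. *)
Let t0 : 'rV[R]_m := const_mx (c / 2).

(** Approximate [h] by an exponential sum [s] within [e' * mcosh (c / 4)]. After the
    tilt by [t0], both the sum and the error weight have exponents in the cube, so
    their integrals converge by hypothesis. *)
Let tilted_cvg (h : 'rV[R]_m -> R) (K1 M : R) :
  continuous h -> (forall y, `|h y| <= M) -> (forall y, ~ box K1 y -> h y = 0) ->
  \int[P n]_w (expR (dot t0 (Y n w)) * h (Y n w)) @[n --> \oo] -->
  \int[P']_w (expR (dot t0 (Z w)) * h (Z w)).
Proof.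
move=> hc hM hK.
have c40 : 0 < c / 4 by rewrite divr_gt0.
have [sW sW1 sW2] := @mcosh_mexpsum R m _ (ltW c40).
have tilt_inside (s : seq (R * 'rV[R]_m)) :
    (forall p, p \in s -> forall i, `|p.2 ord0 i| <= c / 4) ->
    inside [seq (p.1, t0 + p.2) | p <- s].
  move=> sc q /mapP[p ps ->] i /=; rewrite !mxE.
  by have := sc p ps i; rewrite ler_norml => /andP[? ?]; apply/andP; split; lra.
set W := [seq (p.1, t0 + p.2) | p <- sW].
have WE y : mexpsum W y = expR (dot t0 y) * mcosh (c / 4) y.
  by rewrite -mexpsum_tilt sW2.
have inW : inside W := tilt_inside _ sW1.
set B := \int[P']_w mexpsum W (Z w).
have B0 : 0 <= B.
  by apply: Rintegral_ge0 => w _; rewrite WE mulr_ge0 ?expR_ge0 ?mcosh_ge0.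
apply/cvgrPdist_le => e e0.
have B10 : 0 < 2 * B + 1 by rewrite ltr_wpDl ?mulr_ge0.
pose e' := e / 2 / (2 * B + 1).
have e'0 : 0 < e' by rewrite !divr_gt0.
have [s s1 s2] := mexp_approx_bounded c40 hc hM e'0.
set S := [seq (p.1, t0 + p.2) | p <- s].
have inS : inside S := tilt_inside _ s1.
have SE y : mexpsum S y = expR (dot t0 y) * mexpsum s y by rewrite -mexpsum_tilt.
have hS y : `|expR (dot t0 y) * h y - mexpsum S y| <= e' * mexpsum W y.
  rewrite SE WE -mulrBr normrM ger0_norm ?expR_ge0// mulrCA.
  by rewrite ler_wpM2l ?expR_ge0.
have e20 : 0 < e / 2 by rewrite divr_gt0.
have [KS HS] := mexpsum_cvg inS e20.
have [KW HW] := mexpsum_cvg inW ltr01.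
pose K := Num.max K1 (Num.max KS KW).
have {}HS : \forall n \near \oo,
    `|\int[P n]_(w in Y n @^-1` box K) mexpsum S (Y n w) -
      \int[P']_w mexpsum S (Z w)| <= e / 2.
  by apply: HS; rewrite !le_max lexx orbT.
have {}HW : \forall n \near \oo,
    `|\int[P n]_(w in Y n @^-1` box K) mexpsum W (Y n w) -
      \int[P']_w mexpsum W (Z w)| <= 1.
  by apply: HW; rewrite !le_max lexx !orbT.
have gc : continuous (fun y => expR (dot t0 y) * h y).
  exact: continuous_mul_rV (@continuous_expdot R m t0) hc.
(* Y n on a box and Z on the whole space are treated alike. *)
have cmp d0 (T0 : measurableType d0) (P0 : probability T0 R) (D : set T0)
    (V : T0 -> 'rV[R]_m) : measurable D ->
    measurable_fun setT (V : T0 -> borel_rV R m) ->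
    (forall p, inside [:: p] -> P0.-integrable D (EFin \o (fun w => expR (dot p.2 (V w))))) ->
    `|\int[P0]_(w in D) (expR (dot t0 (V w)) * h (V w)) -
      \int[P0]_(w in D) mexpsum S (V w)| <=
    e' * \int[P0]_(w in D) mexpsum W (V w).
  move=> mD mV Vint.
  have Sint : P0.-integrable D (EFin \o (fun w => mexpsum S (V w))).
    apply: mexpsum_int => // p pS; apply: Vint => q; rewrite inE => /eqP ->.
    exact: inS.
  have Wint : P0.-integrable D (EFin \o (fun w => mexpsum W (V w))).
    apply: mexpsum_int => // p pW; apply: Vint => q; rewrite inE => /eqP ->.
    exact: inW.
  have t0int : P0.-integrable D (EFin \o (fun w => M * expR (dot t0 (V w)))).
    have : inside [:: (1, t0)].
      move=> q; rewrite inE => /eqP -> i /=; rewrite mxE divr_gt0//=.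
      by rewrite ltr_pdivrMr// ltr_pMr// ltr1n.
    move=> /Vint /(integrableZl mD M); apply: eq_integrable => // w _ /=.
  have mh : measurable_fun setT (fun w => expR (dot t0 (V w)) * h (V w)).
    apply: (measurableT_comp (T2 := borel_rV R m)
      (f := fun y => expR (dot t0 y) * h y)); last exact: mV.
    exact: continuous_measurable_rV.
  have hint : P0.-integrable D (EFin \o (fun w => expR (dot t0 (V w)) * h (V w))).
    apply: le_integrable t0int => //.
      by apply/measurable_EFinP; exact: measurable_funTS.
    move=> w _; rewrite /= lee_fin normrM ger0_norm ?expR_ge0// mulrC.
    rewrite (le_trans _ (ler_norm _))// ler_wpM2r ?expR_ge0//.
  rewrite -RintegralB// -RintegralZl//.
  apply: le_trans (le_normr_Rintegral _ _) _ => //.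
    have := integrableB mD hint Sint; exact: eq_integrable.
  apply: le_Rintegral => //.
    have := integrableB mD hint Sint => /integrable_abse.
    by apply: eq_integrable => // w _ /=.
  by have := integrableZl mD e' Wint; apply: eq_integrable.
near=> n.
have HSn : `|\int[P n]_(w in Y n @^-1` box K) mexpsum S (Y n w) -
      \int[P']_w mexpsum S (Z w)| <= e / 2 by near: n.
have HWn : `|\int[P n]_(w in Y n @^-1` box K) mexpsum W (Y n w) - B| <= 1.
  by near: n.
have c1 := cmp _ _ (P n) (Y n @^-1` box K) (Y n) (@mYbox n K) (@mY n)
  (fun p _ => @Y_exp_int n K p.2).
have c2 := cmp _ _ P' setT Z measurableT mZ
  (fun p ip => Z_int (ip p (mem_head _ _))).
have -> : \int[P n]_w (expR (dot t0 (Y n w)) * h (Y n w)) =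
    \int[P n]_(w in Y n @^-1` box K) (expR (dot t0 (Y n w)) * h (Y n w)).
  rewrite [RHS]Rintegral_mkcond; apply: eq_Rintegral => w _.
  rewrite patchE; case: ifPn => // /negP; rewrite inE => nK.
  rewrite hK ?mulr0// => K1w; apply: nK; apply: le_box K1w.
  by rewrite le_max lexx.
set A1 := \int[P']_w _; set A2 := \int[P n]_(w in _) (_ * _).
set S1 := \int[P']_w mexpsum S _ in HSn c2 *.
set S2 := \int[P n]_(w in _) mexpsum S _ in HSn c1 *.
set W2 := \int[P n]_(w in _) mexpsum W _ in HWn c1 *.
have -> : A1 - A2 = (A1 - S1) - (S2 - S1) - (A2 - S2) by ring.
apply: le_trans (ler_normB _ _) _.
apply: le_trans (lerD (ler_normB _ _) (lexx _)) _.
apply: le_trans (lerD (lerD c2 HSn) c1) _.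
have W2B : W2 <= B + 1 by move: HWn; rewrite ler_norml => /andP[_]; lra.
have : e' * W2 <= e' * (B + 1) by rewrite ler_wpM2l// ltW.
have : e' * (2 * B + 1) = e / 2 by rewrite /e' divfK// gt_eqF.
rewrite -/B; lra.
Unshelve. all: by end_near. Qed.

(** The tilt is undone inside the test function, where [e^(- t0 . y)] is bounded
    thanks to the cutoff. *)
Let compact_cvg (f : 'rV[R]_m -> R) (M K : R) :
  continuous f -> (forall y, `|f y| <= M) ->
  \int[P n]_w (f (Y n w) * cutoff K (Y n w)) @[n --> \oo] -->
  \int[P']_w (f (Z w) * cutoff K (Z w)).
Proof.
move=> fc fM.
have M0 : 0 <= M by apply: le_trans (fM 0).
pose h y := f y * cutoff K y * expR (dot (- t0) y).
have hE y : expR (dot t0 y) * h y = f y * cutoff K y.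
  by rewrite mulrCA -expRD dotNl subrr expR0 mulr1.
have := @tilted_cvg h (K + 1) (M * expR (\sum_(i < m) `|(- t0) ord0 i| * (K + 1))).
have -> : (fun n => \int[P n]_w (expR (dot t0 (Y n w)) * h (Y n w))) =
    (fun n => \int[P n]_w (f (Y n w) * cutoff K (Y n w))).
  by apply/funext => n; apply: eq_Rintegral => w _; rewrite hE.
have -> : \int[P']_w (expR (dot t0 (Z w)) * h (Z w)) =
    \int[P']_w (f (Z w) * cutoff K (Z w)).
  by apply: eq_Rintegral => w _; rewrite hE.
apply.
- apply: continuous_mul_rV; last exact: continuous_expdot.
  exact: continuous_mul_rV fc (@continuous_cutoff R m K).
- move=> y; have [yK|yK] := pselect (box (K + 1) y).
    rewrite normrM ler_pM//; last exact: expdot_le_box.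
    by rewrite normrM -[M]mulr1 ler_pM// cutoff_norm.
  by rewrite /h cutoff0// mulr0 mul0r normr0 mulr_ge0// expR_ge0.
- by move=> y yK; rewrite /h cutoff0// mulr0 mul0r.
Qed.

(** A continuity theorem for moment generating functions. Taking the constant 1 for
    the test function in [compact_cvg] shows that no mass of [Y n] escapes to
    infinity, since the total masses are all equal to 1. *)
Theorem mgf_cvg_in_law (f : 'rV[R]_m -> R) (M : R) :
  continuous f -> (forall y, `|f y| <= M) ->
  \int[P n]_w f (Y n w) @[n --> \oo] --> \int[P']_w f (Z w).
Proof.
move=> fc fM; apply/cvgrPdist_le => e e0.
have M0 : 0 <= M by apply: le_trans (fM 0).
have M10 : 0 < M + 1 by rewrite ltr_wpDl.
have e1 : 0 < e / 4 / (M + 1) by rewrite !divr_gt0.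
have e2 : 0 < e / 4 by rewrite divr_gt0.
have [K HK] := cutoff_small P' mZ e1.
have Hf := @compact_cvg f M K fc fM.
have one_c : continuous (fun _ : 'rV[R]_m => 1 : R) by exact: cst_continuous.
have one_1 (y : 'rV[R]_m) : `|1 : R| <= 1 by rewrite normr1.
have := @compact_cvg (fun=> 1) 1 K one_c one_1.
have -> : (fun n => \int[P n]_w (1 * cutoff K (Y n w))) =
    (fun n => \int[P n]_w cutoff K (Y n w)).
  by apply/funext => n; apply: eq_Rintegral => w _; rewrite mul1r.
have -> : \int[P']_w (1 * cutoff K (Z w)) = \int[P']_w cutoff K (Z w).
  by apply: eq_Rintegral => w _; rewrite mul1r.
move=> /cvgrPdist_le /(_ _ e1) H1.
move/cvgrPdist_le : Hf => /(_ _ e2) Hf.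
near=> n.
have H1n : `|\int[P']_w cutoff K (Z w) - \int[P n]_w cutoff K (Y n w)| <= e / 4 / (M + 1).
  by near: n.
have Hfn : `|\int[P']_w (f (Z w) * cutoff K (Z w)) -
    \int[P n]_w (f (Y n w) * cutoff K (Y n w))| <= e / 4 by near: n.
have tY := cutoff_tail (P n) K (@mY n) fc fM.
have tZ := cutoff_tail P' K mZ fc fM.
move: H1n Hfn HK tY tZ.
set a := \int[P']_w cutoff _ _; set b := \int[P n]_w cutoff _ _.
set A := \int[P']_w (_ * _); set B := \int[P n]_w (_ * _).
set F := \int[P']_w _; set G := \int[P n]_w _.
move=> H1n Hfn HK tY tZ.
have eq4 : (M + 1) * (e / 4 / (M + 1)) = e / 4 by rewrite mulrC divfK// gt_eqF.
have HZ : M * (1 - a) <= e / 4.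
  rewrite -eq4; apply: (@le_trans _ _ (M * (e / 4 / (M + 1)))).
    by rewrite ler_wpM2l.
  by rewrite ler_wpM2r ?(ltW e1)// lerDl.
have HY : M * (1 - b) <= e / 4 + e / 4.
  have -> : M * (1 - b) = M * (1 - a) + M * (a - b) by ring.
  apply: lerD => //; rewrite -eq4; apply: (@le_trans _ _ (M * (e / 4 / (M + 1)))).
    by rewrite ler_wpM2l// (le_trans _ H1n)// ler_norm.
  by rewrite ler_wpM2r ?(ltW e1)// lerDl.
have -> : F - G = (F - A) + (A - B) - (G - B) by ring.
apply: le_trans (ler_normB _ _) _.
apply: le_trans (lerD (ler_normD _ _) (lexx _)) _.
apply: le_trans (lerD (lerD tZ Hfn) tY) _.
by clear one_c one_1; lra.
Unshelve. all: by end_near. Qed.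

End box_mgf_convergence.

(** * Falling factorials as approximate exponentials *)

(** A falling factorial normalized so that it is close to [e^(k (x - mu) / mu)] when
    [x] is close to [mu]: the exponential factor compensates the product of the
    [1 - j / mu] for [j < k]. *)
Definition nfall (R : realType) (mu x : R) (k : nat) : R :=
  falling x k / mu ^+ k * expR (k%:R ^+ 2 / (2 * mu)).

Lemma nfall0 (R : realType) (mu x : R) : nfall mu x 0 = 1.
Proof. by rewrite /nfall /falling big_ord0 expr0 expr0n /= mul0r expR0 divr1 mulr1. Qed.

Lemma nfallS (R : realType) (mu x : R) k : 0 < mu ->
  nfall mu x k.+1 =
  nfall mu x k * ((x - k%:R) / mu * expR ((2 * k%:R + 1) / (2 * mu))).
Proof.
move=> mu0; have mu_neq0 : mu != 0 by rewrite gt_eqF.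
rewrite /nfall /falling big_ord_recr /= exprSr.
have -> : k.+1%:R ^+ 2 / (2 * mu) =
    k%:R ^+ 2 / (2 * mu) + (2 * k%:R + 1) / (2 * mu).
  by rewrite -natr1; field.
by rewrite expRD; field; rewrite mu_neq0 expf_neq0.
Qed.

Lemma nfall_ge0 (R : realType) (mu x : R) k : 0 < mu -> k%:R - 1 <= x ->
  0 <= nfall mu x k.
Proof.
move=> mu0; elim: k => [|k ih] kx; first by rewrite nfall0.
rewrite nfallS// mulr_ge0//.
  by apply: ih; rewrite (le_trans _ kx)// lerB// ler_nat.
rewrite mulr_ge0 ?expR_ge0// divr_ge0 ?(ltW mu0)// subr_ge0.
by move: kx; rewrite -natr1 addrK.
Qed.

(** Each new factor is [1 + u] with [u = (x - k) / mu - 1], which is at most [e^u]. *)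
Lemma nfall_le (R : realType) (mu x : R) k : 0 < mu -> k%:R - 1 <= x ->
  nfall mu x k <= expR (k%:R * ((x - mu) / mu) + k%:R / (2 * mu)).
Proof.
move=> mu0; have mu_neq0 : mu != 0 by rewrite gt_eqF.
elim: k => [|k ih] kx; first by rewrite nfall0 !mul0r addr0 expR0.
have kx' : k%:R - 1 <= x by rewrite (le_trans _ kx)// lerB// ler_nat.
rewrite nfallS//.
have -> : k.+1%:R * ((x - mu) / mu) + k.+1%:R / (2 * mu) =
    (k%:R * ((x - mu) / mu) + k%:R / (2 * mu)) +
    (((x - k%:R) / mu - 1) + (2 * k%:R + 1) / (2 * mu)).
  by rewrite -natr1; field.
rewrite expRD; apply: ler_pM; [exact: nfall_ge0| |exact: ih|].
- rewrite mulr_ge0 ?expR_ge0// divr_ge0 ?(ltW mu0)// subr_ge0.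
  by move: kx; rewrite -natr1 addrK.
- rewrite expRD ler_wpM2r ?expR_ge0//.
  by have := expR_ge1Dx ((x - k%:R) / mu - 1); rewrite addrCA subrr addr0.
Qed.

(** The reverse of [1 + z <= e^z], at a loss of second order. *)
Lemma expR_sub_sqr_le (R : realType) (z : R) : - 2^-1 <= z ->
  expR (z - 2 * z ^+ 2) <= 1 + z.
Proof.
move=> z2; have D0 : 0 < 1 - (z - 2 * z ^+ 2) by nra.
have : (1 - (z - 2 * z ^+ 2)) * expR (z - 2 * z ^+ 2) <= 1.
  rewrite -ler_pdivlMr ?expR_gt0// mul1r -expRN.
  exact: expR_ge1Dx.
move=> H; rewrite -(ler_pM2l D0) (le_trans H)//.
have -> : (1 - (z - 2 * z ^+ 2)) * (1 + z) = 1 + z ^+ 2 * (1 + 2 * z) by ring.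
by rewrite lerDl mulr_ge0 ?sqr_ge0//; lra.
Qed.

(** Each of the [j] new factors is [1 + z] with [|z| <= Z] at worst, which is bounded
    below by [expR_sub_sqr_le]. *)
Lemma nfall_ratio_ge (R : realType) (mu x s Z : R) k j : 0 < mu ->
  s <= x - mu -> Z <= 2^-1 -> (`|s| + (k + j)%:R) / mu <= Z ->
  nfall mu x k * expR (j%:R * (s / mu - 2 * Z ^+ 2)) <= nfall mu x (k + j).
Proof.
move=> mu0 sx Z2; have mu_neq0 : mu != 0 by rewrite gt_eqF.
elim: j => [|j ih] Hz; first by rewrite addn0 mul0r expR0 mulr1.
have kj : ((k + j)%:R : R) <= (k + j.+1)%:R by rewrite ler_nat addnS.
have Hz' : (`|s| + (k + j)%:R) / mu <= Z.
  by rewrite (le_trans _ Hz)// ler_wpM2r ?invr_ge0 ?(ltW mu0)// lerD2l.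
rewrite addnS nfallS//.
have -> : j.+1%:R * (s / mu - 2 * Z ^+ 2) =
  j%:R * (s / mu - 2 * Z ^+ 2) + (s / mu - 2 * Z ^+ 2) by rewrite -natr1; ring.
rewrite expRD mulrA.
set z := (s - (k + j)%:R) / mu.
have zZ : `|z| <= Z.
  rewrite (le_trans _ Hz')// normrM normfV (gtr0_norm mu0).
  by rewrite ler_wpM2r ?invr_ge0 ?(ltW mu0)// (le_trans (ler_normB _ _))// normr_nat.
have z2 : - 2^-1 <= z.
  by have := le_trans zZ Z2; rewrite ler_norml => /andP[].
have step : expR (s / mu - 2 * Z ^+ 2) <=
    (x - (k + j)%:R) / mu * expR ((2 * (k + j)%:R + 1) / (2 * mu)).
  apply: (@le_trans _ _ ((1 + z) * expR ((2 * (k + j)%:R + 1) / (2 * mu)))).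
    apply: le_trans (ler_wpM2r (expR_ge0 _) (expR_sub_sqr_le z2)).
    rewrite -expRD ler_expR.
    have -> : (2 * (k + j)%:R + 1) / (2 * mu) = (k + j)%:R / mu + (2 * mu)^-1.
      by field.
    have : z ^+ 2 <= Z ^+ 2.
      rewrite -(real_normK (num_real z)) lerXn2r ?nnegrE//.
      exact: le_trans zZ.
    have : 0 <= (2 * mu)^-1 by rewrite invr_ge0 mulr_ge0 ?ltW.
    rewrite /z mulrBl; lra.
  rewrite ler_wpM2r ?expR_ge0//.
  have -> : 1 + z = (mu + s - (k + j)%:R) / mu by rewrite /z; field.
  by rewrite ler_wpM2r ?invr_ge0 ?(ltW mu0)//; lra.
have xkj : (k + j)%:R - 1 <= x.
  have : (`|s| + (k + j)%:R) / mu <= 1 by rewrite (le_trans Hz')// (le_trans Z2)//; lra.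
  by rewrite ler_pdivrMr// mul1r; have := ler_norm (- s); rewrite normrN; lra.
apply: ler_pM => //.
- rewrite mulr_ge0 ?expR_ge0// nfall_ge0//.
  by rewrite (le_trans _ xkj)// lerB// ler_nat leq_addr.
- exact: ih.
Qed.

(** Below its last zero the falling factorial may be negative, but it is negligible
    there: its factors are all at most [k] in absolute value. *)
Lemma nfall_small (R : realType) (mu x eta : R) k : 0 < mu -> 0 <= x ->
  x < k%:R - 1 -> k%:R / mu * expR (k%:R / (2 * mu)) <= eta -> eta <= 1 ->
  `|nfall mu x k| <= eta.
Proof.
move=> mu0 x0 xk ke e1; have mu_neq0 : mu != 0 by rewrite gt_eqF.
set b := k%:R / mu * expR (k%:R / (2 * mu)) in ke *.
have b0 : 0 <= b by rewrite mulr_ge0 ?expR_ge0// divr_ge0 ?(ltW mu0).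
have k0 : (0 < k)%N.
  have : 1 < k%:R :> R by lra.
  by rewrite ltr1n => /ltnW.
apply: (@le_trans _ _ (b ^+ k)); last first.
  have b1 : b <= 1 by exact: le_trans e1.
  apply: le_trans ke; case: (k) k0 => // q _.
  by rewrite exprS ler_piMr// exprn_ile1.
rewrite /b exprMn -expRM_natl /nfall normrM [X in _ * X]ger0_norm ?expR_ge0//.
have -> : k%:R * (k%:R / (2 * mu)) = k%:R ^+ 2 / (2 * mu) by field.
rewrite ler_wpM2r ?expR_ge0// normrM normfV normrX (gtr0_norm mu0) expr_div_n.
rewrite ler_wpM2r ?invr_ge0 ?exprn_ge0 ?(ltW mu0)//.
rewrite /falling normr_prod.
have -> : k%:R ^+ k = \prod_(j < k) (k%:R : R).
  by rewrite prodr_const card_ord.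
apply: ler_prod => j _; rewrite normr_ge0/= ler_norml.
have : (j%:R : R) <= k%:R by rewrite ler_nat ltnW.
have : (0 : R) <= j%:R by [].
by move=> ? ?; apply/andP; split; lra.
Qed.

(** The order of the factorial moment that plays the role of the exponent [t]. *)
Definition ford (R : realType) (mu sigma t : R) : nat :=
  Num.trunc (t * mu / sigma).

(** An upper bound of [|nfall|] where the falling factorial may be negative. *)
Definition fall_err (R : realType) (c sigma : R) : R :=
  c / sigma * expR (c / sigma / 2).

(** A nonnegative substitute for [e^(t (x - mu) / sigma)] on the half-line
    [0 <= x], whose expectation is a combination of factorial moments. *)
Definition vfall (R : realType) (c mu sigma t x : R) : R :=
  nfall mu x (ford mu sigma t) + fall_err c sigma.

Section vfall.
Variables (R : realType) (c mu sigma K : R).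
Hypotheses (c0 : 0 < c) (mu0 : 0 < mu) (sigma0 : 0 < sigma) (K0 : 0 <= K).

Let mu_neq0 : mu != 0. Proof. by rewrite gt_eqF. Qed.
Let sigma_neq0 : sigma != 0. Proof. by rewrite gt_eqF. Qed.
Local Notation k t := (ford mu sigma t).
Local Notation tau t := ((k t)%:R * (sigma / mu)).
Local Notation eta := (fall_err c sigma).

Lemma fall_err_ge0 : 0 <= eta.
Proof. by rewrite mulr_ge0 ?expR_ge0// divr_ge0// ltW. Qed.

Lemma ford_le t : 0 <= t -> tau t <= t.
Proof.
move=> t0; rewrite mulrA ler_pdivrMr// -ler_pdivlMr//.
by rewrite truncn_le divr_ge0 ?mulr_ge0 ?(ltW mu0) ?(ltW sigma0).
Qed.

Lemma ford_ge t : t <= tau t + sigma / mu.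
Proof.
rewrite -[X in _ + X]mul1r -mulrDl natr1 mulrA ler_pdivlMr// -ler_pdivrMr//.
by rewrite ltW// truncnS_gt.
Qed.

Lemma ford0 : k 0 = 0%N.
Proof. by rewrite /ford !mul0r trunc0. Qed.

Lemma ford_lec t : 0 <= t <= c -> (k t)%:R / mu <= c / sigma.
Proof.
move=> /andP[t0 tc]; rewrite ler_pdivlMr// mulrAC -mulrA.
exact: le_trans (ford_le t0) tc.
Qed.

Lemma ford_mono t t' : 0 <= t -> t <= t' -> (k t <= k t')%N.
Proof.
move=> t0 tt'; apply: le_truncn.
by rewrite ler_wpM2r ?invr_ge0 ?(ltW sigma0)// ler_wpM2r// ltW.
Qed.

(** For [|x - mu| <= K sigma] and [k] of the order of a factorial moment in use, a
    bound of the relative deviation [(|x - mu| + k) / mu]. *)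
Definition fall_Z : R := K * (sigma / mu) + c / sigma.
(** The loss [2 Z^2] per factor in [nfall_ratio_ge], accumulated over the at most
    [c mu / sigma] factors. *)
Definition fall_E : R := c * (mu / sigma) * (2 * fall_Z ^+ 2).

Hypotheses (Z2 : fall_Z <= 2^-1) (eta1 : eta <= 1).

Let cs0 : 0 <= c / sigma. Proof. by rewrite divr_ge0// ltW. Qed.
Let sm0 : 0 <= sigma / mu. Proof. by rewrite divr_ge0// ltW. Qed.
Let Ksm0 : 0 <= K * (sigma / mu). Proof. by rewrite mulr_ge0. Qed.
Let Z0 : 0 <= fall_Z. Proof. by rewrite addr_ge0. Qed.

Let k_eta t : 0 <= t <= c ->
  (k t)%:R / mu * expR ((k t)%:R / (2 * mu)) <= eta.
Proof.
move=> tc; have H := ford_lec tc; apply: ler_pM => //.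
- by rewrite divr_ge0// ltW.
- by rewrite ler_expR invfM mulrCA mulrC ler_wpM2r// invr_ge0.
Qed.

Lemma vfall_ge0 t x : 0 <= t <= c -> 0 <= x -> 0 <= vfall c mu sigma t x.
Proof.
move=> tc x0; rewrite /vfall; have [kx|xk] := lerP ((k t)%:R - 1) x.
  by rewrite addr_ge0 ?nfall_ge0 ?fall_err_ge0.
have := nfall_small mu0 x0 xk (k_eta tc) eta1.
by rewrite ler_norml => /andP[? _]; lra.
Qed.

Lemma vfall0_ge1 x : 1 <= vfall c mu sigma 0 x.
Proof. by rewrite /vfall ford0 nfall0 lerDl fall_err_ge0. Qed.

Lemma nfall_le_exp t x : 0 <= t <= c -> (k t)%:R - 1 <= x ->
  nfall mu x (k t) <= expR (tau t * ((x - mu) / sigma) + c / sigma / 2).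
Proof.
move=> tc kx; apply: le_trans (nfall_le mu0 kx) _; rewrite ler_expR.
have -> : (k t)%:R * ((x - mu) / mu) = tau t * ((x - mu) / sigma).
  by field; rewrite mu_neq0 sigma_neq0.
rewrite lerD2l invfM mulrCA mulrC ler_wpM2r ?invr_ge0//; exact: ford_lec.
Qed.

Let nfall_ratio t t' x y0 : 0 <= t -> t <= t' -> t' <= c -> `|y0| <= K ->
  y0 <= (x - mu) / sigma ->
  nfall mu x (k t) * expR ((tau t' - tau t) * y0 - fall_E) <= nfall mu x (k t').
Proof.
move=> t0 tt' tc y0K y0x.
have t0c : 0 <= t <= c by rewrite t0 (le_trans tt').
have t'0c : 0 <= t' <= c by rewrite tc (le_trans t0).
have kk := ford_mono t0 tt'.
have kD : (k t)%:R + (k t' - k t)%:R = (k t')%:R :> R by rewrite -natrD subnKC.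
have HZ : (`|sigma * y0| + (k t + (k t' - k t))%:R) / mu <= fall_Z.
  rewrite natrD kD mulrDl lerD//; last exact: ford_lec.
  by rewrite normrM (gtr0_norm sigma0) mulrAC mulrC ler_wpM2r.
have sx : sigma * y0 <= x - mu by rewrite mulrC -ler_pdivlMr.
have := nfall_ratio_ge mu0 sx Z2 HZ; rewrite subnKC//; apply: le_trans.
have [kx|xk] := lerP 0 (nfall mu x (k t)); last first.
  suff : 0 <= nfall mu x (k t) by rewrite leNgt xk.
  apply: nfall_ge0 => //.
  have : (`|sigma * y0| + (k t)%:R) / mu <= 1.
    apply: (@le_trans _ _ fall_Z); last by have Z2' := Z2; lra.
    by apply: le_trans HZ; rewrite ler_wpM2r ?invr_ge0 ?(ltW mu0)// lerD2l ler_nat leq_addr.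
  rewrite ler_pdivrMr// mul1r; have := ler_norm (- (sigma * y0)).
  by rewrite normrN; lra.
rewrite ler_wpM2l// ler_expR mulrBr.
have -> : (k t' - k t)%:R * (sigma * y0 / mu) = (tau t' - tau t) * y0.
  by rewrite natrB//; field.
rewrite lerD2l lerN2 /fall_E ler_wpM2r ?mulr_ge0 ?sqr_ge0//.
rewrite mulrA ler_pdivlMr// -ler_pdivrMr// mulrAC.
have := ford_lec t'0c; rewrite ler_pdivlMr//; apply: le_trans.
rewrite ler_wpM2r ?(ltW sigma0)//.
by rewrite ler_wpM2r ?invr_ge0 ?(ltW mu0)// ler_nat leq_subr.
Qed.

Let k_le_x t x : 0 <= t <= c -> - K <= (x - mu) / sigma -> (k t)%:R - 1 <= x.
Proof.
move=> tc yK; have : fall_Z <= 1 by have Z2' := Z2; lra.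
rewrite /fall_Z => HZ.
have H : (k t)%:R / mu <= 1 - K * (sigma / mu) by have := ford_lec tc; lra.
move: yK; rewrite ler_pdivlMr// => yK.
move: H; rewrite ler_pdivrMr// mulrBl mul1r mulrA divfK//; lra.
Qed.

Let tau_y t y : 0 <= t -> `|y| <= K ->
  `|tau t * y - t * y| <= K * (sigma / mu).
Proof.
move=> t0 yK; rewrite -mulrBl normrM mulrC ler_pM// ler_norml.
by have := ford_le t0; have := ford_ge t; move=> *; apply/andP; split; lra.
Qed.

(** On the box [|x - mu| <= K sigma], [vfall] lies between [vfall_low] and [vfall_up]
    times the exponential; both factors tend to 1. *)
Definition vfall_up : R := expR (K * (sigma / mu) + c / sigma / 2) + eta * expR (c * K).
Definition vfall_low : R := expR (- (K * (sigma / mu) + fall_E)).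

Lemma vfall_le_box t x : 0 <= t <= c -> `|(x - mu) / sigma| <= K ->
  vfall c mu sigma t x <= expR (t * ((x - mu) / sigma)) * vfall_up.
Proof.
move=> tc; set y := (x - mu) / sigma => yK.
have /andP[t0 tc'] := tc.
have /andP[yK1 yK2] : - K <= y <= K by rewrite -ler_norml.
rewrite /vfall /vfall_up mulrDr lerD//.
  apply: le_trans (nfall_le_exp tc (k_le_x tc yK1)) _.
  rewrite -expRD ler_expR -/y addrA lerD2r.
  by have := tau_y t0 yK; rewrite ler_norml => /andP[_]; lra.
rewrite mulrCA -expRD ler_peMr ?fall_err_ge0// -expR0 ler_expR.
have : `|t * y| <= c * K by rewrite normrM ger0_norm// ler_pM.
by rewrite ler_norml => /andP[]; lra.
Qed.

Lemma vfall_ge_box t x : 0 <= t <= c -> `|(x - mu) / sigma| <= K ->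
  expR (t * ((x - mu) / sigma)) * vfall_low <= vfall c mu sigma t x.
Proof.
move=> tc; set y := (x - mu) / sigma => yK; have /andP[t0 tc'] := tc.
have := @nfall_ratio 0 t x y (lexx _) t0 tc' yK (lexx _).
rewrite ford0 nfall0 mul1r mul0r subr0 => H.
apply: (@le_trans _ _ (nfall mu x (k t))); last by rewrite lerDl fall_err_ge0.
apply: le_trans H; rewrite -expRD ler_expR.
by have := tau_y t0 yK; rewrite ler_norml => /andP[]; lra.
Qed.

(** To the left of the box, [e^(t y)] is at most [e^(- t K)] times its value at the
    exponent 0. *)
Definition vfall_tail_low (t : R) : R :=
  expR (- (t * K) + K * (sigma / mu) + c / sigma / 2) + 2 * eta.

Lemma vfall_le_tail_low t x : 0 <= t <= c -> 0 <= x -> (x - mu) / sigma < - K ->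
  vfall c mu sigma t x <= vfall_tail_low t * vfall c mu sigma 0 x.
Proof.
move=> tc x0 yK; have /andP[t0 tc'] := tc.
have e0 := fall_err_ge0.
have T0 : 0 <= vfall_tail_low t by rewrite addr_ge0 ?expR_ge0// mulr_ge0.
apply: (@le_trans _ _ (vfall_tail_low t)); last first.
  by rewrite ler_peMr// vfall0_ge1.
rewrite /vfall /vfall_tail_low; have [kx|xk] := lerP ((k t)%:R - 1) x.
  rewrite mulr_natl mulr2n addrA lerD2r ler_wpDr//.
  apply: le_trans (nfall_le_exp tc kx) _; rewrite ler_expR lerD2r.
  apply: (@le_trans _ _ (tau t * - K)).
    by apply: ler_wpM2l; [rewrite mulr_ge0|exact: ltW].
  have : (t - tau t) * K <= sigma / mu * K.
    by rewrite ler_wpM2r//; have := ford_ge t; lra.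
  by lra.
have := nfall_small mu0 x0 xk (k_eta tc) eta1.
rewrite ler_norml => /andP[_ H].
by rewrite mulr_natl mulr2n ler_wpDl ?expR_ge0// lerD2r.
Qed.

(** To the right of the box, [e^(t y)] is at most [e^(- (c - t) K)] times [e^(c y)].
    The two tails are the reason why [t] has to stay strictly between 0 and [c]. *)
Definition vfall_tail_high (t : R) : R :=
  expR (- ((c - t) * K) + K * (sigma / mu) + fall_E) + eta * expR fall_E.

Lemma vfall_le_tail_high t x : 0 <= t <= c -> K < (x - mu) / sigma ->
  vfall c mu sigma t x <= vfall_tail_high t * vfall c mu sigma c x.
Proof.
move=> tc yK; have /andP[t0 tc'] := tc; have e0 := fall_err_ge0.
have KK : `|K| <= K by rewrite ger0_norm.
have T0 : 0 <= vfall_tail_high t.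
  by rewrite addr_ge0 ?expR_ge0// mulr_ge0// expR_ge0.
apply: (@le_trans _ _ (vfall_tail_high t * nfall mu x (k c))); last first.
  by rewrite ler_wpM2l// lerDl.
have R1 := @nfall_ratio t c x K t0 tc' (lexx _) KK (ltW yK).
have R0 := @nfall_ratio 0 c x K (lexx _) (ltW c0) (lexx _) KK (ltW yK).
rewrite ford0 nfall0 mul1r mul0r subr0 in R0.
rewrite /vfall /vfall_tail_high mulrDl lerD//.
  rewrite -[leLHS]mulr1 -(expR0 R) -(subrr ((tau c - tau t) * K - fall_E)).
  rewrite expRD mulrA mulrC ler_pM ?expR_ge0//.
    rewrite mulr_ge0 ?expR_ge0//; apply: nfall_ge0 => //.
    by apply: k_le_x => //; rewrite (le_trans _ (ltW yK))//; have K0' := K0; lra.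
  rewrite ler_expR opprB.
  have H1 : (tau c - tau t) * K >= (c - t) * K - K * (sigma / mu).
    rewrite [K * _]mulrC -mulrBl ler_wpM2r//.
    by have := ford_ge c; have := ford_le t0; lra.
  lra.
rewrite -mulrA ler_peMr// (le_trans _ (ler_wpM2l (expR_ge0 _) R0))//.
rewrite -expRD addrCA subrr addr0 -expR0 ler_expR mulr_ge0//.
by rewrite mulr_ge0.
Qed.

End vfall.

(** * Factorial moments and truncated exponential moments *)

Lemma cvg_expR (R : realType) T (F : set_system T) (FF : Filter F) (f : T -> R) (a : R) :
  f x @[x --> F] --> a -> expR (f x) @[x --> F] --> expR a.
Proof. by move=> fa; apply: (cvg_comp _ _ fa); exact: continuous_expR. Qed.

Lemma cvg_sumr (R : realType) T (F : set_system T) (FF : Filter F) I (r : seq I)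
    (f : I -> T -> R) (a : I -> R) :
  (forall i, f i x @[x --> F] --> a i) ->
  \sum_(i <- r) f i x @[x --> F] --> \sum_(i <- r) a i.
Proof.
by move=> fa; apply: (@cvg_big _ _ +%R 0 xpredT add_continuous) => i _; exact: fa.
Qed.

Lemma cvg_prodr (R : realType) T (F : set_system T) (FF : Filter F) I (r : seq I)
    (f : I -> T -> R) (a : I -> R) :
  (forall i, f i x @[x --> F] --> a i) ->
  \prod_(i <- r) f i x @[x --> F] --> \prod_(i <- r) a i.
Proof.
move=> fa; elim: r => [|i r ih].
  by under eq_fun do rewrite big_nil; rewrite big_nil; exact: cvg_cst.
by under eq_fun do rewrite big_cons; rewrite big_cons; exact: cvgM.
Qed.

Section scale_limits.
Variables (R : realType) (mu sigma : R^nat) (c : R).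
Hypotheses (mu_gt0 : forall n, 0 < mu n) (sigma_gt0 : forall n, 0 < sigma n).
Hypotheses (sm : much_less sigma mu) (ms : much_less mu (fun n => sigma n ^+ 3)).

(** The square of [1 / sigma] is [(sigma / mu) * (mu / sigma^3)]. *)
Lemma inv_sigma_cvg0 : (sigma n)^-1 @[n --> \oo] --> (0 : R).
Proof.
have H : (sigma n)^-1 ^+ 2 @[n --> \oo] --> (0 : R).
  have -> : (fun n => (sigma n)^-1 ^+ 2) =
      (fun n => (sigma n / mu n) * (mu n / sigma n ^+ 3)).
    apply/funext => n.
    by field; rewrite (gt_eqF (mu_gt0 n)) (gt_eqF (sigma_gt0 n)).
  by rewrite -[X in _ --> X](mulr0 0); exact: cvgM sm ms.
apply/cvgrPdist_lt => e e0; move/cvgrPdist_lt : H => /(_ (e ^+ 2)).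
rewrite exprn_gt0// => /(_ isT); apply: filterS => n.
rewrite !sub0r !normrN normrX.
by rewrite ltr_pXn2r// ?nnegrE ?(ltW e0).
Unshelve. all: by end_near. Qed.

Let c_sigma : c / sigma n @[n --> \oo] --> (0 : R).
Proof. by rewrite -(mulr0 c); apply: cvgM; [exact: cvg_cst|exact: inv_sigma_cvg0]. Qed.

Let K_sm K : K * (sigma n / mu n) @[n --> \oo] --> (0 : R).
Proof. by rewrite -(mulr0 K); apply: cvgM; [exact: cvg_cst|exact: sm]. Qed.

Lemma fall_Z_cvg K : fall_Z c (mu n) (sigma n) K @[n --> \oo] --> (0 : R).
Proof. by rewrite -(addr0 0); exact: cvgD. Qed.

(** The term [mu / sigma^3] is where [mu << sigma^3] enters. *)
Lemma fall_E_cvg K : fall_E c (mu n) (sigma n) K @[n --> \oo] --> (0 : R).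
Proof.
have -> : (fun n => fall_E c (mu n) (sigma n) K) = (fun n =>
    (2 * c * K) * (K * (sigma n / mu n)) + (4 * c * K) * (c / sigma n) +
    (2 * c ^+ 3) * (mu n / sigma n ^+ 3)).
  apply/funext => n; rewrite /fall_E /fall_Z.
  by field; rewrite (gt_eqF (mu_gt0 n)) (gt_eqF (sigma_gt0 n)).
have -> : (0 : R) = (2 * c * K) * 0 + (4 * c * K) * 0 + (2 * c ^+ 3) * 0 by ring.
apply: cvgD; first apply: cvgD.
- by apply: cvgM; [exact: cvg_cst|exact: K_sm].
- by apply: cvgM; [exact: cvg_cst|exact: c_sigma].
- by apply: cvgM; [exact: cvg_cst|exact: ms].
Qed.

Let c_sigma2 : c / sigma n / 2 @[n --> \oo] --> (0 : R).
Proof. by rewrite -(mul0r 2^-1); apply: cvgM; [exact: c_sigma|exact: cvg_cst]. Qed.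

Lemma fall_err_cvg : fall_err c (sigma n) @[n --> \oo] --> (0 : R).
Proof.
rewrite -(mul0r (expR 0)); apply: cvgM => //.
exact: cvg_expR.
Qed.

Lemma vfall_up_cvg K : vfall_up c (mu n) (sigma n) K @[n --> \oo] --> (1 : R).
Proof.
have -> : (1 : R) = expR (0 + 0) + 0 * expR (c * K).
  by rewrite addr0 expR0 mul0r addr0.
apply: cvgD; first by apply: cvg_expR; exact: cvgD.
by apply: cvgM; [exact: fall_err_cvg|exact: cvg_cst].
Qed.

Lemma vfall_low_cvg K : vfall_low c (mu n) (sigma n) K @[n --> \oo] --> (1 : R).
Proof.
have -> : (1 : R) = expR (- (0 + 0)) by rewrite addr0 oppr0 expR0.
by apply: cvg_expR; apply: cvgN; apply: cvgD => //; exact: fall_E_cvg.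
Qed.

Lemma vfall_tail_low_cvg K t :
  vfall_tail_low c (mu n) (sigma n) K t @[n --> \oo] --> expR (- (t * K)).
Proof.
have -> : expR (- (t * K)) = expR (- (t * K) + 0 + 0) + 2 * 0.
  by rewrite !addr0 mulr0 addr0.
apply: cvgD.
  by apply: cvg_expR; apply: cvgD => //; apply: cvgD => //; exact: cvg_cst.
by apply: cvgM; [exact: cvg_cst|exact: fall_err_cvg].
Qed.

Lemma vfall_tail_high_cvg K t :
  vfall_tail_high c (mu n) (sigma n) K t @[n --> \oo] --> expR (- ((c - t) * K)).
Proof.
have -> : expR (- ((c - t) * K)) = expR (- ((c - t) * K) + 0 + 0) + 0 * expR 0.
  by rewrite !addr0 mul0r addr0.
have E := fall_E_cvg K.
apply: cvgD.
  by apply: cvg_expR; apply: cvgD => //; apply: cvgD => //; exact: cvg_cst.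
by apply: cvgM; [exact: fall_err_cvg|exact: cvg_expR].
Qed.

Lemma ford_cvg t : 0 <= t ->
  (ford (mu n) (sigma n) t)%:R * (sigma n / mu n) @[n --> \oo] --> t.
Proof.
move=> t0; apply: (@squeeze_cvgr _ _ _ _ (fun n => t - sigma n / mu n) (fun=> t)).
- near=> n; have := ford_ge (mu_gt0 n) (sigma_gt0 n) t.
  have := ford_le (mu_gt0 n) (sigma_gt0 n) t0.
  by move=> *; apply/andP; split; lra.
- by rewrite -[X in _ --> X](subr0 t); apply: cvgB; [exact: cvg_cst|exact: sm].
- exact: cvg_cst.
Unshelve. all: by end_near. Qed.

End scale_limits.

Definition quad (R : realType) (m : nat) (G : 'M[R]_m) (t : 'rV[R]_m) : R :=
  \sum_(i < m) \sum_(j < m) G i j * t ord0 i * t ord0 j.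

(** The moment generating function of the centred normal law with covariance [G]. *)
Definition gauss_mgf (R : realType) (m : nat) (G : 'M[R]_m) (t : 'rV[R]_m) : R :=
  expR (2^-1 * quad G t).

Definition upd (R : realType) (m : nat) (t : 'rV[R]_m) (i : 'I_m) (a : R) : 'rV[R]_m :=
  \row_j (if j == i then a else t ord0 j).

Lemma integrable_bigsum (R : realType) d (T : measurableType d)
    (P : probability T R) (I : eqType) (s : seq I) (f : I -> T -> R) :
  (forall i, P.-integrable setT (EFin \o f i)) ->
  P.-integrable setT (EFin \o (fun w => \sum_(i <- s) f i w)).
Proof.
move=> H; have := @lincomb_integrable R _ T P setT I s (fun=> 1) f measurableT
  (fun i _ => H i).
by apply: eq_integrable => // w _ /=; congr EFin; apply: eq_bigr => i _; rewrite mul1r.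
Qed.

Lemma Rintegral_bigsum (R : realType) d (T : measurableType d)
    (P : probability T R) (I : eqType) (s : seq I) (f : I -> T -> R) :
  (forall i, P.-integrable setT (EFin \o f i)) ->
  \int[P]_w (\sum_(i <- s) f i w) = \sum_(i <- s) \int[P]_w f i w.
Proof.
move=> H; have := @lincomb_Rintegral R _ T P setT I s (fun=> 1) f measurableT
  (fun i _ => H i).
under eq_Rintegral do under eq_bigr do rewrite mul1r.
by move=> ->; apply: eq_bigr => i _; rewrite mul1r.
Qed.

Section factorial_moments.
Variables (R : realType) (m : nat).
Variables (d : nat -> measure_display) (T : forall n, measurableType (d n)).
Variables (P : forall n, probability (T n) R).
Variables (X : 'I_m -> forall n, {RV (P n) >-> R}).
Hypothesis X_ge0 : forall i n w, 0 <= X i n w.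
Variables (mu sigma : 'I_m -> R^nat).
Hypotheses (mu_gt0 : forall i n, 0 < mu i n) (sigma_gt0 : forall i n, 0 < sigma i n).
Hypotheses (sm : forall i, much_less (sigma i) (mu i))
  (ms : forall i, much_less (mu i) (fun n => sigma i n ^+ 3)).
Variables (Gamma : 'M[R]_m) (c : R).
Hypothesis c_gt0 : 0 < c.
Hypothesis factorial_moments : forall eps : R, 0 < eps ->
  \forall n \near \oo, forall k : 'I_m -> nat,
    (forall i, (k i)%:R <= c * mu i n / sigma i n) ->
    exists2 r : R, `|r| < eps &
      'E_(P n)[(fun w => \prod_(i < m) falling (X i n w) (k i))%R]%E =
      (\prod_(i < m) mu i n ^+ k i *
       expR (2^-1 * (\sum_(i < m) \sum_(j < m)
               (Gamma i j * sigma i n * sigma j n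
                - (i == j)%:R * mu i n) / (mu i n * mu j n)
               * (k i)%:R * (k j)%:R) + r))%:E.

Let nfallX n (k : 'I_m -> nat) w := \prod_(i < m) nfall (mu i n) (X i n w) (k i).

Arguments nfallX : clear implicits.

Let scaled n (k : 'I_m -> nat) : 'rV[R]_m :=
  \row_i ((k i)%:R * (sigma i n / mu i n)).

(** The exponential factor of [nfall] cancels the terms [- delta_ij mu_i] of the
    hypothesis; what remains is [gauss_mgf] at the exponents [k_i sigma_i / mu_i]. *)
Let nfallX_moment eps : 0 < eps -> \forall n \near \oo, forall k : 'I_m -> nat,
  (forall i, (k i)%:R <= c * mu i n / sigma i n) ->
  (P n).-integrable setT (EFin \o nfallX n k) /\
  exists2 r : R, `|r| < eps &
    \int[P n]_w nfallX n k w = expR (2^-1 * quad Gamma (scaled n k) + r).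
Proof.
move=> e0; have := factorial_moments e0; apply: filterS => n H k kc.
have [r re] := H k kc; rewrite unlock => E.
pose f w := \prod_(i < m) falling (X i n w) (k i).
pose C := \prod_(i < m) ((mu i n ^+ k i)^-1 * expR ((k i)%:R ^+ 2 / (2 * mu i n))).
have nE w : nfallX n k w = C * f w.
  rewrite /nfallX /C /f -big_split /=; apply: eq_bigr => i _.
  by rewrite /nfall; ring.
have mf : measurable_fun setT f.
  apply: measurable_prod => i _; apply: (measurableT_comp (f := fun x => falling x (k i))) => //.
  by apply: measurable_prod => j _; exact: measurable_funB.
have fi : (P n).-integrable setT (EFin \o f).
  apply/integrableP; split; first exact/measurable_EFinP.
  by rewrite integral_fin_num_abs// E.
split.
  have := integrableZl measurableT C fi.
  by apply: eq_integrable => // w _ /=; rewrite nE.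
exists r => //.
under eq_Rintegral do rewrite nE.
rewrite RintegralZl// /Rintegral E /= /C big_split /= -expR_sum.
rewrite mulrACA -big_split /= big1 ?mul1r; last first.
  by move=> i _; rewrite mulVf// expf_neq0// gt_eqF.
rewrite -expRD; congr expR; rewrite addrA; congr (_ + _).
rewrite /quad !mulr_sumr -big_split /=; apply: eq_bigr => i _.
rewrite !mulr_sumr.
have -> : (k i)%:R ^+ 2 / (2 * mu i n) = \sum_(j < m) 2^-1 *
    ((i == j)%:R * (mu i n / (mu i n * mu j n) * (k i)%:R * (k j)%:R)).
  rewrite (bigD1 i)//= eqxx mul1r big1 ?addr0.
    by field; rewrite gt_eqF.
  by move=> j /negbTE ij; rewrite eq_sym ij !(mul0r, mulr0).
rewrite -big_split /=; apply: eq_bigr => j _; rewrite !mxE.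
by field; rewrite !gt_eqF.
Qed.

Let fordt n (t : 'rV[R]_m) i := ford (mu i n) (sigma i n) (t ord0 i).

Let ford_bound n (t : 'rV[R]_m) : (forall i, 0 <= t ord0 i <= c) ->
  forall i, (fordt n t i)%:R <= c * mu i n / sigma i n.
Proof.
move=> tc i; have := ford_lec (mu_gt0 i n) (sigma_gt0 i n) (tc i).
by rewrite ler_pdivrMr// mulrAC.
Qed.

Let cvg_quad_ford (t : 'rV[R]_m) : (forall i, 0 <= t ord0 i <= c) ->
  quad Gamma (scaled n (fordt n t)) @[n --> \oo] --> quad Gamma t.
Proof.
move=> tc; rewrite /quad; apply: cvg_sumr => i; apply: cvg_sumr => j.
under eq_fun do rewrite !mxE.
have H l := ford_cvg (mu_gt0 l) (sigma_gt0 l) (@sm l) (andP (tc l)).1.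
exact: (cvgM (cvgM (cvg_cst _) (H i)) (H j)).
Qed.

Let nfallX_cvg (t : 'rV[R]_m) : (forall i, 0 <= t ord0 i <= c) ->
  \int[P n]_w nfallX n (fordt n t) w @[n --> \oo] --> gauss_mgf Gamma t.
Proof.
move=> tc; apply/cvgrPdist_lt => e e0.
have := @continuous_expR R (2^-1 * quad Gamma t).
move=> /cvgrPdist_lt /(_ _ e0) /nbhs_ballP[r /= r0 rP].
have r20 : 0 < r / 2 by rewrite divr_gt0.
have H1 := nfallX_moment r20.
have H2 : 2^-1 * quad Gamma (scaled n (fordt n t)) @[n --> \oo] --> 2^-1 * quad Gamma t.
  by apply: cvgM; [exact: cvg_cst|exact: cvg_quad_ford].
move/cvgrPdist_lt : H2 => /(_ _ r20) H2.
near=> n.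
have [_ [s sr ->]] : (P n).-integrable setT (EFin \o nfallX n (fordt n t)) /\
  exists2 s : R, `|s| < r / 2 & \int[P n]_w nfallX n (fordt n t) w =
    expR (2^-1 * quad Gamma (scaled n (fordt n t)) + s).
  by move: (ford_bound n tc); move: (fordt n t); near: n.
apply: rP; rewrite /ball /= opprD addrA (splitr r).
rewrite (le_lt_trans (ler_normB _ _))// ltrD//.
by near: n.
Unshelve. all: by end_near. Qed.

Let V n (t : 'rV[R]_m) w :=
  \prod_(i < m) vfall c (mu i n) (sigma i n) (t ord0 i) (X i n w).
Arguments V : clear implicits.

Let restr (t : 'rV[R]_m) (J : {set 'I_m}) : 'rV[R]_m :=
  \row_i (if i \in J then t ord0 i else 0).

(** In each coordinate [vfall] is a normalized falling factorial plus a constant,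
    and the constant is a multiple of the falling factorial of order 0. *)
Let V_expand n t w : V n t w = \sum_(J : {set 'I_m})
  (\prod_i (if i \in J then 1 else fall_err c (sigma i n))) *
  nfallX n (fordt n (restr t J)) w.
Proof.
rewrite /V /vfall bigA_distr; apply: eq_bigr => J _.
rewrite /nfallX -big_split /=; apply: eq_bigr => i _.
rewrite /fordt !mxE; case: ifP => _; first by rewrite mul1r.
by rewrite ford0 nfall0 mulr1.
Qed.

Let restr_bound (t : 'rV[R]_m) J : (forall i, 0 <= t ord0 i <= c) ->
  forall i, 0 <= restr t J ord0 i <= c.
Proof. by move=> tc i; rewrite mxE; case: ifP => // _; rewrite lexx ltW. Qed.

Let nfallX_int : \forall n \near \oo, forall t : 'rV[R]_m,
  (forall i, 0 <= t ord0 i <= c) ->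
  (P n).-integrable setT (EFin \o nfallX n (fordt n t)).
Proof.
have := nfallX_moment ltr01; apply: filterS => n H t tc.
exact: (H _ (ford_bound n tc)).1.
Qed.

Let V_int : \forall n \near \oo, forall t : 'rV[R]_m,
  (forall i, 0 <= t ord0 i <= c) -> (P n).-integrable setT (EFin \o V n t).
Proof.
apply: filterS nfallX_int => n H t tc.
have := @lincomb_integrable R _ _ (P n) setT _ (index_enum {set 'I_m})
  (fun J => \prod_i (if i \in J then 1 else fall_err c (sigma i n)))
  (fun J => nfallX n (fordt n (restr t J))) measurableT
  (fun J _ => H _ (restr_bound J tc)).
by apply: eq_integrable => // w _ /=; rewrite V_expand.
Qed.

(** Only the term of [V_expand] that takes no error constant survives in the
    limit. *)
Let V_cvg (t : 'rV[R]_m) : (forall i, 0 <= t ord0 i <= c) ->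
  \int[P n]_w V n t w @[n --> \oo] --> gauss_mgf Gamma t.
Proof.
move=> tc.
have -> : gauss_mgf Gamma t = \sum_(J : {set 'I_m})
    (\prod_(i < m) (if i \in J then 1 else 0)) * gauss_mgf Gamma (restr t J).
  rewrite (bigD1 [set: 'I_m]%SET)//= [X in _ + X]big1 ?addr0.
    rewrite big1 ?mul1r; last by move=> i _; rewrite inE.
    congr gauss_mgf; apply/rowP => i; rewrite mxE inE.
    by congr (t _ _); apply/val_inj.
  move=> J JT; have [i iJ] : exists i, i \notin J.
    apply/existsP; apply: contra_neqT JT; rewrite negb_exists => /forallP H.
    by apply/finset.setP => i; rewrite inE; exact: negbNE (H i).
  by rewrite (bigD1 i)//= (negbTE iJ) !mul0r.
pose S n := \sum_(J : {set 'I_m})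
  (\prod_(i < m) (if i \in J then 1 else fall_err c (sigma i n))) *
    \int[P n]_w nfallX n (fordt n (restr t J)) w.
have : S n @[n --> \oo] --> \sum_(J : {set 'I_m})
    (\prod_(i < m) (if i \in J then 1 else 0)) * gauss_mgf Gamma (restr t J).
  apply: cvg_sumr => J; apply: cvgM; last exact: nfallX_cvg (restr_bound J tc).
  apply: cvg_prodr => i; case: ifP => _; first exact: cvg_cst.
  exact: (fall_err_cvg c (mu_gt0 i) (sigma_gt0 i) (@sm i) (@ms i)).
apply: cvg_trans; apply: near_eq_cvg.
apply: filterS nfallX_int => n H; rewrite /S.
rewrite -(@lincomb_Rintegral _ _ _ (P n)) => [||J _]; last 2 first.
- exact: measurableT.
- exact: H (restr_bound J tc).
by apply: eq_Rintegral => w _; rewrite V_expand.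
Qed.

Let Y n (w : T n) : 'rV[R]_m := \row_i ((X i n w - mu i n) / sigma i n).
Arguments Y : clear implicits.

(** The requirements on [n] under which the bounds on [vfall] hold in the box of
    size [K]. *)
Let good n K := forall i, fall_Z c (mu i n) (sigma i n) K <= 2^-1 /\
  fall_err c (sigma i n) <= 1.

Let good_near K : \forall n \near \oo, good n K.
Proof.
apply: filter_forall => i.
have i2 : (0 : R) < 2^-1 by rewrite invr_gt0.
have H1 : \forall n \near \oo, fall_Z c (mu i n) (sigma i n) K <= 2^-1.
  exact: (cvgr_le _ (fall_Z_cvg c (mu_gt0 i) (sigma_gt0 i) (@sm i) (@ms i) K) _ i2).
have H2 : \forall n \near \oo, fall_err c (sigma i n) <= 1.
  exact: (cvgr_le _ (fall_err_cvg c (mu_gt0 i) (sigma_gt0 i) (@sm i) (@ms i)) _ ltr01).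
by near=> n; split; near: n.
Unshelve. all: by end_near. Qed.

Let V_ge0 n K (t : 'rV[R]_m) w : good n K -> (forall i, 0 <= t ord0 i <= c) ->
  0 <= V n t w.
Proof.
move=> g tc; apply: prodr_ge0 => i _; apply: vfall_ge0 => //.
exact: (g i).2.
Qed.

Let upd_bound (t : 'rV[R]_m) i a : (forall i, 0 <= t ord0 i <= c) ->
  0 <= a <= c -> forall j, 0 <= upd t i a ord0 j <= c.
Proof. by move=> tc ac j; rewrite mxE; case: ifP. Qed.

Let V_upd n K (t : 'rV[R]_m) w i a C : good n K ->
  (forall i, 0 <= t ord0 i <= c) -> 0 <= C ->
  vfall c (mu i n) (sigma i n) (t ord0 i) (X i n w) <=
    C * vfall c (mu i n) (sigma i n) a (X i n w) ->
  V n t w <= C * V n (upd t i a) w.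
Proof.
move=> g tc C0 H; rewrite /V (bigD1 i)//= [X in _ <= _ * X](bigD1 i)//= mulrA.
have -> : \prod_(j < m | j != i) vfall c (mu j n) (sigma j n) (upd t i a ord0 j) (X j n w)
    = \prod_(j < m | j != i) vfall c (mu j n) (sigma j n) (t ord0 j) (X j n w).
  by apply: eq_bigr => j /negbTE ji; rewrite mxE ji.
rewrite mxE eqxx ler_wpM2r//; apply: prodr_ge0 => j _.
by apply: vfall_ge0 => //; exact: (g j).2.
Qed.

Let tails n K (t : 'rV[R]_m) w := \sum_(i < m)
  (vfall_tail_low c (mu i n) (sigma i n) K (t ord0 i) * V n (upd t i 0) w +
   vfall_tail_high c (mu i n) (sigma i n) K (t ord0 i) * V n (upd t i c) w).
Arguments tails : clear implicits.

Let tail_low_ge0 n K i a : 0 <= vfall_tail_low c (mu i n) (sigma i n) K a.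
Proof. by rewrite addr_ge0 ?expR_ge0// mulr_ge0// fall_err_ge0. Qed.

Let tail_high_ge0 n K i a : 0 <= vfall_tail_high c (mu i n) (sigma i n) K a.
Proof. by rewrite addr_ge0 ?expR_ge0// mulr_ge0 ?expR_ge0// fall_err_ge0. Qed.

Let V_tails n K (t : 'rV[R]_m) w : 0 <= K -> good n K ->
  (forall i, 0 <= t ord0 i <= c) -> ~ box K (Y n w) -> V n t w <= tails n K t w.
Proof.
move=> K0 g tc /existsNP[i /negP]; rewrite -ltNge mxE => Ki.
have cc : 0 <= c <= c by rewrite lexx ltW.
have oc : 0 <= (0 : R) <= c by rewrite lexx ltW.
have V0 j a : 0 <= a <= c -> 0 <= V n (upd t j a) w.
  by move=> ac; apply: (V_ge0 w g); exact: upd_bound.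
have [Z2 eta1] := g i.
rewrite /tails (bigD1 i)//= ler_wpDr//.
  apply: sumr_ge0 => j _.
  by rewrite addr_ge0// mulr_ge0// V0.
move: Ki; rewrite lter_normr => /orP[Ki|Ki].
  rewrite ler_wpDl// ?mulr_ge0 ?V0//; apply: (V_upd g) => //.
  exact: vfall_le_tail_high.
rewrite ler_wpDr// ?mulr_ge0 ?V0//; apply: (V_upd g) => //.
by apply: vfall_le_tail_low => //; lra.
Qed.

Let exp_prod n (t : 'rV[R]_m) w :
  expR (dot t (Y n w)) = \prod_(i < m) expR (t ord0 i * ((X i n w - mu i n) / sigma i n)).
Proof. by rewrite /dot expR_sum; apply: eq_bigr => i _; rewrite mxE. Qed.

Let V_le_box n K (t : 'rV[R]_m) w : 0 <= K -> good n K ->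
  (forall i, 0 <= t ord0 i <= c) -> box K (Y n w) ->
  V n t w <= (\prod_(i < m) vfall_up c (mu i n) (sigma i n) K) * expR (dot t (Y n w)).
Proof.
move=> K0 g tc yK; rewrite mulrC exp_prod -big_split /=; apply: ler_prod => i _.
have [Z2 eta1] := g i; apply/andP; split; first exact: vfall_ge0.
by apply: vfall_le_box => //; have := yK i; rewrite mxE.
Qed.

Let V_ge_box n K (t : 'rV[R]_m) w : 0 <= K -> good n K ->
  (forall i, 0 <= t ord0 i <= c) -> box K (Y n w) ->
  (\prod_(i < m) vfall_low c (mu i n) (sigma i n) K) * expR (dot t (Y n w)) <= V n t w.
Proof.
move=> K0 g tc yK; rewrite mulrC exp_prod -big_split /=; apply: ler_prod => i _.
have [Z2 eta1] := g i; apply/andP; split; first by rewrite mulr_ge0 ?expR_ge0.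
by apply: vfall_ge_box => //; have := yK i; rewrite mxE.
Qed.

Lemma measurable_standardized n : measurable_fun setT (Y n : T n -> borel_rV R m).
Proof.
apply: measurable_rV => i.
under eq_fun do rewrite mxE.
by apply: measurable_funM => //; exact: measurable_funB.
Qed.

Let mYbox n K : measurable (Y n @^-1` box K).
Proof. by apply: measurable_preimage_box; exact: measurable_standardized. Qed.

Let exp_int n K (t : 'rV[R]_m) : (P n).-integrable (Y n @^-1` box K)
  (EFin \o (fun w => expR (dot t (Y n w)))).
Proof. by apply: box_expdot_integrable; exact: measurable_standardized. Qed.

(** In the box, [V] is comparable to the exponential. Outside of the box, it is
    dominated by the moments in which one exponent is moved to 0 or to [c], with
    factors that are exponentially small in [K]. *)
Let box_bounds n K (t : 'rV[R]_m) : 0 <= K -> good n K ->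
  (forall i, 0 <= t ord0 i <= c) ->
  (forall t : 'rV[R]_m, (forall i, 0 <= t ord0 i <= c) ->
    (P n).-integrable setT (EFin \o V n t)) ->
  let A := \int[P n]_(w in Y n @^-1` box K) expR (dot t (Y n w)) in
  (\prod_(i < m) vfall_low c (mu i n) (sigma i n) K) * A <= \int[P n]_w V n t w /\
  \int[P n]_w V n t w - \sum_(i < m)
     (vfall_tail_low c (mu i n) (sigma i n) K (t ord0 i) * \int[P n]_w V n (upd t i 0) w +
      vfall_tail_high c (mu i n) (sigma i n) K (t ord0 i) * \int[P n]_w V n (upd t i c) w)
    <= (\prod_(i < m) vfall_up c (mu i n) (sigma i n) K) * A.
Proof.
move=> K0 g tc VI A.
have VIt := VI t tc.
have VIb : (P n).-integrable (Y n @^-1` box K) (EFin \o V n t).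
  by apply: integrableS VIt.
have VIr : (P n).-integrable setT (EFin \o (V n t \_ (Y n @^-1` box K))).
  rewrite -restrict_EFin; exact: (iffLR (integrable_mkcond _ (mYbox n K))).
have Vpos (t' : 'rV[R]_m) w : (forall i, 0 <= t' ord0 i <= c) -> 0 <= V n t' w.
  exact: V_ge0.
have cc : 0 <= c <= c by rewrite lexx ltW.
have oc : 0 <= (0 : R) <= c by rewrite lexx ltW.
have zZ (a : R) (t' : 'rV[R]_m) : (forall i, 0 <= t' ord0 i <= c) ->
    (P n).-integrable setT (EFin \o (fun w => a * V n t' w)).
  move=> t'c; have := integrableZl measurableT a (VI t' t'c).
  by apply: eq_integrable.
have box_le : \int[P n]_(w in Y n @^-1` box K) V n t w =
    \int[P n]_w (V n t \_ (Y n @^-1` box K)) w by rewrite Rintegral_mkcond.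
split.
  rewrite -RintegralZl//; apply: (@le_trans _ _ (\int[P n]_(w in Y n @^-1` box K) V n t w)).
    apply: le_Rintegral => //.
      have := integrableZl (mYbox n K) (\prod_(i < m) vfall_low c (mu i n) (sigma i n) K)
        (exp_int n K t).
      by apply: eq_integrable.
    by move=> w yK; exact: V_ge_box.
  rewrite box_le; apply: le_Rintegral => // w _.
  by rewrite patchE; case: ifP => // _; exact: Vpos.
have pairI i : (P n).-integrable setT (EFin \o (fun w =>
    vfall_tail_low c (mu i n) (sigma i n) K (t ord0 i) * V n (upd t i 0) w +
    vfall_tail_high c (mu i n) (sigma i n) K (t ord0 i) * V n (upd t i c) w)).
  have := integrableD measurableT
    (zZ (vfall_tail_low c (mu i n) (sigma i n) K (t ord0 i)) _ (upd_bound i tc oc))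
    (zZ (vfall_tail_high c (mu i n) (sigma i n) K (t ord0 i)) _ (upd_bound i tc cc)).
  by apply: eq_integrable.
have tailsI : (P n).-integrable setT (EFin \o tails n K t).
  exact: integrable_bigsum pairI.
have -> : \sum_(i < m)
     (vfall_tail_low c (mu i n) (sigma i n) K (t ord0 i) * \int[P n]_w V n (upd t i 0) w +
      vfall_tail_high c (mu i n) (sigma i n) K (t ord0 i) * \int[P n]_w V n (upd t i c) w)
   = \int[P n]_w tails n K t w.
  rewrite /tails (Rintegral_bigsum _ pairI); apply: eq_bigr => i _.
  rewrite RintegralD//.
  - by rewrite !RintegralZl//; apply: VI; exact: upd_bound.
  - by apply: zZ; exact: upd_bound.
  - by apply: zZ; exact: upd_bound.
apply: (@le_trans _ _ (\int[P n]_(w in Y n @^-1` box K) V n t w)).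
  rewrite lerBlDr box_le -RintegralD//; apply: le_Rintegral => //.
    by have := integrableD measurableT VIr tailsI; apply: eq_integrable.
  move=> w _; rewrite patchE; case: ifPn => [_|].
    rewrite lerDl; apply: sumr_ge0 => i _.
    by rewrite addr_ge0// mulr_ge0//; apply: Vpos; exact: upd_bound.
  by rewrite notin_setE => yK; rewrite add0r; exact: V_tails.
rewrite -RintegralZl//; apply: le_Rintegral => //.
  have := integrableZl (mYbox n K) (\prod_(i < m) vfall_up c (mu i n) (sigma i n) K)
    (exp_int n K t).
  by apply: eq_integrable.
by move=> w yK; exact: V_le_box.
Qed.

Let tail_limit (t : 'rV[R]_m) K := \sum_(i < m)
  (expR (- (t ord0 i * K)) * gauss_mgf Gamma (upd t i 0) +
   expR (- ((c - t ord0 i) * K)) * gauss_mgf Gamma (upd t i c)).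

Let tail_limit_cvg0 (t : 'rV[R]_m) : (forall i, 0 < t ord0 i < c) ->
  tail_limit t K @[K --> +oo] --> (0 : R).
Proof.
move=> tc; have -> : (0 : R) = \sum_(i < m)
    (0 * gauss_mgf Gamma (upd t i 0) + 0 * gauss_mgf Gamma (upd t i c)).
  by rewrite big1// => i _; rewrite !mul0r addr0.
have E a : 0 < a -> expR (- (a * K)) @[K --> +oo] --> (0 : R).
  move=> a0; apply: (@cvg_comp _ _ _ (fun K : R => a * K) (fun x => expR (- x)) (pinfty_nbhs R) (pinfty_nbhs R) _).
    by apply: gt0_cvgMry => //; exact: cvg_id.
  exact: cvgr_expR.
apply: cvg_sumr => i; have /andP[t0 tc'] := tc i.
by apply: cvgD; (apply: cvgM; last exact: cvg_cst); apply: E; rewrite ?subr_gt0.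
Qed.

(** Let first [n] and then [K] tend to infinity in [box_bounds]. *)
Theorem standardized_mgf_cvg : box_mgf_cvg P Y c (gauss_mgf Gamma).
Proof.
move=> t tc e e0.
have tc' i : 0 <= t ord0 i <= c by have /andP[/ltW-> /ltW->] := tc i.
have cc : 0 <= c <= c by rewrite lexx ltW.
have oc : 0 <= (0 : R) <= c by rewrite lexx ltW.
have e20 : 0 < e / 2 by rewrite divr_gt0.
have [K0 [_ HK0]] : \forall K \near +oo, tail_limit t K <= e / 2.
  exact: cvgr_le (tail_limit_cvg0 tc) _ e20.
exists (Num.max 0 (K0 + 1)) => K; rewrite ge_max => /andP[K_ge0 K0K].
have dK : tail_limit t K <= e / 2 by apply: HK0; lra.
set M := gauss_mgf Gamma t.
pose a n := \prod_(i < m) vfall_up c (mu i n) (sigma i n) K.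
pose b n := \prod_(i < m) vfall_low c (mu i n) (sigma i n) K.
pose I n := \int[P n]_w V n t w.
pose S n := \sum_(i < m)
     (vfall_tail_low c (mu i n) (sigma i n) K (t ord0 i) * \int[P n]_w V n (upd t i 0) w +
      vfall_tail_high c (mu i n) (sigma i n) K (t ord0 i) * \int[P n]_w V n (upd t i c) w).
have ac : a n @[n --> \oo] --> (1 : R).
  rewrite -[X in _ --> X](@big1_eq R 1 *%R _ (index_enum 'I_m) xpredT).
  apply: cvg_prodr => i.
  exact: (vfall_up_cvg c (mu_gt0 i) (sigma_gt0 i) (@sm i) (@ms i)).
have bc : b n @[n --> \oo] --> (1 : R).
  rewrite -[X in _ --> X](@big1_eq R 1 *%R _ (index_enum 'I_m) xpredT).
  apply: cvg_prodr => i.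
  exact: (vfall_low_cvg c (mu_gt0 i) (sigma_gt0 i) (@sm i) (@ms i)).
have Ic : I n @[n --> \oo] --> M by exact: V_cvg.
have Sc : S n @[n --> \oo] --> tail_limit t K.
  apply: cvg_sumr => i; apply: cvgD; apply: cvgM.
  - exact: (vfall_tail_low_cvg c (mu_gt0 i) (sigma_gt0 i) (@sm i) (@ms i)).
  - by apply: V_cvg; exact: upd_bound.
  - exact: (@vfall_tail_high_cvg R (mu i) (sigma i) c (mu_gt0 i) (sigma_gt0 i) (@sm i) (@ms i) K (t ord0 i)).
  - by apply: V_cvg; exact: upd_bound.
have n1 : (1 : R) != 0 by exact: oner_neq0.
have upc : I n / b n @[n --> \oo] --> M.
  by rewrite -[M]divr1; apply: cvgM => //; exact: cvgV.
have lowc : (I n - S n) / a n @[n --> \oo] --> M - tail_limit t K.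
  by rewrite -[X in _ --> X]divr1; apply: cvgM; [exact: cvgB|exact: cvgV].
have Me : M < M + e by rewrite ltrDl.
have Me' : M - e < M - tail_limit t K.
  by rewrite ltrD2l ltrN2; apply: (le_lt_trans dK); rewrite ltr_pdivrMr// mulr_natr mulr2n ltrDl.
have H1 : \forall n \near \oo, I n / b n <= M + e by exact: (cvgr_le _ upc _ Me).
have H2 : \forall n \near \oo, M - e <= (I n - S n) / a n by exact: (cvgr_ge _ lowc _ Me').
near=> n.
have g : good n K by near: n; exact: good_near.
have VI : forall t : 'rV[R]_m, (forall i, 0 <= t ord0 i <= c) ->
    (P n).-integrable setT (EFin \o V n t) by near: n; exact: V_int.
have [B1 B2] := box_bounds K_ge0 g tc' VI.
have b0 : 0 < b n by apply: prodr_gt0 => i _; exact: expR_gt0.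
have a0 : 0 < a n.
  apply: prodr_gt0 => i _; rewrite ltr_wpDr ?expR_gt0// mulr_ge0 ?expR_ge0//.
  exact: fall_err_ge0.
have H1n : I n / b n <= M + e by near: n.
have H2n : M - e <= (I n - S n) / a n by near: n.
set A := \int[P n]_(w in _) _ in B1 B2 *.
have A1 : A <= I n / b n by rewrite ler_pdivlMr// mulrC.
have A2 : (I n - S n) / a n <= A by rewrite ler_pdivrMr// mulrC.
by rewrite ler_distl; apply/andP; split; lra.
Unshelve. all: by end_near. Qed.

End factorial_moments.

(** * Gaussian vectors with a given covariance *)

(** Indicators, then simple functions, then monotone limits. *)
Lemma ge0_integral_density (R : realType) d (T : measurableType d)
    (mu nu : {measure set T -> \bar R}) (h : T -> R) (f : T -> \bar R) :
  measurable_fun setT h -> (forall x, 0 <= h x) ->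
  (forall A, measurable A -> nu A = \int[mu]_(x in A) (h x)%:E)%E ->
  measurable_fun setT f -> (forall x, 0 <= f x)%E ->
  (\int[nu]_x f x = \int[mu]_x (f x * (h x)%:E))%E.
Proof.
Import HBNNSimple.
move=> mh h0 nuE mf f0.
have mH : measurable_fun setT (EFin \o h) by exact/measurable_EFinP.
have indic_case (A : set T) : measurable A ->
    (\int[nu]_x (\1_A x)%:E = \int[mu]_x ((\1_A x)%:E * (h x)%:E))%E.
  move=> mA; rewrite integral_indic// setIT nuE// [LHS]integral_mkcond/=.
  apply: eq_integral => x _; rewrite patchE indicE; case: ifPn => xA.
    by rewrite mul1e.
  by rewrite mul0e.
have simple_case (g : {nnsfun T >-> R}) :
    (\int[nu]_x (g x)%:E = \int[mu]_x ((g x)%:E * (h x)%:E))%E.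
  under [LHS]eq_integral do rewrite fimfunE -fsumEFin//.
  rewrite [LHS]ge0_integral_fsum//; last 2 first.
    - by move=> r; exact/measurable_EFinP/measurableT_comp.
    - by move=> n x _; rewrite EFinM nnfun_muleindic_ge0.
  under [RHS]eq_integral.
    move=> x xD; rewrite fimfunE -fsumEFin// muleC ge0_mule_fsumr; last first.
      by move=> r; rewrite EFinM nnfun_muleindic_ge0.
    over.
  rewrite [RHS]ge0_integral_fsum//; last 2 first.
    - move=> r; apply: emeasurable_funM => //.
      by apply/measurable_EFinP; apply: measurable_funM => //; exact: measurable_indic.
    - move=> n x _; rewrite EFinM mule_ge0//; first by rewrite lee_fin.
      by rewrite nnfun_muleindic_ge0.
  apply: eq_fsbigr => r _.
  under [RHS]eq_integral do rewrite muleC.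
  rewrite !integralZl_indic_nnsfun//=.
  have [r0|r0] := ltP r 0.
    rewrite (_ : g @^-1` [set r] = set0); last first.
      by apply/seteqP; split => // x /= gx; move: r0; rewrite -gx ltNge fun_ge0.
    rewrite indic0 !(@integral0_eq _ _ _ _ setT)// ?mule0//.
    by move=> x _; rewrite mulr0 mul0e.
  rewrite indic_case//.
  under [RHS]eq_integral do rewrite EFinM -muleA.
  rewrite ge0_integralZl//.
  - by apply: emeasurable_funM => //; exact/measurable_EFinP/measurable_indic.
  - by move=> x _; rewrite mule_ge0// lee_fin.
pose g := nnsfun_approx measurableT mf.
transitivity (lim (\int[nu]_x (g n x)%:E @[n --> \oo])%E).
  rewrite -monotone_convergence//=.
  - apply: eq_integral => ? /[!inE] xD; apply/esym/cvg_lim => //=.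
    exact: cvg_nnsfun_approx.
  - by move=> n; exact/measurable_EFinP/measurable_funTS.
  - by move=> n ? _; rewrite lee_fin.
  - by move=> ? _ ? ? mn; rewrite lee_fin; exact/lefP/nd_nnsfun_approx.
under eq_fun do rewrite simple_case.
rewrite -monotone_convergence//=.
- apply: eq_integral => x /[!inE] xD; apply/cvg_lim => //=.
  by apply: cvgeZr => //; exact: cvg_nnsfun_approx.
- by move=> n; apply: emeasurable_funM => //; exact/measurable_EFinP/measurable_funTS.
- by move=> n ? _; rewrite mule_ge0// lee_fin.
- move=> x _ a b ab; rewrite lee_wpmul2r ?lee_fin//.
  exact/lefP/nd_nnsfun_approx.
Qed.

(** Completing the square turns the exponentially tilted normal density into a
    constant times the density of a translated normal law. *)
Lemma normal_prob_mgf (R : realType) (s t : R) : s != 0 ->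
  (\int[normal_prob 0 s]_x (expR (t * x))%:E = (expR (2^-1 * (s * t) ^+ 2))%:E)%E.
Proof.
move=> s0.
have me : measurable_fun setT (fun x : R => expR (t * x)).
  by apply: measurableT_comp => //; exact: mulrl_measurable.
rewrite (@ge0_integral_density R _ _ lebesgue_measure _ (normal_pdf 0 s))//=.
- under eq_integral => x _.
    have -> : ((expR (t * x))%:E * (normal_pdf 0 s x)%:E =
       (expR (2^-1 * (s * t) ^+ 2))%:E * (normal_pdf (s ^+ 2 * t) s x)%:E)%E.
      rewrite -!EFinM !normal_pdfE// /normal_fun; congr EFin.
      rewrite !(mulrCA _ (normal_peak s)) -!expRD; congr (_ * expR _).
      by field.
    over.
  rewrite ge0_integralZl//= ?lee_fin ?expR_ge0//.
  + by rewrite integral_normal_pdf mule1.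
  + by apply/measurable_EFinP; exact: measurable_normal_pdf.
  + by move=> x _; rewrite lee_fin normal_pdf_ge0.
- exact: measurable_normal_pdf.
- by move=> x; exact: normal_pdf_ge0.
- exact/measurable_EFinP.
Qed.

(** The law of the sum over [s] of independent standard normal multiples of the
    vectors [v], built by adding one vector at a time. *)
Lemma gauss_law_exists (R : realType) m (s : seq 'rV[R]_m) :
  exists nu : probability (borel_rV R m) R, forall t : 'rV[R]_m,
    (\int[nu]_y (expR (dot t y))%:E =
     (expR (2^-1 * \sum_(v <- s) dot t v ^+ 2))%:E)%E.
Proof.
elim: s => [|v s [nu nuE]].
  exists (\d_ (0 : borel_rV R m) : probability _ _) => t.
  rewrite integral_dirac//=; last first.
    by apply/measurable_EFinP; apply: continuous_measurable_rV; exact: continuous_expdot.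
  rewrite diracT mul1e big_nil mulr0; congr (expR _)%:E.
  by rewrite /dot big1// => i _; rewrite mxE mulr0.
pose X (p : borel_rV R m * measurableTypeR R) : borel_rV R m :=
  p.1 + (p.2 : R) *: v.
have mX : measurable_fun setT X.
  apply: measurable_rV => i; rewrite /X.
  under eq_fun do rewrite !mxE.
  apply: measurable_funD.
    by apply: (measurableT_comp (@measurable_coord R m i)); exact: measurable_fst.
  by apply: measurable_funM => //; exact: measurable_snd.
pose X' : {mfun (borel_rV R m * measurableTypeR R)%type >-> borel_rV R m} := mfun_Sub (mem_set mX).
exists (distribution (nu \x normal_prob 0 1)%E X') => t.
have mE : measurable_fun setT (fun y : borel_rV R m => (expR (dot t y))%:E).
  by apply/measurable_EFinP; apply: continuous_measurable_rV; exact: continuous_expdot.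
rewrite ge0_integral_distribution//=.
rewrite fubini_tonelli1//=; last exact: (measurableT_comp mE mX).
rewrite /fubini_F /=.
under eq_integral => y _.
  under eq_integral => x _.
    have -> : dot t (X (y, x)) = dot t y + dot t v * x.
      rewrite /X /dot mulr_suml -big_split /=; apply: eq_bigr => i _.
      by rewrite !mxE; ring.
    rewrite expRD EFinM.
    over.
  rewrite ge0_integralZl//=; [|shelve..].
  rewrite normal_prob_mgf ?oner_neq0// mul1r.
  over.
rewrite ge0_integralZr//=; [|shelve..].
by rewrite nuE -EFinM -expRD big_cons mulrDr addrC.
Unshelve.
all: try by rewrite lee_fin expR_ge0.
all: try by move=> ? _; rewrite lee_fin expR_ge0.
all: try exact: mE.
by apply/measurable_EFinP; apply: measurableT_comp => //; exact: mulrl_measurable.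
Qed.

Lemma quad_row (R : realType) m (G : 'M[R]_m) (t : 'rV[R]_m) :
  quad G t = \sum_(i < m) t ord0 i * dot (row i G) t.
Proof.
apply: eq_bigr => i _; rewrite /dot mulr_sumr; apply: eq_bigr => j _.
by rewrite mxE; ring.
Qed.

Lemma dot_delta (R : realType) m (i : 'I_m) (t : 'rV[R]_m) :
  dot (delta_mx ord0 i) t = t ord0 i.
Proof.
rewrite /dot (bigD1 i)//= big1 ?addr0 ?mxE ?eqxx ?mul1r// => j ji.
by rewrite mxE (negbTE ji) andbF mul0r.
Qed.

Lemma dotC (R : realType) m (t u : 'rV[R]_m) : dot t u = dot u t.
Proof. by apply: eq_bigr => i _; rewrite mulrC. Qed.

Lemma dotZl (R : realType) m (x : R) (t u : 'rV[R]_m) : dot (x *: t) u = x * dot t u.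
Proof. by rewrite /dot mulr_sumr; apply: eq_bigr => i _; rewrite mxE mulrA. Qed.

Lemma quad_delta (R : realType) m (G : 'M[R]_m) (i : 'I_m) :
  quad G (delta_mx ord0 i) = G i i.
Proof.
rewrite quad_row -[RHS]mul1r (bigD1 i)//= big1 ?addr0 => [|j ji].
  by rewrite mxE !eqxx dotC dot_delta mxE.
by rewrite mxE (negbTE ji) andbF mul0r.
Qed.

Lemma quad_shift (R : realType) m (G : 'M[R]_m) (t : 'rV[R]_m) (i : 'I_m) (x : R) :
  G^T = G ->
  quad G (t + x *: delta_mx ord0 i) =
  quad G t + 2 * x * dot (row i G) t + x ^+ 2 * G i i.
Proof.
move=> Gsym.
have dG j u : dot (row j G) (u + x *: delta_mx ord0 i) = dot (row j G) u + x * G j i.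
  by rewrite dotC dotDl dotZl dot_delta mxE dotC.
rewrite !quad_row.
under eq_bigr => j _ do rewrite dG !mxE eqxx /= mulrDl !mulrDr.
rewrite !big_split /=.
have -> : \sum_(j < m) t ord0 j * (x * G j i) = x * dot (row i G) t.
  rewrite /dot mulr_sumr; apply: eq_bigr => j _.
  by rewrite mxE -{1}Gsym mxE; ring.
have -> : \sum_(j < m) x * (j == i)%:R * dot (row j G) t = x * dot (row i G) t.
  rewrite (bigD1 i)//= big1 ?addr0 ?eqxx ?mulr1// => j ji.
  by rewrite (negbTE ji) mulr0 mul0r.
have -> : \sum_(j < m) x * (j == i)%:R * (x * G j i) = x ^+ 2 * G i i.
  rewrite (bigD1 i)//= big1 ?addr0 ?eqxx ?mulr1 ?mulrA ?expr2// => j ji.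
  by rewrite (negbTE ji) mulr0 mul0r.
ring.
Qed.

(** The discriminant of the nonnegative quadratic polynomial
    [x |-> quad G (t + x e_i)]. *)
Lemma psd_cauchy_schwarz (R : realType) m (G : 'M[R]_m) (t : 'rV[R]_m) (i : 'I_m) :
  G^T = G -> (forall u, 0 <= quad G u) ->
  dot (row i G) t ^+ 2 <= G i i * quad G t.
Proof.
move=> Gsym G0; set b := dot (row i G) t; set a := G i i; set q := quad G t.
have P x : 0 <= q + 2 * x * b + x ^+ 2 * a by rewrite -quad_shift.
have a0 : 0 <= a by have := G0 (delta_mx ord0 i); rewrite quad_delta.
have [a0'|a_neq0] := eqVneq a 0.
  have [b0|b_neq0] := eqVneq b 0; first by rewrite b0 a0' expr0n mul0r.
  have := P (- (q + 1) / (2 * b)); rewrite a0' mulr0 addr0.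
  have -> : q + 2 * (- (q + 1) / (2 * b)) * b = - 1 by field.
  by rewrite lerNr oppr0 ler10.
have a1 : 0 < a by rewrite lt_neqAle eq_sym a_neq0.
have := P (- b / a).
have -> : q + 2 * (- b / a) * b + (- b / a) ^+ 2 * a = (a * q - b ^+ 2) / a by field.
by rewrite pmulr_lge0 ?invr_gt0// subr_ge0.
Qed.

(** One step of the Cholesky factorization, repeated: subtracting the square of the
    normalized row [i] kills the diagonal entry [i], keeps the diagonal entries
    that vanish, and preserves nonnegativity by [psd_cauchy_schwarz]. *)
Lemma psd_sum_sqr (R : realType) m (G : 'M[R]_m) :
  G^T = G -> (forall u, 0 <= quad G u) ->
  exists s : seq 'rV[R]_m, forall t, quad G t = \sum_(v <- s) dot t v ^+ 2.
Proof.
have [k] := ubnP #|[pred i | G i i != 0]|.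
elim: k G => // k IH G; rewrite ltnS => Gk Gsym G0.
have [/existsP[i Gi]|/existsPn Gd] := boolP [exists i, G i i != 0]; last first.
  exists [::] => t; rewrite big_nil quad_row big1// => i _.
  have := psd_cauchy_schwarz t i Gsym G0.
  have /negPn/eqP -> := Gd i; rewrite mul0r => b2.
  have /eqP : dot (row i G) t ^+ 2 = 0 by apply/eqP; rewrite eq_le b2 sqr_ge0.
  by rewrite sqrf_eq0 => /eqP ->; rewrite mulr0.
have a0 : 0 < G i i 
  by rewrite lt_neqAle eq_sym Gi; have := G0 (delta_mx ord0 i); rewrite quad_delta.
pose v := (Num.sqrt (G i i))^-1 *: row i G.
pose G' : 'M[R]_m := G - v^T *m v.
have G'E j l : G' j l = G j l - G i j * G i l / G i i.
  rewrite !mxE big_ord1 !mxE; congr (_ - _).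
  rewrite mulrACA mulrC -invfM -expr2 sqr_sqrtr ?(ltW a0)//.
have G'q t : quad G' t = quad G t - dot t v ^+ 2.
  have -> : dot t v ^+ 2 = \sum_(j < m) \sum_(l < m) (v^T *m v) j l * t ord0 j * t ord0 l.
    rewrite expr2 /dot mulr_suml; apply: eq_bigr => j _; rewrite mulr_sumr.
    by apply: eq_bigr => l _; rewrite [in RHS]mxE big_ord1 [v^T _ _]mxE; ring.
  rewrite /quad -sumrB; apply: eq_bigr => j _; rewrite -sumrB; apply: eq_bigr => l _.
  by rewrite /G' mxE [(- (v^T *m v)) j l]mxE; ring.
have dv t : dot t v ^+ 2 = dot (row i G) t ^+ 2 / G i i.
  by rewrite dotC dotZl exprMn exprVn sqr_sqrtr ?(ltW a0)// mulrC.
have [|||s sE] := IH G'.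
- apply: leq_trans Gk; apply: proper_card; apply/properP; split.
    apply/fintype.subsetP => j; rewrite !inE G'E; apply: contraNN => /eqP Gj.
    have := psd_cauchy_schwarz (delta_mx ord0 i) j Gsym G0.
    rewrite dotC dot_delta mxE Gj mul0r => b2.
    have : G j i ^+ 2 == 0 by rewrite eq_le b2 sqr_ge0.
    rewrite sqrf_eq0 => /eqP Gji.
    by rewrite -{1}Gsym mxE Gji !mul0r subr0.
  by exists i; rewrite !inE// G'E mulfK ?subrr ?eqxx.
- apply/matrixP => j l; rewrite mxE !G'E -{1}Gsym mxE.
  by rewrite [G i j * _]mulrC.
- move=> u; rewrite G'q dv subr_ge0 ler_pdivrMr// mulrC.
  exact: psd_cauchy_schwarz.
exists (v :: s) => t; rewrite big_cons -sE G'q; ring.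
Qed.

(** * Moments from the moment generating function *)

Lemma is_derive_expRM (R : realType) (c b u : R) :
  is_derive u 1 (fun v => c * expR (v * b)) (c * b * expR (u * b)).
Proof.
have H1 : is_derive u 1 (fun v : R => v * b) b.
  rewrite (_ : (fun v => _) = b *: (id : R -> R)).
    by apply: is_derive_eq; rewrite scaler1.
  by apply/funext => v; rewrite /= mulrC.
have H2 := @is_derive1_comp R expR (fun v => v * b) u (expR (u * b)) b _ H1.
rewrite (_ : (fun v => _) = c *: (expR \o (fun v => v * b))) //.
by apply: is_derive_eq; rewrite -mulrA [b * _]mulrC.
Qed.

Section real_mgf.
Variables (R : realType) (d : measure_display) (T : measurableType d).
Variables (P : probability T R) (B : T -> R).
Hypothesis mB : measurable_fun setT B.
Hypothesis B_exp : forall u, P.-integrable setT (fun w => (expR (u * B w))%:E).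

Let dB k u w := B w ^+ k * expR (u * B w).

(** The domination that allows differentiation under the integral near [a]. *)
Let dB_le k a u w : `|u - a| <= 1 ->
  `|dB k u w| <= k`!%:R * (expR ((a + 2) * B w) + expR ((a - 2) * B w)).
Proof.
move=> ua; rewrite /dB normrM normrX (ger0_norm (expR_ge0 _)).
have := exprn_le_expR (B w) k (@ltr01 R); rewrite expr1n divr1 mul1r => Bk.
apply: (@le_trans _ _ (k`!%:R * expR `|B w| * expR (u * B w))).
  by rewrite ler_wpM2r ?expR_ge0.
rewrite -mulrA ler_wpM2l// -expRD.
have := expR_ge0 ((a + 2) * B w); have := expR_ge0 ((a - 2) * B w).
move: ua; rewrite ler_distl => /andP[u1 u2] e1 e2.
have [B0|B0] := lerP 0 (B w).
  apply: le_trans (_ : expR ((a + 2) * B w) <= _); last by rewrite lerDl.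
  rewrite ler_expR ger0_norm//.
  have : 0 <= (a + 1 - u) * B w by rewrite mulr_ge0// subr_ge0.
  by move=> H; nra.
apply: le_trans (_ : expR ((a - 2) * B w) <= _); last by rewrite lerDr.
rewrite ler_expR ltr0_norm//.
have : 0 <= (u - (a - 1)) * - B w by rewrite mulr_ge0 ?subr_ge0// oppr_ge0 ltW.
by move=> H; nra.
Qed.

Let dom_int k a : P.-integrable setT
  (EFin \o (fun w => k`!%:R * (expR ((a + 2) * B w) + expR ((a - 2) * B w)))).
Proof.
apply: (eq_integrable measurableT (fun w => k`!%:R%:E *
    ((expR ((a + 2) * B w))%:E + (expR ((a - 2) * B w))%:E))%E) => //.
by apply: integrableZl => //; apply: integrableD => //; exact: B_exp.
Qed.

Let mdB k u : measurable_fun setT (dB k u).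
Proof.
apply: measurable_funM; first exact: measurable_funX.
by apply: measurableT_comp => //; exact: measurable_funM.
Qed.

Lemma exp_moment_integrable k u : P.-integrable setT (EFin \o dB k u).
Proof.
apply: (le_integrable measurableT _ _ (dom_int k u)).
  by apply/measurable_EFinP; exact: mdB.
move=> w _; rewrite /= lee_fin (le_trans (dB_le k w (a := u) (u := u) _))//.
  by rewrite subrr normr0.
exact: ler_norm.
Qed.

Lemma derive1_exp_moment k a :
  (fun u => \int[P]_w (B w ^+ k * expR (u * B w)))^`()%classic a =
  \int[P]_w (B w ^+ k.+1 * expR (a * B w)).
Proof.
have D (u : R) (w : T) : is_derive u 1 (fun v : R => dB k v w) (dB k.+1 u w).
  by apply: is_derive_eq (is_derive_expRM _ _ _) _; rewrite /dB exprSr.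
rewrite (@differentiation_under_integral R _ T P (dB k) setT measurableT a (a - 1) (a + 1)
  _ _ _ (fun w => k.+1`!%:R * (expR ((a + 2) * B w) + expR ((a - 2) * B w)))).
- by apply: eq_Rintegral => w _; rewrite /partial1of2 derive1E derive_val.
- by rewrite /= in_itv/=; apply/andP; split; lra.
- by move=> u _; exact: exp_moment_integrable.
- by move=> u w _ _; case: (D u w).
- by move=> w; rewrite mulr_ge0// addr_ge0// expR_ge0.
- exact: dom_int.
- move=> u w; rewrite /= in_itv/= => /andP[u1 u2] _.
  rewrite /partial1of2 derive1E derive_val; apply: dB_le.
  by rewrite ler_distl; apply/andP; split; lra.
Qed.

Variable q : R.
Hypothesis B_mgf : forall u, \int[P]_w expR (u * B w) = expR (2^-1 * q * u ^+ 2).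

Let derive_gauss (u : R) :
  is_derive u 1 (fun v : R => expR (2^-1 * q * v ^+ 2)) (q * u * expR (2^-1 * q * u ^+ 2)).
Proof.
have H1 : is_derive u 1 (fun v : R => 2^-1 * q * v ^+ 2) (q * u).
  rewrite (_ : (fun v => _) = (2^-1 * q) *: ((id : R -> R) ^+ 2)).
    by apply: is_derive_eq; rewrite /= /GRing.scale /=; field.
  by apply/funext => v; rewrite /= exprfctE.
have H2 := @is_derive1_comp R expR (fun v => 2^-1 * q * v ^+ 2) u _ _ _ H1.
by apply: is_derive_eq; rewrite mulrC.
Qed.

Let first_moment u : \int[P]_w (B w * expR (u * B w)) = q * u * expR (2^-1 * q * u ^+ 2).
Proof.
have := derive1_exp_moment 0 u.
under eq_fun do under eq_Rintegral do rewrite expr0 mul1r.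
under eq_fun do rewrite B_mgf.
under [RHS]eq_Rintegral do rewrite expr1.
by have [_ <-] := derive_gauss u; rewrite -derive1E => ->.
Qed.

Lemma gauss_mean : \int[P]_w B w = 0.
Proof.
have := first_moment 0; rewrite mulr0 mul0r => <-.
by apply: eq_Rintegral => w _; rewrite mul0r expR0 mulr1.
Qed.

Lemma gauss_second_moment : \int[P]_w (B w ^+ 2) = q.
Proof.
have := derive1_exp_moment 1 0.
under eq_fun do under eq_Rintegral do rewrite expr1.
under eq_fun do rewrite first_moment.
under [RHS]eq_Rintegral do rewrite mul0r expR0 mulr1.
move=> <-; have H := derive_gauss 0.
have E : is_derive (0 : R) 1 (fun u : R => q * u * expR (2^-1 * q * u ^+ 2)) q.
  rewrite (_ : (fun u => _) = (q *: (id : R -> R)) * (fun v : R => expR (2^-1 * q * v ^+ 2)))//.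
  have Hq : is_derive (0 : R) 1 (q *: (id : R -> R)) q by apply: is_derive_eq; rewrite scaler1.
  have := @is_deriveM _ _ _ _ _ _ _ _ Hq H.
  by rewrite mulr0 mul0r scaler0 add0r expr0n /= mulr0 expR0 scale1r.
by rewrite derive1E; case: E.
Qed.

End real_mgf.

(** * A law on the line is determined by its moment generating function *)

Lemma ge0_subset_Rintegral (R : realType) d (T : measurableType d)
    (P : probability T R) (A B : set T) (g : T -> R) :
  measurable A -> measurable B -> A `<=` B -> (forall w, 0 <= g w) ->
  P.-integrable B (EFin \o g) ->
  \int[P]_(w in A) g w <= \int[P]_(w in B) g w.
Proof.
move=> mA mB AB g0 gi; apply: fine_le.
- by apply: integrable_fin_num => //; exact: integrableS gi.
- exact: integrable_fin_num.
- apply: ge0_subset_integral => //; first exact: measurable_int gi.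
  by move=> w _; rewrite lee_fin.
Qed.

(** A fixed law is a constant sequence: the convergence theorem becomes a uniqueness
    theorem. *)
Lemma box_mgf_cvg_cst (R : realType) m d (T : measurableType d)
    (P : probability T R) (V : T -> 'rV[R]_m) (c : R) :
  measurable_fun setT (V : T -> borel_rV R m) ->
  (forall t : 'rV[R]_m, P.-integrable setT (fun w => (expR (dot t (V w)))%:E)) ->
  box_mgf_cvg (fun _ : nat => P) (fun _ : nat => V) c
    (fun t => \int[P]_w expR (dot t (V w))).
Proof.
move=> mV Vi t _ e e0.
have mB K : measurable (V @^-1` box K) by exact: measurable_preimage_box.
pose F (k : nat) := V @^-1` box k%:R.
have ndF : nondecreasing_seq F.
  by move=> j k jk; rewrite subsetEset => w; apply: le_box; rewrite ler_nat.
have UF : \bigcup_k F k = setT.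
  apply/seteqP; split => // w _.
  have S0 : 0 <= \sum_(i < m) `|V w ord0 i| by exact: sumr_ge0.
  exists (Num.bound (\sum_(i < m) `|V w ord0 i|)) => // i.
  apply: le_trans (ltW (archi_boundP S0)).
  by rewrite (bigD1 i)//= lerDl sumr_ge0.
have mg : measurable_fun setT (fun w => (expR (dot t (V w)))%:E) by exact: measurable_int (Vi t).
have := @ge0_nondecreasing_set_cvg_integral _ _ _ F (fun w => (expR (dot t (V w)))%:E) P
  ndF (fun k => mB k%:R) (fun k => measurable_funTS mg) (fun k w _ => expR_ge0 _).
rewrite UF -[X in _ --> X]fineK; last exact: integrable_fin_num.
move=> /fine_cvgP[_] /cvgrPdist_le /(_ _ e0)[N _ /(_ _ (leqnn N))] /= HN.
exists N%:R => K NK; near=> n.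
have g0 w : 0 <= expR (dot t (V w)) by exact: expR_ge0.
have K1 : \int[P]_(w in F N) expR (dot t (V w)) <= \int[P]_(w in V @^-1` box K) expR (dot t (V w)).
  apply: ge0_subset_Rintegral => //; first exact: mB.
    by move=> w; exact: le_box.
  exact: integrableS (Vi t).
have K2 : \int[P]_(w in V @^-1` box K) expR (dot t (V w)) <= \int[P]_w expR (dot t (V w)).
  by apply: (ge0_subset_Rintegral (mB K) measurableT) => //; exact: Vi.
move: HN; rewrite -/(Rintegral P setT (fun w => expR (dot t (V w)))).
rewrite -/(Rintegral P (F N) (fun w => expR (dot t (V w)))).
rewrite ger0_norm ?subr_ge0 ?(le_trans K1)// => HN.
by rewrite distrC ger0_norm ?subr_ge0//; lra.
Unshelve. all: by end_near. Qed.

Section mgf_determines_law.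
Variables (R : realType) (mu1 mu2 : probability (measurableTypeR R) R) (M : R -> R).
Hypothesis mgf1 : forall t, (\int[mu1]_x (expR (t * x))%:E = (M t)%:E)%E.
Hypothesis mgf2 : forall t, (\int[mu2]_x (expR (t * x))%:E = (M t)%:E)%E.

Let V (x : measurableTypeR R) : 'rV[R]_1 := const_mx x.

Let mV : measurable_fun setT (V : measurableTypeR R -> borel_rV R 1).
Proof.
by apply: measurable_rV => i; under eq_fun do rewrite mxE; exact: measurable_id.
Qed.

Let dotV (t : 'rV[R]_1) x : dot t (V x) = t ord0 ord0 * x.
Proof. by rewrite /dot big_ord1 mxE. Qed.

Let exp_int (mu : probability (measurableTypeR R) R) :
  (forall t, (\int[mu]_x (expR (t * x))%:E = (M t)%:E)%E) ->
  forall t : 'rV[R]_1, mu.-integrable setT (fun x => (expR (dot t (V x)))%:E).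
Proof.
move=> H t; apply/integrableP; split.
  apply/measurable_EFinP.
  exact: (measurableT_comp (continuous_measurable_rV (@continuous_expdot R 1 t)) mV).
under eq_integral => x _ do rewrite /= ger0_norm ?expR_ge0// dotV.
by rewrite H ltry.
Qed.

(** The integrals against [mu1] form a constant sequence that converges to the
    integral against [mu2]. *)
Let eq_bounded_continuous (g : R -> R) : continuous g -> (forall x, `|g x| <= 1) ->
  \int[mu1]_x g x = \int[mu2]_x g x.
Proof.
move=> gc g1; pose f (y : 'rV[R]_1) := g (y ord0 ord0).
have fc : continuous f.
  by move=> y; apply: continuous_comp; [exact: coord_continuous|exact: gc].
have YZ : box_mgf_cvg (fun _ : nat => mu1) (fun _ : nat => V) 1
    (fun t => \int[mu2]_w expR (dot t (V w))).
  move=> t t1 e e0; have [K0 HK0] := @box_mgf_cvg_cst _ _ _ _ mu1 V 1 mV (exp_int mgf1) t t1 e e0.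
  exists K0; have -> // : \int[mu2]_w expR (dot t (V w)) = \int[mu1]_w expR (dot t (V w)).
  rewrite /Rintegral; congr fine.
  under eq_integral => x _ do rewrite /= dotV.
  under [RHS]eq_integral => x _ do rewrite /= dotV.
  by rewrite mgf1 mgf2.
have := @mgf_cvg_in_law R 1 _ _ (fun=> mu1) (fun=> V) _ _ mu2 V 1 ltr01 (fun=> mV) mV
  (fun t _ => exp_int mgf2 t) YZ f 1 fc (fun y => g1 _).
rewrite /f; under eq_fun do under eq_Rintegral do rewrite mxE.
under [X in _ --> X]eq_Rintegral do rewrite mxE.
by move=> /cvg_lim => /(_ (@Rhausdorff R)) <-; rewrite lim_cst//; exact: Rhausdorff.
Qed.

(** Continuous functions that increase to the indicator of an open half-line. *)
Let ramp a k x : R := Num.min 1 (k%:R * Num.max 0 (a - x)).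

Let ramp_continuous a k : continuous (ramp a k).
Proof.
move=> x; apply: (@continuous_min R R (cst 1) (fun x : R => k%:R * Num.max 0 (a - x))).
  exact: cst_continuous.
apply: (continuous_comp (f := fun x : R => Num.max 0 (a - x)) (g := fun u : R => k%:R * u)).
  apply: (@continuous_max R R (cst 0) (fun x : R => a - x)); first exact: cst_continuous.
  by apply: (@continuousB R R R (cst a) id); [exact: cst_continuous|exact: cvg_id].
exact: mulrl_continuous.
Qed.

Let ramp01 a k x : 0 <= ramp a k x <= 1.
Proof.
by rewrite /ramp le_min ler01 mulr_ge0 ?ler0n ?le_max ?lexx//= ge_min lexx.
Qed.

Let ramp_norm a k x : `|ramp a k x| <= 1.
Proof. by have /andP[? ?] := ramp01 a k x; rewrite ger0_norm. Qed.

Let ramp_cvg a x : ramp a k x @[k --> \oo] --> (\1_(`]-oo, a[%classic) x : R).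
Proof.
rewrite indicE; have [xa|xa] := ltP x a.
  rewrite mem_set /=; last by rewrite in_itv.
  apply: cvg_near_cst; near=> k; rewrite /ramp; apply/min_idPl.
  rewrite max_r ?subr_ge0 ?(ltW xa)// -ler_pdivrMr ?subr_gt0// div1r.
  by near: k; exact: nbhs_infty_ger.
rewrite memNset /=; last by rewrite in_itv/= ltNge xa.
apply: cvg_near_cst; near=> k; rewrite /ramp max_l ?subr_le0// mulr0.
by apply/min_idPr.
Unshelve. all: by end_near. Qed.

Let mu_ray (mu : probability (measurableTypeR R) R) a :
  (\int[mu]_x ramp a k x)%:E @[k --> \oo] --> mu `]-oo, a[%classic.
Proof.
have mr k : measurable_fun setT (EFin \o ramp a k).
  by apply/measurable_EFinP; apply: continuous_measurable_fun; exact: ramp_continuous.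
have mI : measurable (`]-oo, a[%classic : set (measurableTypeR R)) by exact: measurable_itv.
have mE : measurable_fun setT (EFin \o \1_(`]-oo, a[%classic) : measurableTypeR R -> \bar R).
  by apply/measurable_EFinP; exact: measurable_indic.
have rE (x : measurableTypeR R) : [set: measurableTypeR R] x -> (EFin \o ramp a k) x @[k --> \oo] --> (EFin \o \1_(`]-oo, a[%classic)) x.
  by move=> _; apply: cvg_EFin; [exact: nearW|exact: ramp_cvg].
have rN (x : measurableTypeR R) (k : nat) : [set: measurableTypeR R] x ->
    (`|(EFin \o ramp a k) x| <= (EFin \o cst 1%R) x)%E.
  by move=> _; rewrite /= lee_fin ramp_norm.
have [_ _] := @dominated_convergence _ _ _ mu setT measurableT
  (fun k => EFin \o ramp a k) (EFin \o \1_(`]-oo, a[%classic)) (EFin \o cst 1) mr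
  mE (aeW _ rE)
  (finite_measure_integrable_cst mu 1 measurableT)
  (aeW _ rN).
rewrite integral_indic// setIT.
apply: cvg_trans; apply: near_eq_cvg; near=> k => /=.
rewrite /Rintegral fineK//; apply: integrable_fin_num => //.
have mk : measurable_fun setT (ramp a k : measurableTypeR R -> R).
  by apply: continuous_measurable_fun; exact: ramp_continuous.
exact: (@bounded_integrable R _ _ mu setT (ramp a k) 1 measurableT mk (fun x _ => ramp_norm a k x)).
Unshelve. all: by end_near. Qed.

Theorem mgf_law_unique A : measurable A -> mu1 A = mu2 A.
Proof.
apply: (@measure_unique _ R (measurableTypeR R) (@RGenInftyO.G R)
  (fun k => `]-oo, k%:R[%classic)).
- exact: RGenInftyO.measurableE.
- move=> _ _ [a ->] [b ->]; exists (Num.min a b).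
  by apply/seteqP; split => x; rewrite /= !in_itv/= lt_min => /andP.
- by move=> k; exists k%:R.
- apply/seteqP; split => // x _; exists (Num.bound `|x|) => //=.
  by rewrite in_itv/= (le_lt_trans (ler_norm _))// archi_boundP.
- move=> _ [a ->]; have := @mu_ray mu1 a.
  under eq_fun do rewrite (eq_bounded_continuous (@ramp_continuous _ _) (@ramp_norm _ _)).
  by move=> H1; exact: (cvg_unique (@ereal_hausdorff R) H1 (@mu_ray mu2 a)).
- by move=> k; rewrite (le_lt_trans (probability_le1 _ _)) ?ltry//; exact: measurable_itv.
Qed.

End mgf_determines_law.

(** * The limit law *)

(** The inequality [2 <= u + 1 / u] at [u = l x], multiplied by [E]. *)
Lemma two_le_tilt (R : realType) (E x l : R) : 0 < E -> 0 < x -> 0 < l ->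
  2 * E <= l * (E * x) + l^-1 * (E / x).
Proof.
move=> E0 x0 l0; rewrite -subr_ge0.
have -> : l * (E * x) + l^-1 * (E / x) - 2 * E = E * (l * x - 1) ^+ 2 / (l * x).
  by field; rewrite !gt_eqF.
by rewrite divr_ge0// mulr_ge0 ?sqr_ge0 ?(ltW E0) ?(ltW l0) ?(ltW x0).
Qed.

(** Limits inherit the log-convexity of moment generating functions: integrate
    [two_le_tilt] with [x = e^(s . y)] over a box, pass to the limit, and choose
    [l = M t / M (t + s)]. *)
Lemma box_mgf_log_convex (R : realType) (m : nat)
    (d : nat -> measure_display) (T : forall n, measurableType (d n))
    (P : forall n, probability (T n) R) (Y : forall n, T n -> 'rV[R]_m)
    (c : R) (M : 'rV[R]_m -> R) (t s : 'rV[R]_m) :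
  (forall n, measurable_fun setT (@Y n : T n -> borel_rV R m)) ->
  box_mgf_cvg P Y c M -> (forall t, 0 < M t) ->
  (forall i, 0 < t ord0 i < c) -> (forall i, 0 < (t + s) ord0 i < c) ->
  (forall i, 0 < (t - s) ord0 i < c) ->
  M t ^+ 2 <= M (t + s) * M (t - s).
Proof.
move=> mY YM M0 tc tsc tsc'.
set a := M (t + s); set b := M (t - s); set m0 := M t.
have m0_gt0 : 0 < m0 by exact: M0.
have a_gt0 : 0 < a by exact: M0.
pose l := m0 / a; pose l' := a / m0.
have l0 : 0 < l by rewrite divr_gt0.
have l'0 : 0 < l' by rewrite divr_gt0.
suff : m0 <= l' * b.
  by rewrite /l' mulrAC ler_pdivlMr// expr2.
apply/ler_addgt0Pr => e e0.
pose e' := e / (2 + l + l').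
have e'0 : 0 < e' by rewrite divr_gt0// addr_gt0// addr_gt0.
have ee' : e' * (2 + l + l') = e.
  by rewrite divfK// gt_eqF// addr_gt0// addr_gt0.
have [K1 H1] := YM _ tc _ e'0; have [K2 H2] := YM _ tsc _ e'0.
have [K3 H3] := YM _ tsc' _ e'0.
pose K := Num.max K1 (Num.max K2 K3).
have {}H1 := H1 K; have {}H2 := H2 K; have {}H3 := H3 K.
pose I n u := \int[P n]_(w in @Y n @^-1` box K) expR (dot u (Y n w)).
near \oo => n.
have Hn1 : `|I n t - m0| <= e' by near: n; apply: H1; rewrite le_max lexx.
have Hn2 : `|I n (t + s) - a| <= e' by near: n; apply: H2; rewrite !le_max lexx orbT.
have Hn3 : `|I n (t - s) - b| <= e' by near: n; apply: H3; rewrite !le_max lexx !orbT.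
have mB : measurable (@Y n @^-1` box K) by exact: measurable_preimage_box.
have ei u : (P n).-integrable (@Y n @^-1` box K) (EFin \o (fun w => expR (dot u (Y n w)))).
  exact: box_expdot_integrable.
have zi x u : (P n).-integrable (@Y n @^-1` box K)
    (EFin \o (fun w => x * expR (dot u (Y n w)))).
  by have := integrableZl mB x (ei u); apply: eq_integrable.
have J : 2 * I n t <= l * I n (t + s) + l' * I n (t - s).
  rewrite /I -!RintegralZl// -RintegralD//.
  apply: le_Rintegral => //.
    by have := integrableD mB (zi l (t + s)) (zi l' (t - s)); apply: eq_integrable.
  move=> w _; rewrite !dotDl dotNl !expRD expRN.
  set E := expR (dot t _); set x := expR (dot s _).
  have -> : l' = l^-1 by rewrite /l invf_div.
  by apply: two_le_tilt; rewrite ?expR_gt0.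
have la : l * a = m0 by rewrite divfK// gt_eqF.
move: Hn1 Hn2 Hn3; rewrite !ler_distl => /andP[B0 _] /andP[_ B1] /andP[_ B2].
have {}B1 : l * I n (t + s) <= m0 + l * e' by rewrite -la -mulrDr ler_wpM2l// ltW.
have {}B2 : l' * I n (t - s) <= l' * b + l' * e' by rewrite -mulrDr ler_wpM2l// ltW.
have E1 : e = e' * 2 + l * e' + l' * e' by rewrite -ee'; ring.
rewrite E1; lra.
Unshelve. all: by end_near. Qed.

Lemma quad_parallelogram (R : realType) m (G : 'M[R]_m) (t u : 'rV[R]_m) :
  quad G (t + u) + quad G (t - u) = 2 * (quad G t + quad G u).
Proof.
rewrite /quad -!big_split mulr_sumr; apply: eq_bigr => i _.
rewrite -!big_split mulr_sumr; apply: eq_bigr => j _ /=.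
by rewrite !mxE; ring.
Qed.

Lemma quadZ (R : realType) m (G : 'M[R]_m) (x : R) (t : 'rV[R]_m) :
  quad G (x *: t) = x ^+ 2 * quad G t.
Proof.
rewrite /quad mulr_sumr; apply: eq_bigr => i _; rewrite mulr_sumr.
by apply: eq_bigr => j _; rewrite !mxE; ring.
Qed.

(** Log-convexity of [gauss_mgf G] in the direction [u] is nonnegativity of
    [quad G u], by the parallelogram identity. Thus the covariance matrix of the
    limit is positive semidefinite because it is obtained as a limit. *)
Lemma box_mgf_psd (R : realType) (m : nat)
    (d : nat -> measure_display) (T : forall n, measurableType (d n))
    (P : forall n, probability (T n) R) (Y : forall n, T n -> 'rV[R]_m)
    (c : R) (G : 'M[R]_m) : 0 < c ->
  (forall n, measurable_fun setT (@Y n : T n -> borel_rV R m)) ->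
  box_mgf_cvg P Y c (gauss_mgf G) -> forall u, 0 <= quad G u.
Proof.
move=> c0 mY YG u.
(* Small enough for t + x u and t - x u to stay in the cube. *)
pose x := c / 2 / (1 + \sum_(i < m) `|u ord0 i|).
have S0 : 0 < 1 + \sum_(i < m) `|u ord0 i| by rewrite ltr_pwDl ?sumr_ge0.
have x0 : 0 < x by rewrite !divr_gt0.
have xu i : `|x * u ord0 i| < c / 2.
  rewrite normrM gtr0_norm// /x mulrAC ltr_pdivrMr// ltr_pM2l ?divr_gt0//.
  by rewrite (bigD1 i)//= addrCA ltrDl ltr_pwDl ?sumr_ge0.
pose t : 'rV[R]_m := const_mx (c / 2).
have := @box_mgf_log_convex R m d T P Y c (gauss_mgf G) t (x *: u) mY YG (fun=> expR_gt0 _).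
rewrite -expRM_natl -expRD ler_expR -mulrDr quad_parallelogram quadZ => H.
have : 0 <= x ^+ 2 * quad G u.
  suff : 2%:R * (2^-1 * quad G t) <= 2^-1 * (2 * (quad G t + x ^+ 2 * quad G u)) by lra.
  apply: H => i; have := xu i; rewrite ltr_norml => /andP[h1 h2]; rewrite !mxE.
  - by apply/andP; split; lra.
  - by apply/andP; split; lra.
  - by apply/andP; split; lra.
by rewrite pmulr_rge0// exprn_gt0.
Qed.

Lemma expectation_Rintegral (R : realType) d (T : measurableType d)
    (P : probability T R) (f : T -> R) :
  P.-integrable setT (EFin \o f) -> ('E_P[f] = (\int[P]_w f w)%:E)%E.
Proof. by move=> fi; rewrite unlock /Rintegral fineK//; exact: integrable_fin_num. Qed.

Section multinormal_of_mgf.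
Variables (R : realType) (m : nat) (G : 'M[R]_m).
Hypotheses (G_sym : G^T = G) (G_psd : forall u, 0 <= quad G u).
Variable nu : probability (borel_rV R m) R.
Hypothesis nu_mgf : forall t : 'rV[R]_m,
  (\int[nu]_y (expR (dot t y))%:E = (gauss_mgf G t)%:E)%E.

Let mdot (t : 'rV[R]_m) : measurable_fun setT (dot t : borel_rV R m -> R).
Proof. by apply: continuous_measurable_rV; exact: continuous_dot. Qed.

Lemma expdot_integrable (t : 'rV[R]_m) :
  nu.-integrable setT (fun y : borel_rV R m => (expR (dot t y))%:E).
Proof.
apply/integrableP; split.
  by apply/measurable_EFinP; apply: continuous_measurable_rV; exact: continuous_expdot.
under eq_integral => y _ do rewrite /= ger0_norm ?expR_ge0//.
by rewrite nu_mgf ltry.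
Qed.

Let dot_exp (t : 'rV[R]_m) u :
  nu.-integrable setT (fun y : borel_rV R m => (expR (u * dot t y))%:E).
Proof. by under eq_fun do rewrite -dotZl; exact: expdot_integrable. Qed.

Let dot_mgf (t : 'rV[R]_m) u :
  (\int[nu]_y (expR (u * dot t y))%:E = (expR (2^-1 * quad G t * u ^+ 2))%:E)%E.
Proof.
under eq_integral do rewrite -dotZl.
by rewrite nu_mgf /gauss_mgf quadZ; congr (expR _)%:E; ring.
Qed.

Let dot_Rmgf (t : 'rV[R]_m) u :
  \int[nu]_y expR (u * dot t y) = expR (2^-1 * quad G t * u ^+ 2).
Proof. by rewrite /Rintegral dot_mgf. Qed.

Let dot_int (t : 'rV[R]_m) : nu.-integrable setT (EFin \o (dot t : borel_rV R m -> R)).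
Proof.
have := exp_moment_integrable (mdot t) (dot_exp t) 1 0; apply: eq_integrable => // y _.
by rewrite /= mul0r expR0 mulr1.
Qed.

Let dot2_int (t : 'rV[R]_m) :
  nu.-integrable setT (EFin \o (fun y : borel_rV R m => dot t y ^+ 2)).
Proof.
have := exp_moment_integrable (mdot t) (dot_exp t) 2 0; apply: eq_integrable => // y _.
by rewrite /= mul0r expR0 mulr1.
Qed.

(** Both sides have the moment generating function of the centred normal law with
    variance [quad G t]. *)
Let dot_law (t : 'rV[R]_m) (A : set R) : measurable A ->
  nu [set y | A (dot t y)] = normal_law 0 (Num.sqrt (quad G t)) A.
Proof.
move=> mA.
have mX : measurable_fun setT (dot t : borel_rV R m -> measurableTypeR R) by exact: mdot.
pose X : {mfun borel_rV R m >-> measurableTypeR R} := mfun_Sub (mem_set mX).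
rewrite -[LHS]/(distribution nu X A).
have X_mgf u : (\int[distribution nu X]_x (expR (u * x))%:E =
    (expR (2^-1 * quad G t * u ^+ 2))%:E)%E.
  rewrite ge0_integral_distribution//=.
  by apply/measurable_EFinP; apply: measurableT_comp => //; exact: mulrl_measurable.
rewrite /normal_law; case: ifPn => [/eqP s0|s0].
  apply: (mgf_law_unique X_mgf (mu2 := \d_(0 : measurableTypeR R))) => // u.
  rewrite integral_dirac//=; last first.
    by apply/measurable_EFinP; apply: measurableT_comp => //; exact: mulrl_measurable.
  rewrite diracT mul1e mulr0 expR0.
  by rewrite -[quad G t]sqr_sqrtr// s0 expr0n mulr0 mul0r expR0.
apply: (mgf_law_unique X_mgf) => // u.
by rewrite normal_prob_mgf// exprMn sqr_sqrtr// mulrA.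
Qed.

(** The moment generating function determines the laws of the linear combinations of
    the coordinates, and its derivatives give their first two moments. *)
Lemma multinormal_of_mgf : multinormal nu G.
Proof.
have coordE i : (fun y : 'rV[R]_m => y ord0 i) = dot (delta_mx ord0 i).
  by apply/funext => y; rewrite dot_delta.
have mean0 i : ('E_nu[fun y : 'rV[R]_m => y ord0 i] = 0)%E.
  rewrite coordE expectation_Rintegral; last exact: dot_int.
  congr EFin.
  exact: (gauss_mean (mdot _) (dot_exp _) (dot_Rmgf _)).
split => //.
  move=> t; exists 0, (Num.sqrt (quad G t)); split; first exact: sqrtr_ge0.
  by move=> A mA; exact: dot_law.
move=> i j; rewrite unlock !mean0.
(* Polarization: a product of coordinates from squares of linear forms. *)
pose e k : 'rV[R]_m := delta_mx ord0 k.
pose h (y : borel_rV R m) := 2^-1 * (dot (e i + e j) y ^+ 2 - dot (e i) y ^+ 2 - dot (e j) y ^+ 2).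
have -> : ((fun y : 'rV[R]_m => y ord0 i) \- cst (fine 0%E)) *
    ((fun y : 'rV[R]_m => y ord0 j) \- cst (fine 0%E)) = h.
  apply/funext => y; rewrite /h dotDl !dot_delta.
  transitivity (y ord0 i * y ord0 j); last by field.
  by rewrite -[y ord0 i in RHS]subr0 -[y ord0 j in RHS]subr0.
have i1 := integrableB measurableT (dot2_int (e i + e j)) (dot2_int (e i)).
have i2 := integrableB measurableT i1 (dot2_int (e j)).
have sm t : \int[nu]_y (dot t y ^+ 2) = quad G t.
  exact: (gauss_second_moment (mdot _) (dot_exp _) (dot_Rmgf _)).
rewrite expectation_Rintegral; last first.
  by have := integrableZl measurableT 2^-1 i2; apply: eq_integrable.
have i1' : nu.-integrable setT (EFin \o (fun y : borel_rV R m =>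
    dot (e i + e j) y ^+ 2 - dot (e i) y ^+ 2)) by move: i1; apply: eq_integrable.
have i2' : nu.-integrable setT (EFin \o (fun y : borel_rV R m =>
    dot (e i + e j) y ^+ 2 - dot (e i) y ^+ 2 - dot (e j) y ^+ 2)).
  by move: i2; apply: eq_integrable.
congr EFin; rewrite /h RintegralZl// RintegralB//.
rewrite RintegralB//.
have eij : e i + e j = e i + 1 *: delta_mx ord0 j by rewrite scale1r.
rewrite !sm eij quad_shift// !quad_delta dotC dot_delta mxE.
have -> : G j i = G i j by rewrite -{1}G_sym mxE.
by field.
Qed.

End multinormal_of_mgf.

Theorem theoremA1 (R : realType) (m : nat)
    (d : nat -> measure_display) (T : forall n, measurableType (d n))
    (P : forall n, probability (T n) R)
    (X : 'I_m -> forall n, {RV (P n) >-> R})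
    (X_ge0 : forall i n w, 0 <= X i n w)
    (mu sigma : 'I_m -> R^nat)
    (mu_gt0 : forall i n, 0 < mu i n)
    (sigma_gt0 : forall i n, 0 < sigma i n)
    (sigma_ll_mu : forall i, much_less (sigma i) (mu i))
    (mu_ll_sigma3 : forall i, much_less (mu i) (fun n => sigma i n ^+ 3))
    (Gamma : 'M[R]_m) (Gamma_sym : Gamma^T = Gamma)
    (c : R) (c_gt0 : 0 < c)
    (factorial_moments : forall eps : R, 0 < eps ->
       \forall n \near \oo, forall k : 'I_m -> nat,
         (forall i, (k i)%:R <= c * mu i n / sigma i n) ->
         exists2 r : R, `|r| < eps &
           'E_(P n)[(fun w => \prod_(i < m) falling (X i n w) (k i))%R]%E =
           (\prod_(i < m) mu i n ^+ k i *
            expR (2^-1 * (\sum_(i < m) \sum_(j < m)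
                    (Gamma i j * sigma i n * sigma j n
                     - (i == j)%:R * mu i n) / (mu i n * mu j n)
                    * (k i)%:R * (k j)%:R) + r))%:E) :
  exists nu : probability (borel_rV R m) R,
    multinormal nu Gamma /\
    cvg_in_distribution P
      (fun n w => \row_(i < m) ((X i n w - mu i n) / sigma i n)) nu.
Proof.
have YG := standardized_mgf_cvg X_ge0 mu_gt0 sigma_gt0 sigma_ll_mu mu_ll_sigma3
  c_gt0 factorial_moments.
have mY n := @measurable_standardized R m d T P X mu sigma n.
have psd := box_mgf_psd c_gt0 mY YG.
have [s sE] := psd_sum_sqr Gamma_sym psd.
have [nu nu_mgf'] := gauss_law_exists s.
have nu_mgf t : (\int[nu]_y (expR (dot t y))%:E = (gauss_mgf Gamma t)%:E)%E.
  by rewrite nu_mgf' /gauss_mgf sE.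
exists nu; split; first exact: multinormal_of_mgf.
move=> f fc [M fM].
have id_m : measurable_fun setT (id : borel_rV R m -> borel_rV R m) by exact: measurable_id.
have YZ : box_mgf_cvg P (fun n w => \row_(i < m) ((X i n w - mu i n) / sigma i n)) c
    (fun t => \int[nu]_y expR (dot t y)).
  move=> t tc e e0; rewrite /Rintegral nu_mgf; exact: YG.
have H := mgf_cvg_in_law c_gt0 mY id_m (fun t _ => expdot_integrable nu_mgf t) YZ fc fM.
rewrite expectation_Rintegral; last exact: (bounded_comp_integrable nu id_m fc fM).
under eq_fun => n.
  rewrite (expectation_Rintegral (bounded_comp_integrable (P n) (mY n) fc fM)).
  over.
by apply: cvg_EFin; [exact: nearW|exact: H].
Qed.
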